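(* Let $\gamma\in(1/2,1]$ and $T>0$. Suppose $u\in\mathcal C^0([0,T];H^{1+\gamma}(\mathbb T))$ is the solution of $iu_t+u_{xx}+\frac12|u|^2u=0$, $u(0)=u_0$, on $\mathbb T=\mathbb R/(2\pi\mathbb Z)$, and that $\mathbf T,\mathbf e_1,\mathbf e_2\in\mathcal C^0([0,T];H^1(\mathbb T))$ is the solution of the linear system $$\mathsf y_t(t,x)=\mathsf A(t,x)\mathsf y(t,x),\quad \mathsf y=\begin{pmatrix}\mathbf T\\\mathbf e_1\\\mathbf e_2\end{pmatrix},\quad \mathsf A=\begin{pmatrix}0&-\mathrm{Im}\,u_x&\mathrm{Re}\,u_x\\ \mathrm{Im}\,u_x&0&-\frac{|u|^2}2\\-\mathrm{Re}\,u_x&\frac{|u|^2}2&0\end{pmatrix}$$ with orthonormal initial frame $\mathbf T_0,\mathbf e_{1,0},\mathbf e_{2,0}$. Let $M=T/h$, $t_m=mh$, $R=\sup_{t\in[0,t_M]}\|u(t)\|_{H^{1+\gamma}}$, and denote by $\mathbf T_m$ the first row of $\mathsf y_m$ computed by Scheme B (see context). Then there exist $h_0>0$ and $C>0$ depending on $\gamma,R$ (with $T$ regarded as fixed) such that for any $0<h<h_0$ and every $0\le m\le M$ $$\|\mathbf T_m-\mathbf T(mh)\|_{L^2(\mathbb T;\ell^2)}\le Ch^\gamma.$$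
   Context: $\|f\|^2_{L^2(\mathbb T;\ell^2)}=\int_{\mathbb T}\|f(x)\|_{\ell^2}^2dx$ with $\ell^2$ the Euclidean norm. $\mathbf T,\mathbf e_1,\mathbf e_2$ are row vectors in $\mathbb R^3$. $\varphi_1(z)=(e^z-1)/z$ for $z\neq0$, $\varphi_1(0)=1$; functions of $\partial_x^2$ are Fourier multipliers (replace $\partial_x^2$ by $-k^2$ on $e^{ikx}$); $\hat w_k=\frac1{2\pi}\int_{\mathbb T}w(x)e^{-ikx}dx$. The step size $h$ is such that $M=T/h\in\mathbb N$. Scheme B. (1) NLS: $u_0^{(approx)}=u_0$, and $w=u^{(approx)}_{m+1}$ is obtained from $v=u^{(approx)}_m$ by solving $$w=e^{ih\partial_x^2}v+i\tfrac h4e^{ih\partial_x^2}\left[v^2\varphi_1(-ih\partial_x^2)\overline v\right]+i\tfrac h4\left[w^2\varphi_1(ih\partial_x^2)\overline w\right]$$ by fixed-point iteration started at $e^{ih\partial_x^2}v$ (the solution is the limit of the iteration). (2) Frame: $\mathsf y_0=(\mathbf T_0,\mathbf e_{1,0},\mathbf e_{2,0})$ (as rows) and $$\mathsf y_{m+1}=\exp\left(\mathcal Q_h^{(\text{low-reg})}[\mathsf H_1;(u^{(approx)}_m,u^{(approx)}_{m+1})]\right)\mathsf y_m ,$$ where, for functions $v,w$ on $\mathbb T$ (values at $t_m$ and $t_{m+1}$), $$\mathcal Q_h^{(\text{low-reg})}[\mathsf H_1;(v,w)]=\begin{pmatrix}0&-\mathrm{Im}\,\mathcal Q_1&\mathrm{Re}\,\mathcal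 Q_1\\ \mathrm{Im}\,\mathcal Q_1&0&-\frac12\mathcal Q_2\\-\mathrm{Re}\,\mathcal Q_1&\frac12\mathcal Q_2&0\end{pmatrix},\qquad \mathcal Q_1=h\varphi_1(ih\partial_x^2)\frac{e^{-ih\partial_x^2}\partial_xw+\partial_xv}2,$$ $$\mathcal Q_2=\sum_{l\in\mathbb Z}e^{ilx}\Bigg[\sum_{\substack{l=k_1-k_2\\k_1^2\ge k_2^2}}h\varphi_1(-ihk_1^2)\frac{e^{ihk_1^2}\hat w_{k_1}+\hat v_{k_1}}2\,\frac{\overline{\hat w_{k_2}}+\overline{\hat v_{k_2}}}2+\sum_{\substack{l=k_1-k_2\\k_1^2<k_2^2}}h\varphi_1(ihk_2^2)\frac{\hat w_{k_1}+\hat v_{k_1}}2\,\frac{\overline{e^{ihk_2^2}\hat w_{k_2}}+\overline{\hat v_{k_2}}}2\Bigg].$$ *)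

(* Defs.v *)
From mathcomp Require Import all_boot all_order all_algebra.
From mathcomp Require Import complex.
From mathcomp Require Import all_classical all_reals all_analysis.
Set Implicit Arguments.
Unset Strict Implicit.
Unset Printing Implicit Defensive.
Import Order.TTheory GRing.Theory Num.Theory.
Import numFieldNormedType.Exports.
Local Open Scope classical_set_scope.
Local Open Scope ring_scope.
Local Open Scope complex_scope.

Section ComplexAnalysis.
Variable R : realType.
Implicit Types (z : R[i]) (f : R -> R[i]).

Definition sqmodulus z : R := complex.Re z ^+ 2 + complex.Im z ^+ 2.

Definition cexp z : R[i] :=
  (expR (complex.Re z) * cos (complex.Im z))
    +i* (expR (complex.Re z) * sin (complex.Im z)).

Definition phi1 z : R[i] := if z == 0 then 1 else (cexp z - 1) / z.

(* Limits, derivatives and continuity of complex-valued functions are taken on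
   real and imaginary parts. *)
Definition clim (a : nat -> R[i]) : R[i] :=
  (limn (fun n => complex.Re (a n))) +i* (limn (fun n => complex.Im (a n))).

Definition ccontinuous f : Prop :=
  continuous (fun x : R => complex.Re (f x))
  /\ continuous (fun x : R => complex.Im (f x)).

Definition is_cderive f (t : R) (d : R[i]) : Prop :=
  is_derive t (1 : R) (fun s : R => complex.Re (f s)) (complex.Re d)
  /\ is_derive t (1 : R) (fun s : R => complex.Im (f s)) (complex.Im d).

(* Sum over Z as the limit of the symmetric partial sums over -N <= k <= N. *)
Definition csumZ (a : int -> R[i]) : R[i] :=
  clim (fun N => \sum_(j < N.*2.+1) a (j%:Z - N%:Z)).

Definition cmexp (A : 'M[R[i]]_3) : 'M[R[i]]_3 :=
  \matrix_(i, j) clim (fun n => (\sum_(k < n) (k`!%:R^-1 *: A ^+ k)) i j).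

End ComplexAnalysis.

(* Functions on the torus R/(2 pi Z) are 2 pi-periodic functions on R, and
   integrals over the torus are integrals over [0, 2 pi]. *)
Section Torus.
Variable R : realType.
Implicit Types (f g v w : R -> R[i]) (s : R) (k : int).

Definition torus : set R := `[0, 2 * pi]%classic.

Definition tint f : R[i] :=
  (\int[@lebesgue_measure R]_(x in torus) complex.Re (f x))%R
    +i* (\int[@lebesgue_measure R]_(x in torus) complex.Im (f x))%R.

Definition echar k (x : R) : R[i] := cexp (0 +i* (k%:~R * x)).

Definition fourier f k : R[i] :=
  ((2 * pi)^-1)%:C * tint (fun x => f x * echar (- k) x).

Definition sobolev_sqnorm s f : \bar R :=
  \esum_(k in [set: int])
    (((1 + k%:~R ^+ 2) `^ s * sqmodulus (fourier f k))%:E).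

Definition sobolev_norm s f : R := Num.sqrt (fine (sobolev_sqnorm s f)).

(* Membership in H^s for s > 1/2: by the Sobolev embedding each class then has
   exactly one continuous representative, and it is the one considered. *)
Definition sobolev s f : Prop :=
  [/\ forall x, f (x + 2 * pi) = f x,
      ccontinuous f
    & (sobolev_sqnorm s f < +oo)%E].

(* C^0([0, T]; H^s); nothing is required for times outside [0, T]. *)
Definition C0_sobolev (T s : R) (u : R -> R -> R[i]) : Prop :=
  (forall t, 0 <= t <= T -> sobolev s (u t))
  /\ (forall t, 0 <= t <= T ->
        (fun r : R => sobolev_norm s (fun x => u r x - u t x))
          @ within `[0, T]%classic (nbhs t) --> (0 : R)).

(* The Fourier multiplier m(d_x^2). *)
Definition fun_dxx (m : R -> R[i]) f (x : R) : R[i] :=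
  csumZ (fun k => m (- k%:~R ^+ 2) * fourier f k * echar k x).

(* d_x as a Fourier multiplier; it is the classical derivative on H^s for
   s > 3/2, where the series converges absolutely. *)
Definition dx f (x : R) : R[i] :=
  csumZ (fun k => 'i%C * k%:~R * fourier f k * echar k x).

(* e^{i h d_x^2} and phi_1(i h d_x^2) *)
Definition schroedinger (h : R) f : R -> R[i] :=
  fun_dxx (fun z => cexp ('i%C * (h * z)%:C)) f.

Definition phi1_dxx (h : R) f : R -> R[i] :=
  fun_dxx (fun z => phi1 ('i%C * (h * z)%:C)) f.

(* i u_t + u_xx + |u|^2 u / 2 = 0 on (0, T).  As u is only in H^{1+gamma}, u_xx
   is a distribution, and the equation is read in the sense of distributions on
   the torus: it is tested against e^{-ikx} for every k. *)
Definition nls_solution (T : R) (u : R -> R -> R[i]) : Prop :=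
  forall t, 0 < t < T -> forall k, exists ut_k : R[i],
    is_cderive (fun r => fourier (u r) k) t ut_k
    /\ 'i%C * ut_k - k%:~R ^+ 2 * fourier (u t) k
       + 2^-1 * fourier (fun x => (sqmodulus (u t x))%:C * u t x) k = 0.

End Torus.

Section Frame.
Variable R : realType.

Definition rows3 (a b c : 'rV[R]_3) : 'M[R]_3 :=
  \matrix_(i < 3) nth 0 [:: a; b; c] i.

Definition skew3 (K : pzRingType) (p q r : K) : 'M[K]_3 :=
  \matrix_(i < 3, j < 3)
    nth 0 (nth [::] [:: [:: 0; - p; q];
                        [:: p; 0; - r];
                        [:: - q; r; 0]] i) j.

Definition frame_matrix (u : R -> R[i]) (x : R) : 'M[R]_3 :=
  skew3 (complex.Im (dx u x)) (complex.Re (dx u x)) (sqmodulus (u x) / 2).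

(* y_t = A y on (0, T), pointwise in x. *)
Definition frame_solution (T : R) (u : R -> R -> R[i])
    (y : R -> R -> 'M[R]_3) : Prop :=
  forall t, 0 < t < T -> forall x : R,
    is_derive t (1 : R) (fun r : R => y r x : 'M[R]_3)
      (frame_matrix (u t) x *m y t x).

Definition C0_sobolev_row (T s : R) (a : R -> R -> 'rV[R]_3) : Prop :=
  forall j, C0_sobolev T s (fun t x => (a t x 0 j)%:C).

Definition orthonormal_rows (y : 'M[R]_3) : Prop := y *m y^T = 1%:M.

End Frame.

Section SchemeB.
Variables (R : realType) (h : R).
Implicit Types (v w : R -> R[i]).

Definition nls_rhs v w (x : R) : R[i] :=
  schroedinger h v x
  + 'i%C * (h / 4)%:C
    * schroedinger h (fun y => v y ^+ 2 * phi1_dxx (- h) (fun z => (v z)^*%C) y) x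
  + 'i%C * (h / 4)%:C
    * (w x ^+ 2 * phi1_dxx h (fun z => (w z)^*%C) x).

Definition nls_step v : R -> R[i] :=
  fun x => clim (fun n => iter n (nls_rhs v) (schroedinger h v) x).

Definition nls_num (u0 : R -> R[i]) (m : nat) : R -> R[i] :=
  iter m nls_step u0.

Definition Q1 v w : R -> R[i] := fun x =>
  h%:C * phi1_dxx h (fun y => (schroedinger (- h) (dx w) y + dx v y) / 2) x.

(* The pairs with k1 - k2 = l are parametrised by k1. *)
Definition Q2_coef v w (l : int) : R[i] :=
  csumZ (fun k1 => let k2 := k1 - l in
    if k2 ^+ 2 <= k1 ^+ 2 then
      h%:C * phi1 (- ('i%C * (h * k1%:~R ^+ 2)%:C))
      * ((cexp ('i%C * (h * k1%:~R ^+ 2)%:C) * fourier w k1 + fourier v k1) / 2)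
      * (((fourier w k2)^*%C + (fourier v k2)^*%C) / 2)
    else 0)
  + csumZ (fun k1 => let k2 := k1 - l in
    if k1 ^+ 2 < k2 ^+ 2 then
      h%:C * phi1 ('i%C * (h * k2%:~R ^+ 2)%:C)
      * ((fourier w k1 + fourier v k1) / 2)
      * (((cexp ('i%C * (h * k2%:~R ^+ 2)%:C) * fourier w k2)^*%C
          + (fourier v k2)^*%C) / 2)
    else 0).

Definition Q2 v w : R -> R[i] := fun x =>
  csumZ (fun l => echar l x * Q2_coef v w l).

(* Q2 is not real-valued in general: the terms with k1^2 = k2^2 all belong to
   the first sum and need not be conjugate-symmetric.  Hence the matrix, and
   with it the numerical frame, has complex entries. *)
Definition Qlowreg v w (x : R) : 'M[R[i]]_3 :=
  skew3 (complex.Im (Q1 v w x))%:C (complex.Re (Q1 v w x))%:C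
        (2^-1 * Q2 v w x).

Fixpoint frame_num (u0 : R -> R[i]) (y0 : R -> 'M[R]_3) (m : nat) (x : R)
    : 'M[R[i]]_3 :=
  if m is n.+1 then
    cmexp (Qlowreg (nls_num u0 n) (nls_num u0 n.+1) x) *m frame_num u0 y0 n x
  else map_mx (fun a : R => a%:C) (y0 x).

End SchemeB.

Definition L2_norm (R : realType) (a : R -> 'rV[R[i]]_3) : \bar R :=
  ((\int[@lebesgue_measure R]_(x in @torus R)
      (\sum_(j < 3) sqmodulus (a x 0 j))%R%:E) `^ (2^-1)%R)%E.

(* Main.v *)
(* All estimates are made on Fourier coefficients.

   For the Schroedinger equation, the twisted coefficients e^{i k^2 t} u_k are
   Lipschitz in time with values in H^{1 + gam}.  In the Duhamel integral the
   scheme integrates the phase of the conjugated factor exactly; the remaining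
   phases are products of two frequencies, and |e^{i s c} - 1| <= 2 |s c|^gam
   makes the defect of one step O(h^{1 + gam}) in H^1.  Since H^1 is an algebra,
   the step is stable in H^1, whence an error O(h^gam) in H^1.

   For the frame, the s-derivative of the quadrature over [t, t + s], evaluated at
   the exact solution, is the matrix of the frame system up to O(s), because the
   twisted coefficients, with one derivative, are Lipschitz in l^1.  By the mean
   value theorem, one step with exact data has a pointwise error O(h^2).
   Replacing the exact data by numerical ones changes Q2 by O(h^{1 + gam})
   uniformly in x, but Q1, which contains a derivative, by a function that is
   O(h^{1 + gam}) only in L^2.  The smoothing of phi_1 makes it O(h^{1/2 + gam}),
   hence O(h), uniformly in x, which is enough for a Gronwall argument at fixed
   x; the L^2 norms are taken only afterwards, by Parseval. *)

Require Import Defs.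
From mathcomp Require Import all_boot all_order all_algebra.
From mathcomp Require Import complex.
From mathcomp Require Import all_classical all_reals all_analysis.
From mathcomp Require Import ring lra zify.
Import Order.TTheory GRing.Theory Num.Theory.
Import numFieldNormedType.Exports.
Local Open Scope classical_set_scope.
Local Open Scope ring_scope.
Local Open Scope complex_scope.
Set Implicit Arguments.
Unset Strict Implicit.
Unset Printing Implicit Defensive.

(** * Complex numbers and summable families *)

(** All constants must depend on [gamma], [T] and the bound on u alone, but the available H^{1 +
    gam} bound of the numerical solution triples at each step ([fixed_point]). It is therefore used
    only qualitatively, to make the series of the x-derivatives in Q1 absolutely convergent; the
    constants come from H^1 bounds. The condition gam > 1/2 makes the coefficients of u_x summable
    and gives sqrt h * h^gam <= h. The two brackets of the implicit step are two half steps, one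
    forward from t_m and one backward from t_{m+1} for the time-reversed conjugate solution; they
    meet at the midpoint, whence h / 4 and the opposite signs in phi_1. In Q2 the phase that is
    integrated exactly belongs to the higher frequency. The factor k^2 left on the lower frequency
    is then shared, one derivative for each factor. Stability of the frame step rests instead on exp
    Q = 1 + Q + O(|Q|^2) with |Q| = O(h) uniformly in x, and the size of the exact frame on
    conservation of its column norms. *)

Notation cn := (@Normc.normc _).

Section ComplexModulus.
Variable R : realType.
Implicit Types (x y z : R[i]) (r t : R).

Lemma cnE z : cn z = Num.sqrt (sqmodulus z).
Proof. by case: z. Qed.

Lemma sqmodulusE z : sqmodulus z = cn z ^+ 2.
Proof. by rewrite cnE sqr_sqrtr // addr_ge0 ?sqr_ge0. Qed.

Lemma cn_ge0 z : 0 <= cn z.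
Proof. by rewrite cnE sqrtr_ge0. Qed.

Lemma cn0 : cn (0 : R[i]) = 0. Proof. exact: Normc.normc0. Qed.
Lemma cn1 : cn (1 : R[i]) = 1. Proof. exact: Normc.normc1. Qed.
Lemma cnM x y : cn (x * y) = cn x * cn y. Proof. exact: Normc.normcM. Qed.
Lemma cnN z : cn (- z) = cn z. Proof. exact: normcN. Qed.
Lemma cnD x y : cn (x + y) <= cn x + cn y. Proof. exact: le_normcD. Qed.
Lemma cnB x y : cn (x - y) <= cn x + cn y.
Proof. by rewrite -[cn y]cnN cnD. Qed.
Lemma cnC x y : cn (x - y) = cn (y - x). Proof. by rewrite -cnN opprB. Qed.

Lemma cn_real r : cn r%:C = `|r|.
Proof. by rewrite cnE /sqmodulus /= expr0n addr0 sqrtr_sqr. Qed.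

Lemma cn_pos r : 0 <= r -> cn r%:C = r.
Proof. by move=> r0; rewrite cn_real ger0_norm. Qed.

Lemma cn_i : cn ('i%C : R[i]) = 1.
Proof. by rewrite cnE /sqmodulus /= expr0n expr1n add0r sqrtr1. Qed.

Lemma cn_conj z : cn (z^*)%C = cn z.
Proof. by case: z => a b; rewrite !cnE /sqmodulus /= sqrrN. Qed.

Lemma cn0_eq0 z : cn z = 0 -> z = 0. Proof. exact: Normc.eq0_normc. Qed.

Lemma cnV z : cn z^-1 = (cn z)^-1. Proof. exact: Normc.normcV. Qed.

Lemma Re_le_cn z : `|complex.Re z| <= cn z.
Proof.
by rewrite cnE -[X in X <= _]sqrtr_sqr ler_wsqrtr // /sqmodulus lerDl sqr_ge0.
Qed.

Lemma Im_le_cn z : `|complex.Im z| <= cn z.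
Proof.
by rewrite cnE -[X in X <= _]sqrtr_sqr ler_wsqrtr // /sqmodulus lerDr sqr_ge0.
Qed.

Lemma cn_le_ReIm z : cn z <= `|complex.Re z| + `|complex.Im z|.
Proof.
rewrite -ler_sqr ?nnegrE ?addr_ge0 ?cn_ge0 // -sqmodulusE /sqmodulus.
rewrite sqrrD !real_normK ?num_real //.
by rewrite -addrA [_ *+ 2 + _]addrC addrA lerDl mulrn_wge0 // mulr_ge0.
Qed.

Lemma cn_sum (I : Type) (s : seq I) (f : I -> R[i]) :
  cn (\sum_(i <- s) f i) <= \sum_(i <- s) cn (f i).
Proof.
elim: s => [|i s IH]; first by rewrite !big_nil cn0.
by rewrite !big_cons (le_trans (cnD _ _)) // lerD2l.
Qed.

Lemma ReD x y : complex.Re (x + y) = complex.Re x + complex.Re y.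
Proof. by case: x; case: y. Qed.
Lemma ImD x y : complex.Im (x + y) = complex.Im x + complex.Im y.
Proof. by case: x; case: y. Qed.
Lemma ReN x : complex.Re (- x) = - complex.Re x. Proof. by case: x. Qed.
Lemma ImN x : complex.Im (- x) = - complex.Im x. Proof. by case: x. Qed.
Lemma ReM x y : complex.Re (x * y) =
  complex.Re x * complex.Re y - complex.Im x * complex.Im y.
Proof. by case: x; case: y. Qed.
Lemma ImM x y : complex.Im (x * y) =
  complex.Re x * complex.Im y + complex.Im x * complex.Re y.
Proof. by case: x => a b; case: y => c d /=; rewrite [b * c]mulrC [c * b]mulrC. Qed.
Lemma ReJ x : complex.Re (x^*)%C = complex.Re x. Proof. by case: x. Qed.
Lemma ImJ x : complex.Im (x^*)%C = - complex.Im x. Proof. by case: x. Qed.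

Lemma Re_sum (I : Type) (s : seq I) (f : I -> R[i]) :
  complex.Re (\sum_(i <- s) f i) = \sum_(i <- s) complex.Re (f i).
Proof. by elim/big_ind2: _ => // ? ? ? ? <- <-; rewrite ReD. Qed.
Lemma Im_sum (I : Type) (s : seq I) (f : I -> R[i]) :
  complex.Im (\sum_(i <- s) f i) = \sum_(i <- s) complex.Im (f i).
Proof. by elim/big_ind2: _ => // ? ? ? ? <- <-; rewrite ImD. Qed.

Lemma conjD x y : (x + y)^*%C = x^*%C + y^*%C. Proof. exact: raddfD. Qed.
Lemma conjM x y : (x * y)^*%C = x^*%C * y^*%C. Proof. exact: rmorphM. Qed.
Lemma conjN x : (- x)^*%C = - x^*%C. Proof. exact: raddfN. Qed.

Lemma complex_ext x y : complex.Re x = complex.Re y ->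
  complex.Im x = complex.Im y -> x = y.
Proof. by case: x => a b; case: y => c d /= -> ->. Qed.

Lemma realcM (s t : R) : (s * t)%:C = s%:C * t%:C. Proof. exact: rmorphM. Qed.
Lemma realcD (s t : R) : (s + t)%:C = s%:C + t%:C. Proof. exact: rmorphD. Qed.

Lemma mulconj x : x * (x^*)%C = (sqmodulus x)%:C.
Proof.
by apply: complex_ext; rewrite ?ReM ?ImM ReJ ImJ /sqmodulus /=; ring.
Qed.

Definition eit t : R[i] := cos t +i* sin t.

Lemma cexp_eit t : cexp ('i%C * t%:C) = eit t.
Proof.
rewrite /cexp /eit ReM ImM /=.
by rewrite !mul0r !mulr0 subr0 expR0 mul1r add0r !mul1r.
Qed.

Lemma eit0 : eit 0 = 1. Proof. by rewrite /eit cos0 sin0. Qed.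

Lemma eitD s t : eit (s + t) = eit s * eit t.
Proof.
by apply: complex_ext; rewrite ?ReM ?ImM /= ?cosD ?sinD //; ring.
Qed.

Lemma eitN t : eit (- t) = ((eit t)^*)%C.
Proof. by rewrite /eit cosN sinN. Qed.

Lemma cn_eit t : cn (eit t) = 1.
Proof. by rewrite cnE /sqmodulus /= cos2Dsin2 sqrtr1. Qed.

Lemma eitNK t : eit (- t) * eit t = 1.
Proof. by rewrite -eitD addNr eit0. Qed.

Lemma ler_cn_lim (u : nat -> R[i]) z c :
  (fun n => cn (u n - z)) @ \oo --> (0 : R) ->
  (forall n, cn (u n) <= c) -> cn z <= c.
Proof.
move=> uz uc; apply/ler_addgt0Pr => e e0.
have /cvgrPdist_lt /(_ e e0) [n _ /(_ n (leqnn n))] := uz.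
rewrite sub0r normrN ger0_norm ?cn_ge0 // => /ltW h.
rewrite (_ : z = u n + (z - u n)); last by rewrite addrC subrK.
by rewrite (le_trans (cnD _ _)) // lerD // cnC.
Qed.

End ComplexModulus.

(** * Summability with explicit bounds, and Cauchy-Schwarz on finite sums *)

Section FiniteSums.
Variables (R : realType) (I : eqType).
Implicit Types (s t : seq I) (x y z : I -> R).

Lemma sum_subset s t x : uniq s -> uniq t -> {subset s <= t} ->
  (forall i, 0 <= x i) -> \sum_(i <- s) x i <= \sum_(i <- t) x i.
Proof.
move=> us ut st x0; rewrite [X in _ <= X](bigID (mem s)) /=.
have -> : \sum_(i <- t | i \in s) x i = \sum_(i <- s) x i.
  rewrite -big_filter; apply: perm_big; apply: uniq_perm => //.
    exact: filter_uniq.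
  by move=> i; rewrite mem_filter; apply/andP/idP => [[]//|si]; split=> //; exact: st.
by rewrite lerDl sumr_ge0.
Qed.

(** Absolute summability in quantitative form. Since all finite duplicate-free sums are bounded, no
    order of summation is chosen and reindexing by an injection is immediate. *)
Definition l1le x (C : R) := forall s, uniq s -> \sum_(i <- s) `|x i| <= C.
(** The sign of [B] is recorded because the second clause sees only [B ^+ 2]; for [l1le] the empty
    sequence already gives it. *)
Definition l2le x (B : R) :=
  0 <= B /\ forall s, uniq s -> \sum_(i <- s) x i ^+ 2 <= B ^+ 2.

Lemma l1le_ge0 x C : l1le x C -> 0 <= C.
Proof. by move=> /(_ [::] isT); rewrite big_nil. Qed.

Lemma l2le_ge0 x B : l2le x B -> 0 <= B. Proof. by case. Qed.

Lemma l1le_le x y C : (forall i, `|x i| <= `|y i|) -> l1le y C -> l1le x C.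
Proof. by move=> xy yC s us; rewrite (le_trans _ (yC s us)) // ler_sum. Qed.

Lemma l1leD x y z C D : (forall i, `|z i| <= `|x i| + `|y i|) ->
  l1le x C -> l1le y D -> l1le z (C + D).
Proof.
move=> zxy xC yD s us; rewrite (le_trans _ (lerD (xC s us) (yD s us))) //.
by rewrite -big_split /= ler_sum.
Qed.

Lemma l1leZ x y (c C : R) : 0 <= c -> (forall i, `|y i| <= c * `|x i|) ->
  l1le x C -> l1le y (c * C).
Proof.
move=> c0 yx xC s us; rewrite (le_trans _ (ler_wpM2l c0 (xC s us))) //.
by rewrite mulr_sumr ler_sum.
Qed.

Lemma l1le_pt x C i : l1le x C -> `|x i| <= C.
Proof. by move=> /(_ [:: i] isT); rewrite big_seq1. Qed.

Lemma l1le_inj x C (f : I -> I) : injective f -> l1le x C -> l1le (x \o f) C.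
Proof.
move=> fI xC s us; have := xC (map f s); rewrite map_inj_uniq // => /(_ us).
by rewrite big_map.
Qed.

Lemma sqr_norm_le x y : (forall i, `|x i| <= `|y i|) ->
  forall i, x i ^+ 2 <= y i ^+ 2.
Proof. by move=> h i; rewrite -[x i ^+ 2]ger0_norm ?sqr_ge0 // -[y i ^+ 2]ger0_norm ?sqr_ge0 // !normrX lerXn2r ?nnegrE. Qed.

Lemma l2le_le x y B : (forall i, `|x i| <= `|y i|) -> l2le y B -> l2le x B.
Proof.
move=> xy [B0 yB]; split=> // s us; rewrite (le_trans _ (yB s us)) // ler_sum //.
by move=> i _; exact: sqr_norm_le.
Qed.

Lemma l2leW x B D : B <= D -> l2le x B -> l2le x D.
Proof.
move=> BD [B0 xB]; have D0 := le_trans B0 BD; split=> // s us.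
by rewrite (le_trans (xB s us)) // lerXn2r ?nnegrE.
Qed.

Lemma CauchySchwarz_seq s x y A B : 0 <= A -> 0 <= B ->
  \sum_(i <- s) x i ^+ 2 <= A ^+ 2 -> \sum_(i <- s) y i ^+ 2 <= B ^+ 2 ->
  \sum_(i <- s) x i * y i <= A * B.
Proof.
move=> A0 B0 xA yB; apply/ler_addgt0Pr => e e0.
(* AM-GM: 2 x y <= x^2 b/a + y^2 a/b with a > A and b > B *)
have [d d0 dP] : exists2 d, 0 < d & (A + d) * (B + d) <= A * B + e.
  have [d0 d1] : 0 < e / (A + B + 1 + e) /\ e / (A + B + 1 + e) <= 1.
    by split; [rewrite divr_gt0 //; lra|rewrite ler_pdivrMr; lra].
  (* With this choice [d <= 1], so the excess [d * (A + B + d)] of [(A + d) * (B + d)] over [A * B]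
     is at most [d * (A + B + 1) <= e]. *)
  exists (e / (A + B + 1 + e)) => //; set d := e / _ in d0 d1 *.
  have : d * (A + B + 1 + e) = e by rewrite /d divfK //; lra.
  nra.
apply: le_trans dP; set a := A + d; set b := B + d.
have a0 : 0 < a by rewrite /a; lra. have b0 : 0 < b by rewrite /b; lra.
have h i : x i * y i <= x i ^+ 2 * (b / a / 2) + y i ^+ 2 * (a / b / 2).
  have -> : x i ^+ 2 * (b / a / 2) + y i ^+ 2 * (a / b / 2) =
    x i * y i + (b * x i - a * y i) ^+ 2 / (2 * (a * b)).
    by field; rewrite ?gt_eqF.
  by rewrite lerDl divr_ge0 ?sqr_ge0 // mulr_ge0 // mulr_ge0 // ltW.
have /le_trans-> // : \sum_(i <- s) x i * y i <= A ^+ 2 * (b / a / 2) + B ^+ 2 * (a / b / 2).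
  rewrite (le_trans (ler_sum _ (fun i _ => h i))) // big_split /= -!mulr_suml.
  by rewrite lerD // ler_wpM2r // !divr_ge0 // ltW.
have -> : a * b = a ^+ 2 * (b / a / 2) + b ^+ 2 * (a / b / 2).
  by field; rewrite ?gt_eqF.
by rewrite lerD // ler_wpM2r ?divr_ge0 // ?(ltW a0) ?(ltW b0) // lerXn2r ?nnegrE //; rewrite /a /b; lra.
Qed.

Lemma l1le_CS x y A B : l2le x A -> l2le y B ->
  l1le (fun i => x i * y i) (A * B).
Proof.
move=> [A0 xA] [B0 yB] s us.
under eq_bigr do rewrite normrM.
apply: CauchySchwarz_seq => //.
  by under eq_bigr do rewrite real_normK ?num_real //; exact: xA.
by under eq_bigr do rewrite real_normK ?num_real //; exact: yB.
Qed.

Lemma l2leD x y z A B : (forall i, `|z i| <= `|x i| + `|y i|) ->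
  l2le x A -> l2le y B -> l2le z (A + B).
Proof.
move=> zxy [A0 xA] [B0 yB]; split=> [|s us]; first exact: addr_ge0.
have /le_trans-> // : \sum_(i <- s) z i ^+ 2 <= \sum_(i <- s) (`|x i| + `|y i|) ^+ 2.
  rewrite ler_sum // => i _; apply: (sqr_norm_le (x := z) (y := fun i => `|x i| + `|y i|)) => j.
  by rewrite [X in _ <= X]ger0_norm ?addr_ge0.
have -> : \sum_(i <- s) (`|x i| + `|y i|) ^+ 2 =
  \sum_(i <- s) x i ^+ 2 + 2 * (\sum_(i <- s) `|x i * y i|) + \sum_(i <- s) y i ^+ 2.
  rewrite mulr_sumr -!big_split /=; apply: eq_bigr => i _.
  by rewrite sqrrD !real_normK ?num_real // normrM mulr_natl.
have := xA s us; have := yB s us.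
have : \sum_(i <- s) `|x i * y i| <= A * B.
  by apply: l1le_CS => //; split.
by nra.
Qed.

Lemma l2leZ x y (c B : R) : 0 <= c -> (forall i, `|y i| <= c * `|x i|) ->
  l2le x B -> l2le y (c * B).
Proof.
move=> c0 yx [B0 xB]; split=> [|s us]; first exact: mulr_ge0.
rewrite exprMn (le_trans _ (ler_wpM2l (sqr_ge0 c) (xB s us))) // mulr_sumr ler_sum // => i _.
rewrite -exprMn; apply: (sqr_norm_le (x := y) (y := fun i => c * x i)) => j.
by rewrite normrM (ger0_norm c0).
Qed.

Lemma l2le_pt x B i : l2le x B -> `|x i| <= B.
Proof.
move=> [B0 /(_ [:: i] isT)]; rewrite big_seq1 => h.
by rewrite -ler_sqr ?nnegrE // real_normK ?num_real.
Qed.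

Lemma l2le_inj x B (f : I -> I) : injective f -> l2le x B -> l2le (x \o f) B.
Proof.
move=> fI [B0 xB]; split=> // s us; have := xB (map f s).
by rewrite map_inj_uniq // => /(_ us); rewrite big_map.
Qed.

(** A form of Fatou's lemma: each finite sum of squares passes to the limit, so pointwise
    convergence with a common bound suffices. *)
Lemma l2le_lim (u : nat -> I -> R) x B : (forall n, l2le (u n) B) ->
  (forall i, u ^~ i @ \oo --> x i) -> l2le x B.
Proof.
move=> uB ux; split=> [|s us]; first by have [] := uB 0%N.
have h : (fun n => \sum_(i <- s) u n i ^+ 2) @ \oo --> \sum_(i <- s) x i ^+ 2.
  elim: {us} s => [|i s IH].
    by rewrite big_nil; under eq_fun do rewrite big_nil; exact: cvg_cst.
  rewrite big_cons; under eq_fun do rewrite big_cons.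
  by apply: cvgD => //; under eq_fun do rewrite expr2; rewrite expr2; apply: cvgM.
rewrite -(cvg_lim _ h) //; apply: limr_le; first by apply/cvg_ex; eexists; exact: h.
by near=> n; have [_ /(_ s us)] := uB n.
Unshelve. all: by end_near.
Qed.

End FiniteSums.

(** * The symmetric index windows behind [csumZ] *)

Section Windows.

Definition win (N : nat) : seq int := [seq j%:Z - N%:Z | j <- iota 0 N.*2.+1].

Lemma sum_win (V : nmodType) (f : int -> V) N :
  \sum_(j < N.*2.+1) f (j%:Z - N%:Z) = \sum_(k <- win N) f k.
Proof.
by rewrite /win big_map -(big_mkord xpredT (fun j => f (j%:Z - N%:Z))) /index_iota subn0.
Qed.

Lemma uniq_win N : uniq (win N).
Proof. by rewrite map_inj_uniq ?iota_uniq // => i j; lia. Qed.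

Lemma mem_win N k : (k \in win N) = (`|k| <= N)%N.
Proof.
apply/mapP/idP => [[j]|kN]; first by rewrite mem_iota => /andP[_ h] ->; lia.
by exists (absz (k + N%:Z)); rewrite ?mem_iota; lia.
Qed.

Lemma win_cover (s : seq int) : exists N, forall n, (N <= n)%N -> {subset s <= win n}.
Proof.
elim: s => [|k s [N IH]]; first by exists 0%N => n _ k.
exists (maxn `|k| N) => n; rewrite geq_max => /andP[kn Nn] i.
by rewrite inE => /orP[/eqP->|/(IH n Nn)//]; rewrite mem_win.
Qed.

Lemma sum_winN (V : nmodType) (f : int -> V) N :
  \sum_(k <- win N) f (- k) = \sum_(k <- win N) f k.
Proof.
rewrite -(big_map -%R xpredT f); apply: perm_big; apply: uniq_perm.
- by rewrite map_inj_uniq ?uniq_win //; exact: oppr_inj.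
- exact: uniq_win.
- move=> k; apply/mapP/idP => [[j jN ->]|kN]; first by move: jN; rewrite !mem_win; lia.
  by exists (- k); rewrite ?opprK //; move: kN; rewrite !mem_win; lia.
Qed.

End Windows.
Arguments win : simpl never.

(** * Real series over the integers *)

Section RealSums.
Variable R : realType.
Implicit Types (x y z : int -> R) (C D e c : R).

Definition sumZ x : R := limn (fun N => \sum_(k <- win N) x k).

Let part x (N : nat) := \sum_(k <- win N) x k.

Let part_cvg_ge0 x C : (forall k, 0 <= x k) -> l1le x C -> cvgn (part x).
Proof.
move=> x0 xC; apply: nondecreasing_is_cvgn.
  move=> m n mn; apply: sum_subset => //; rewrite ?uniq_win //.
  by move=> k; rewrite !mem_win => /leq_trans->.
exists C => _ [n _ <-]; rewrite (le_trans _ (xC _ (uniq_win n))) //.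
by rewrite ler_sum // => k _; exact: ler_norm.
Qed.

(** Splitting x as (x + |x|) - |x| leaves two series of nonnegative terms, whose partial sums are
    monotone and bounded. *)
Lemma sumZ_cvg x C : l1le x C -> (fun N => \sum_(k <- win N) x k) @ \oo --> sumZ x.
Proof.
move=> xC.
have -> : (fun N => \sum_(k <- win N) x k) =
    (fun N => part (fun k => x k + `|x k|) N - part (fun k => `|x k|) N).
  by apply/funext => N; rewrite /part big_split /= addrK.
rewrite /sumZ (_ : (fun N => \sum_(k <- win N) x k) =
    (fun N => part (fun k => x k + `|x k|) N - part (fun k => `|x k|) N)); last first.
  by apply/funext => N; rewrite /part big_split /= addrK.
apply: is_cvgB.
  apply: (@part_cvg_ge0 _ (C + C)) => [k|].
    by rewrite -lerBlDr sub0r lerNl ler_normr lexx orbT.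
  by apply: (l1leD _ xC xC) => k; rewrite (le_trans (ler_normD _ _)) // normr_id.
apply: (@part_cvg_ge0 _ C) => // s us; rewrite (le_trans _ (xC s us)) // ler_sum // => k _.
by rewrite normr_id.
Qed.

Lemma sumZ_lim x l : (fun N => \sum_(k <- win N) x k) @ \oo --> l -> sumZ x = l.
Proof. by move=> h; apply: cvg_lim. Qed.

(** For nonnegative terms the sum is itself the optimal bound, because every finite sequence is
    contained in all large windows. *)
Lemma l1le_sumZ x C : (forall k, 0 <= x k) -> l1le x C -> l1le x (sumZ x).
Proof.
move=> x0 xC s us; have h := sumZ_cvg xC.
rewrite -(cvg_lim _ h) //; apply: limr_ge; first by apply/cvg_ex; eexists; exact: h.
have [N NP] := win_cover s.
near=> n; rewrite (le_trans (_ : _ <= \sum_(k <- s) x k)) //.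
  by rewrite ler_sum // => k _; rewrite ger0_norm.
by apply: sum_subset => //; rewrite ?uniq_win //; apply: NP; near: n; exact: nbhs_infty_ge.
Unshelve. all: by end_near.
Qed.

Lemma sumZ_abs_le x C : l1le x C -> `|sumZ x| <= C.
Proof.
move=> xC; have h := sumZ_cvg xC.
have h' : (fun N => `|\sum_(k <- win N) x k|) @ \oo --> `|sumZ x| by apply: cvg_norm.
rewrite -(cvg_lim _ h') //; apply: limr_le; first by apply/cvg_ex; eexists; exact: h'.
near=> n; rewrite (le_trans (ler_norm_sum _ _ _)) //; exact: xC (uniq_win n).
Unshelve. all: by end_near.
Qed.

Lemma sumZ_le_bound x C : l1le x C -> sumZ x <= C.
Proof. by move=> /sumZ_abs_le; apply: le_trans; exact: ler_norm. Qed.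

Lemma sumZ_ge0 x C : (forall k, 0 <= x k) -> l1le x C -> 0 <= sumZ x.
Proof. by move=> x0 xC; apply: l1le_ge0 (l1le_sumZ x0 xC). Qed.

Lemma sumZD x y C D : l1le x C -> l1le y D ->
  sumZ (fun k => x k + y k) = sumZ x + sumZ y.
Proof.
move=> xC yD; apply: sumZ_lim; under eq_fun do rewrite big_split /=.
by apply: cvgD; [exact: sumZ_cvg xC|exact: sumZ_cvg yD].
Qed.

Lemma sumZZ x c C : l1le x C -> sumZ (fun k => c * x k) = c * sumZ x.
Proof.
move=> xC; apply: sumZ_lim; under eq_fun do rewrite -mulr_sumr.
by apply: cvgMl_tmp; exact: sumZ_cvg xC.
Qed.

Lemma ler_sumZ x y C D : l1le x C -> l1le y D -> (forall k, x k <= y k) ->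
  sumZ x <= sumZ y.
Proof.
move=> xC yD xy; apply: ler_lim; [by apply/cvg_ex; eexists; exact: sumZ_cvg xC
  |by apply/cvg_ex; eexists; exact: sumZ_cvg yD|].
by near=> n; rewrite ler_sum.
Unshelve. all: by end_near.
Qed.

(** Both sides are optimal bounds, and a bijection carries bounds over in both directions; the
    symmetric partial sums are never rearranged. *)
Lemma sumZ_reindex x C (f g : int -> int) : cancel f g -> cancel g f ->
  (forall k, 0 <= x k) -> l1le x C -> sumZ (x \o f) = sumZ x.
Proof.
move=> fg gf x0 xC; have xS := l1le_sumZ x0 xC.
have xfC : l1le (x \o f) (sumZ x) by apply: l1le_inj xS; exact: can_inj fg.
apply/eqP; rewrite eq_le (sumZ_le_bound xfC) /=.
have xf0 k : 0 <= (x \o f) k by exact: x0.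
have /(l1le_inj (can_inj gf)) h := l1le_sumZ xf0 xfC.
apply: sumZ_le_bound; move: h; congr l1le; apply/funext => k /=.
by rewrite gf.
Qed.

(** A window and a finite set disjoint from it together still sum to at most the total, while the
    window alone already comes within [e] of it. *)
Lemma l1_tail x C : l1le x C -> forall e, 0 < e -> exists N, forall n, (N <= n)%N ->
  forall s, uniq s -> (forall k, k \in s -> k \notin win n) ->
  \sum_(k <- s) `|x k| <= e.
Proof.
move=> xC e e0.
have nxC : l1le (fun k => `|x k|) C.
  by apply: l1le_le xC => k; rewrite normr_id.
have /cvgrPdist_lt /(_ e e0) [N _ NP] := sumZ_cvg nxC.
exists N => n Nn s us sn.
have u2 : uniq (win n ++ s).
  rewrite cat_uniq uniq_win us andbT /=; apply/hasPn => k ks; exact: sn.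
have := l1le_sumZ (fun k => normr_ge0 (x k)) nxC u2.
rewrite big_cat /=; have := NP n Nn.
under [X in _ -> X + _ <= _ -> _]eq_bigr do rewrite normr_id.
under [X in _ -> _ + X <= _ -> _]eq_bigr do rewrite normr_id.
by rewrite ltr_norml => /andP[_ h1] h2; lra.
Qed.

End RealSums.

(** * Complex limits and series over the integers *)

Section ComplexSums.
Variable R : realType.
Implicit Types (a b : int -> R[i]) (u : nat -> R[i]) (x y : int -> R).

Definition ma a : int -> R := fun k => cn (a k).

Lemma ma_norm a k : `|ma a k| = cn (a k).
Proof. by rewrite ger0_norm // cn_ge0. Qed.

(** Convergence in modulus, in place of the two real limits of [clim]; this form is stable under
    products and multiplication by phases. [ccvgP], [ccvg_Re] and [ccvg_Im] translate between the
    two. *)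
Definition ccvg u (l : R[i]) : Prop := (fun n => cn (u n - l)) @ \oo --> (0 : R).

Lemma squeeze0 (f g : nat -> R) : (forall n, 0 <= f n <= g n) ->
  g @ \oo --> (0 : R) -> f @ \oo --> (0 : R).
Proof.
move=> fg g0; apply: (@squeeze_cvgr _ _ _ _ (fun=> 0) g) => //; last exact: cvg_cst.
by near=> n.
Unshelve. all: by end_near.
Qed.

Lemma cvg0_diff (f : nat -> R) l : (fun n => `|f n - l|) @ \oo --> (0 : R) ->
  f @ \oo --> l.
Proof.
move=> /cvgrPdist_lt h; apply/cvgrPdist_lt => e /h; apply: filterS => n.
by rewrite sub0r normrN normr_id distrC.
Qed.

Lemma ccvgP u l : ((fun n => complex.Re (u n)) @ \oo --> complex.Re l) ->
  ((fun n => complex.Im (u n)) @ \oo --> complex.Im l) -> ccvg u l.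
Proof.
move=> ur ui.
have h : (fun n => `|complex.Re (u n) - complex.Re l| +
    `|complex.Im (u n) - complex.Im l|) @ \oo --> (0 : R).
  rewrite -[X in _ --> X]addr0; apply: cvgD.
    rewrite -[X in _ --> X](normr0 R) -[X in `|X|](subrr (complex.Re l)).
    by apply: cvg_norm; apply: cvgB => //; exact: cvg_cst.
  rewrite -[X in _ --> X](normr0 R) -[X in `|X|](subrr (complex.Im l)).
  by apply: cvg_norm; apply: cvgB => //; exact: cvg_cst.
apply: squeeze0 h => n; rewrite cn_ge0 /= (le_trans (cn_le_ReIm _)) //.
by rewrite ReD ImD ReN ImN.
Qed.

Lemma ccvg_Re u l : ccvg u l -> (fun n => complex.Re (u n)) @ \oo --> complex.Re l.
Proof.
move=> ul; apply: cvg0_diff; apply: squeeze0 ul => n; rewrite normr_ge0 /=.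
by rewrite (le_trans _ (Re_le_cn _)) // ReD ReN.
Qed.

Lemma ccvg_Im u l : ccvg u l -> (fun n => complex.Im (u n)) @ \oo --> complex.Im l.
Proof.
move=> ul; apply: cvg0_diff; apply: squeeze0 ul => n; rewrite normr_ge0 /=.
by rewrite (le_trans _ (Im_le_cn _)) // ImD ImN.
Qed.

Lemma clim_lim u l : ccvg u l -> clim u = l.
Proof.
move=> ul; rewrite /clim (cvg_lim _ (ccvg_Re ul)) // (cvg_lim _ (ccvg_Im ul)) //.
by case: l ul.
Qed.

Lemma ccvg_unique u l l' : ccvg u l -> ccvg u l' -> l = l'.
Proof. by move=> /clim_lim <- /clim_lim <-. Qed.

Lemma ccvg_le u (f : nat -> R) l : (forall n, cn (u n - l) <= f n) ->
  f @ \oo --> (0 : R) -> ccvg u l.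
Proof. by move=> uf; apply: squeeze0 => n; rewrite cn_ge0 uf. Qed.

Lemma ccvg_cst z : ccvg (fun=> z) z.
Proof. by rewrite /ccvg; under eq_fun do rewrite subrr cn0; exact: cvg_cst. Qed.

Lemma ccvgD u v l m : ccvg u l -> ccvg v m -> ccvg (fun n => u n + v n) (l + m).
Proof.
move=> ul vm; apply: (ccvg_le (f := fun n => cn (u n - l) + cn (v n - m))) => [n|].
  by rewrite opprD addrACA cnD.
by rewrite -[X in _ --> X]addr0; exact: cvgD.
Qed.

Lemma ccvgZ u l c : ccvg u l -> ccvg (fun n => c * u n) (c * l).
Proof.
move=> ul; apply: (ccvg_le (f := fun n => cn c * cn (u n - l))) => [n|].
  by rewrite -mulrBr cnM.
by rewrite -[X in _ --> X](mulr0 (cn c)); exact: cvgMl_tmp.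
Qed.

Lemma ccvgB u v l m : ccvg u l -> ccvg v m -> ccvg (fun n => u n - v n) (l - m).
Proof.
move=> ul /(ccvgZ (-1)) vm; have := ccvgD ul vm.
by rewrite mulN1r; under eq_fun do rewrite mulN1r.
Qed.

Lemma ccvg_conj u l : ccvg u l -> ccvg (fun n => ((u n)^*)%C) (l^*)%C.
Proof.
by rewrite /ccvg => ul; under eq_fun do rewrite -conjN -conjD cn_conj.
Qed.

Lemma ccvg_cn u l : ccvg u l -> (fun n => cn (u n)) @ \oo --> cn l.
Proof.
move=> ul; apply: cvg0_diff; apply: squeeze0 ul => n; rewrite normr_ge0 /=.
have h1 := cnD (u n - l) l; have h2 := cnD (l - u n) (u n).
by rewrite !subrK in h1 h2; rewrite cnC in h2; rewrite ler_norml; apply/andP; split; lra.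
Qed.

Lemma ccvgM u v l m : ccvg u l -> ccvg v m -> ccvg (fun n => u n * v n) (l * m).
Proof.
move=> ul vm.
apply: (ccvg_le (f := fun n => cn (u n) * cn (v n - m) + cn m * cn (u n - l))) => [n|].
  rewrite -!cnM (le_trans _ (cnD _ _)) //.
  by rewrite (_ : u n * v n - l * m = u n * (v n - m) + m * (u n - l)) //; ring.
rewrite [X in _ --> X](_ : 0 = cn l * 0 + cn m * 0); last by rewrite !mulr0 addr0.
by apply: cvgD; [apply: cvgM => //; exact: ccvg_cn ul|exact: cvgMl_tmp].
Qed.

Lemma csumZE a : csumZ a = clim (fun N => \sum_(k <- win N) a k).
Proof. by rewrite /csumZ; under eq_fun do rewrite sum_win. Qed.

Lemma csumZ_ReIm a :
  csumZ a = sumZ (fun k => complex.Re (a k)) +i* sumZ (fun k => complex.Im (a k)).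
Proof.
rewrite csumZE /clim /sumZ.
by under eq_fun do rewrite Re_sum; under [X in _ +i* limn X]eq_fun do rewrite Im_sum.
Qed.

Lemma csumZ_lim a l : ccvg (fun N => \sum_(k <- win N) a k) l -> csumZ a = l.
Proof. by rewrite csumZE; exact: clim_lim. Qed.

Lemma csumZ_cvg a C : l1le (ma a) C -> ccvg (fun N => \sum_(k <- win N) a k) (csumZ a).
Proof.
move=> aC; rewrite csumZ_ReIm; apply: ccvgP => /=.
  under eq_fun do rewrite Re_sum; apply: (sumZ_cvg (C := C)).
  by apply: l1le_le aC => k; rewrite ma_norm Re_le_cn.
under eq_fun do rewrite Im_sum; apply: (sumZ_cvg (C := C)).
by apply: l1le_le aC => k; rewrite ma_norm Im_le_cn.
Qed.

Lemma csumZ_le a C : l1le (ma a) C -> cn (csumZ a) <= C.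
Proof.
move=> aC; apply: (ler_cn_lim (csumZ_cvg aC)) => N.
rewrite (le_trans (cn_sum _ _)) // (le_trans _ (aC _ (uniq_win N))) //.
by rewrite ler_sum // => k _; rewrite ma_norm.
Qed.

Lemma l1le_ma a x C : (forall k, cn (a k) <= x k) -> l1le x C -> l1le (ma a) C.
Proof.
by move=> ax; apply: l1le_le => k; rewrite ma_norm (le_trans (ax k)) // ler_norm.
Qed.

Lemma csumZ_le_sumZ a x C : (forall k, cn (a k) <= x k) -> l1le x C ->
  cn (csumZ a) <= sumZ x.
Proof.
move=> ax xC; apply: csumZ_le; apply: (l1le_ma ax).
by apply: l1le_sumZ xC => k; apply: le_trans (ax k); exact: cn_ge0.
Qed.

Lemma csumZD a b C D : l1le (ma a) C -> l1le (ma b) D ->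
  csumZ (fun k => a k + b k) = csumZ a + csumZ b.
Proof.
move=> aC bD; apply: csumZ_lim; under eq_fun do rewrite big_split.
by apply: ccvgD; [exact: csumZ_cvg aC|exact: csumZ_cvg bD].
Qed.

Lemma csumZZ a c C : l1le (ma a) C -> csumZ (fun k => c * a k) = c * csumZ a.
Proof.
move=> aC; apply: csumZ_lim; under eq_fun do rewrite -mulr_sumr.
by apply: ccvgZ; exact: csumZ_cvg aC.
Qed.

Lemma csumZB a b C D : l1le (ma a) C -> l1le (ma b) D ->
  csumZ (fun k => a k - b k) = csumZ a - csumZ b.
Proof.
move=> aC bD; apply: csumZ_lim; under eq_fun do rewrite sumrB.
by apply: ccvgB; [exact: csumZ_cvg aC|exact: csumZ_cvg bD].
Qed.

Lemma csumZ_conj a C : l1le (ma a) C ->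
  csumZ (fun k => ((a k)^*)%C) = ((csumZ a)^*)%C.
Proof.
move=> aC; apply: csumZ_lim; under eq_fun do rewrite -raddf_sum.
by apply: ccvg_conj; exact: csumZ_cvg aC.
Qed.

Lemma csumZN a : csumZ (fun k => a (- k)) = csumZ a.
Proof. by rewrite !csumZE; under eq_fun do rewrite sum_winN. Qed.

Lemma csumZ_delta a k0 : (forall k, k != k0 -> a k = 0) -> csumZ a = a k0.
Proof.
move=> a0; apply: csumZ_lim.
rewrite /ccvg; apply: cvg_near_cst; near=> n; apply/eqP.
have kn : k0 \in win n by rewrite mem_win; near: n; exact: nbhs_infty_ge.
rewrite (bigD1_seq k0) ?uniq_win //= big1 ?addr0 ?subrr ?cn0 // => k; exact: a0.
Unshelve. all: by end_near.
Qed.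

Lemma csumZ_tail a C N e : l1le (ma a) C ->
  (forall s, uniq s -> (forall k, k \in s -> k \notin win N) ->
     \sum_(k <- s) cn (a k) <= e) ->
  cn (csumZ a - \sum_(k <- win N) a k) <= e.
Proof.
move=> aC ae.
(* The windows of radius [maxn n N] all contain [win N], so each difference is a finite sum over
   indices outside it. *)
have h : ccvg (fun n => \sum_(k <- win (maxn n N)) a k - \sum_(k <- win N) a k)
    (csumZ a - \sum_(k <- win N) a k).
  apply: ccvgB; last exact: ccvg_cst.
  have /cvgrPdist_lt c := csumZ_cvg aC; apply/cvgrPdist_lt => d d0.
  have [m _ mP] := c d d0; exists m => // n /= mn; apply: mP => /=.
  by rewrite (leq_trans mn) // leq_maxl.
apply: (ler_cn_lim h) => n.
rewrite [X in X - _](bigID (mem (win N))) /=.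
have -> : \sum_(k <- win (maxn n N) | k \in win N) a k = \sum_(k <- win N) a k.
  rewrite -big_filter; apply: perm_big; apply: uniq_perm; rewrite ?filter_uniq ?uniq_win //.
  move=> k; rewrite mem_filter !mem_win; apply/andP/idP => [[]//|kN]; split=> //.
  by rewrite (leq_trans kN) // leq_maxr.
rewrite [X in cn X]addrC addKr -big_filter (le_trans (cn_sum _ _)) //.
apply: ae; first by rewrite filter_uniq ?uniq_win.
by move=> k; rewrite mem_filter => /andP[].
Qed.

End ComplexSums.

(** * Convolution of sequences and Young's inequality *)

Section Convolution.
Variable R : realType.
Implicit Types (X Y Z : int -> R) (a b c : int -> R[i]).

Definition rconv X Y (k : int) : R := sumZ (fun j => X j * Y (k - j)).
Definition conv a b (k : int) : R[i] := csumZ (fun j => a j * b (k - j)).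

Lemma l1le_mulb X Y A B : l1le X A -> (forall k, `|Y k| <= B) ->
  l1le (fun k => X k * Y k) (A * B).
Proof.
move=> XA YB; have B0 : 0 <= B by apply: le_trans (YB 0).
rewrite mulrC; apply: (l1leZ (x := X)) => // k.
by rewrite normrM mulrC ler_wpM2r.
Qed.

Lemma rconv_summable X Y A B k : l1le X A -> (forall k, `|Y k| <= B) ->
  l1le (fun j => X j * Y (k - j)) (A * B).
Proof. by move=> XA YB; apply: l1le_mulb => // j. Qed.

Lemma l1le_lim (u : nat -> int -> R) X C : (forall n, l1le (u n) C) ->
  (forall i, u ^~ i @ \oo --> X i) -> l1le X C.
Proof.
move=> uB ux s us.
have h : (fun n => \sum_(i <- s) `|u n i|) @ \oo --> \sum_(i <- s) `|X i|.
  elim: {us} s => [|i s IH].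
    by rewrite big_nil; under eq_fun do rewrite big_nil; exact: cvg_cst.
  rewrite big_cons; under eq_fun do rewrite big_cons.
  by apply: cvgD => //; apply: cvg_norm.
rewrite -(cvg_lim _ h) //; apply: limr_le; first by apply/cvg_ex; eexists; exact: h.
by near=> n; exact: uB.
Unshelve. all: by end_near.
Qed.

Lemma subr_inj (k : int) : injective (fun j => k - j).
Proof. by move=> i j /= h; lia. Qed.

Lemma subr_injl (k : int) : injective (fun j => j - k).
Proof. by move=> i j /= h; lia. Qed.

(** The inner sum is first cut to a window, where the order of summation is free; [l1le_lim] then
    removes the cut. *)
Lemma rconv_l1 X Y A B : l1le X A -> l1le Y B -> l1le (rconv X Y) (A * B).
Proof.
move=> XA YB; have B0 := l1le_ge0 YB.
apply: (l1le_lim (u := fun n k => \sum_(j <- win n) X j * Y (k - j))) => [n|k]; last first.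
  by apply: sumZ_cvg; apply: rconv_summable XA _ => i; exact: l1le_pt YB.
move=> s us.
have /le_trans-> // : \sum_(k <- s) `|\sum_(j <- win n) X j * Y (k - j)| <=
    \sum_(k <- s) \sum_(j <- win n) `|X j| * `|Y (k - j)|.
  rewrite ler_sum // => k _; rewrite (le_trans (ler_norm_sum _ _ _)) // ler_sum // => j _.
  by rewrite normrM.
rewrite exchange_big /= (le_trans (_ : _ <= \sum_(j <- win n) `|X j| * B)) //.
  rewrite ler_sum // => j _; rewrite -mulr_sumr ler_wpM2l //.
  exact: (l1le_inj (@subr_injl j) YB us).
by rewrite -mulr_suml ler_wpM2r //; exact: XA (uniq_win n).
Qed.

(** Young's inequality l^1 * l^2. Cauchy-Schwarz with the weights X bounds the square of sum X Y by
    A times sum X Y^2; summing over k first then turns Y^2 into [B ^+ 2]. *)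
Lemma rconv_l2 X Y A B : (forall k, 0 <= X k) -> l1le X A -> l2le Y B ->
  l2le (rconv X Y) (A * B).
Proof.
move=> X0 XA YB; have A0 := l1le_ge0 XA; have B0 := l2le_ge0 YB.
apply: (l2le_lim (u := fun n k => \sum_(j <- win n) X j * Y (k - j))) => [n|k]; last first.
  by apply: sumZ_cvg; apply: rconv_summable XA _ => i; exact: l2le_pt YB.
split=> [|s us]; first exact: mulr_ge0.
have SX : \sum_(j <- win n) X j <= A.
  by rewrite (le_trans _ (XA _ (uniq_win n))) // ler_sum // => j _; exact: ler_norm.
have jensen k : (\sum_(j <- win n) X j * Y (k - j)) ^+ 2 <=
    A * \sum_(j <- win n) X j * Y (k - j) ^+ 2.
  set S2 := \sum_(j <- win n) X j * Y (k - j) ^+ 2.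
  have S20 : 0 <= S2 by apply: sumr_ge0 => j _; rewrite mulr_ge0 // sqr_ge0.
  have h1 : \sum_(j <- win n) Num.sqrt (X j) ^+ 2 <= Num.sqrt A ^+ 2.
    by rewrite sqr_sqrtr //; under eq_bigr do rewrite sqr_sqrtr //.
  have E j : `|Num.sqrt (X j) * `|Y (k - j)| | ^+ 2 = X j * Y (k - j) ^+ 2.
    by rewrite normrM normr_id exprMn real_normK ?num_real // sqr_sqrtr // real_normK ?num_real.
  have h2 : \sum_(j <- win n) (Num.sqrt (X j) * `|Y (k - j)|) ^+ 2 <= Num.sqrt S2 ^+ 2.
    by rewrite sqr_sqrtr // ler_sum // => j _; rewrite -E real_normK ?num_real.
  have := CauchySchwarz_seq (sqrtr_ge0 A) (sqrtr_ge0 S2) h1 h2.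
  set L := \sum_(i <- _) _ => hL.
  have hS : `|\sum_(j <- win n) X j * Y (k - j)| <= L.
    rewrite (le_trans (ler_norm_sum _ _ _)) // ler_sum // => j _.
    by rewrite mulrA -expr2 sqr_sqrtr // normrM ger0_norm.
  have : `|\sum_(j <- win n) X j * Y (k - j)| ^+ 2 <= (Num.sqrt A * Num.sqrt S2) ^+ 2.
    by rewrite lerXn2r ?nnegrE ?mulr_ge0 ?sqrtr_ge0 // (le_trans hS).
  by rewrite real_normK ?num_real // exprMn !sqr_sqrtr.
rewrite (le_trans (ler_sum _ (fun k _ => jensen k))) // -mulr_sumr exchange_big /=.
rewrite exprMn expr2 -mulrA ler_wpM2l //.
rewrite (le_trans (_ : _ <= \sum_(j <- win n) X j * B ^+ 2)) //.
  rewrite ler_sum // => j _; rewrite -mulr_sumr ler_wpM2l //.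
  by have [_] := l2le_inj (@subr_injl j) YB; apply.
by rewrite -mulr_suml ler_wpM2r // sqr_ge0.
Qed.

Lemma rconvC X Y A B k : (forall k, 0 <= X k) -> (forall k, 0 <= Y k) ->
  l1le X A -> (forall k, `|Y k| <= B) -> rconv X Y k = rconv Y X k.
Proof.
move=> X0 Y0 XA YB; rewrite /rconv.
rewrite -[RHS](@sumZ_reindex R _ (A * B) (fun j => k - j) (fun j => k - j)).
- by congr sumZ; apply/funext => j /=; rewrite mulrC subKr.
- by move=> j; rewrite subKr.
- by move=> j; rewrite subKr.
- by move=> j; rewrite mulr_ge0.
- have := l1le_inj (@subr_inj k) (rconv_summable k XA YB).
  by congr l1le; apply/funext => j /=; rewrite mulrC subKr.
Qed.

Lemma rconv_ge0 X Y A B k : (forall k, 0 <= X k) -> (forall k, 0 <= Y k) ->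
  l1le X A -> (forall k, `|Y k| <= B) -> 0 <= rconv X Y k.
Proof.
move=> X0 Y0 XA YB; apply: (sumZ_ge0 (C := A * B)); last exact: rconv_summable.
by move=> j; rewrite mulr_ge0.
Qed.

Lemma conv_summable a b A B k : l1le (ma a) A -> (forall k, cn (b k) <= B) ->
  l1le (ma (fun j => a j * b (k - j))) (A * B).
Proof.
move=> aA bB; apply: (l1le_ma (x := fun j => ma a j * ma b (k - j))) => [j|].
  by rewrite cnM.
by apply: rconv_summable => // j; rewrite ma_norm.
Qed.

Lemma cn_conv a b A B k : l1le (ma a) A -> (forall k, cn (b k) <= B) ->
  cn (conv a b k) <= rconv (ma a) (ma b) k.
Proof.
move=> aA bB; apply: (csumZ_le_sumZ (C := A * B)) => [j|]; first by rewrite cnM.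
by apply: rconv_summable => // j; rewrite ma_norm.
Qed.

Lemma ma_pt a A k : l1le (ma a) A -> cn (a k) <= A.
Proof. by move=> /(@l1le_pt _ _ _ _ k); rewrite ma_norm. Qed.

Lemma conv_l1 a b A B : l1le (ma a) A -> l1le (ma b) B ->
  l1le (ma (conv a b)) (A * B).
Proof.
move=> aA bB; apply: (l1le_ma (x := rconv (ma a) (ma b))); last exact: rconv_l1.
by move=> k; apply: cn_conv aA _ => j; exact: ma_pt bB.
Qed.

Lemma convBl a a' b A A' B k : l1le (ma a) A -> l1le (ma a') A' ->
  (forall k, cn (b k) <= B) ->
  conv (fun k => a k - a' k) b k = conv a b k - conv a' b k.
Proof.
move=> aA aA' bB; rewrite /conv -(csumZB (conv_summable k aA bB) (conv_summable k aA' bB)).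
by congr csumZ; apply/funext => j; rewrite mulrBl.
Qed.

Lemma convBr a b b' A B B' k : l1le (ma a) A -> (forall k, cn (b k) <= B) ->
  (forall k, cn (b' k) <= B') ->
  conv a (fun k => b k - b' k) k = conv a b k - conv a b' k.
Proof.
move=> aA bB bB'; rewrite /conv -(csumZB (conv_summable k aA bB) (conv_summable k aA bB')).
by congr csumZ; apply/funext => j; rewrite mulrBr.
Qed.

End Convolution.

(** * Sobolev weights, embedding into l^1, and the algebra estimate *)

Section Weights.
Variable R : realType.
Implicit Types (X Y Z : int -> R) (s p : R) (k i j : int).

(** The power s of the Japanese bracket (1 + k^2)^{1/2}. *)
Definition hw s k : R := (1 + k%:~R ^+ 2) `^ (s / 2).

(** The ball of radius [B] of H^s on the Fourier side; [X] usually holds the moduli of coefficients.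
    Bounds are carried instead of norms, so finiteness never has to be proved apart. *)
Definition hs s X (B : R) : Prop := l2le (fun k => hw s k * X k) B.

Let base_ge1 k : 1 <= 1 + (k%:~R : R) ^+ 2.
Proof. by rewrite lerDl sqr_ge0. Qed.

Let base_gt0 k : 0 < 1 + (k%:~R : R) ^+ 2.
Proof. by rewrite (lt_le_trans ltr01). Qed.

Lemma hw_ge0 s k : 0 <= hw s k. Proof. exact: powR_ge0. Qed.
Lemma hw0 k : hw 0 k = 1. Proof. by rewrite /hw mul0r powRr0. Qed.

Lemma hwD s t k : hw (s + t) k = hw s k * hw t k.
Proof.
by rewrite /hw mulrDl powRD //; apply/implyP => _; rewrite gt_eqF.
Qed.

Lemma hwN s k : hw s (- k) = hw s k.
Proof. by rewrite /hw mulrNz sqrrN. Qed.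

Lemma hw_le s t k : s <= t -> hw s k <= hw t k.
Proof. by move=> st; apply: ler_powR => //; rewrite ler_pM2r. Qed.

Lemma hw_ge1 s k : 0 <= s -> 1 <= hw s k.
Proof. by move=> s0; rewrite -(hw0 k) hw_le. Qed.

Lemma hw_sqr s k : hw s k ^+ 2 = (1 + k%:~R ^+ 2) `^ s.
Proof. by rewrite -powR_mulrn ?powR_ge0 // -powRrM divfK. Qed.

Lemma hw1_sqr k : hw 1 k ^+ 2 = 1 + k%:~R ^+ 2.
Proof. by rewrite hw_sqr powRr1 // ltW. Qed.

Lemma abs_le_hw1 k : `|k%:~R : R| <= hw 1 k.
Proof.
by rewrite -ler_sqr ?nnegrE ?hw_ge0 // hw1_sqr real_normK ?num_real // lerDr.
Qed.

(** If |i| <= |j|, then 1 + (i + j)^2 <= 1 + 4 j^2 <= 4 (1 + j^2); the power s / 2 of the factor 4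
    is the constant of [hw_sub]. *)
Definition wK s : R := 4 `^ (s / 2).

Lemma wK_gt0 s : 0 < wK s. Proof. exact: powR_gt0. Qed.

Lemma hw_sub s i j : 0 <= s -> hw s (i + j) <= wK s * (hw s i + hw s j).
Proof.
move=> s0; have s20 : 0 <= s / 2 by rewrite divr_ge0.
have h a b : `|a%:~R : R| <= `|b%:~R| -> hw s (a + b) <= wK s * hw s b.
  have b0 := fun k => ltW (base_gt0 k).
  move=> ab; rewrite /hw /wK -powRM ?b0 // ge0_ler_powR ?nnegrE ?mulr_ge0 ?b0 // intrD.
  have : (a%:~R : R) ^+ 2 <= b%:~R ^+ 2.
    by rewrite -[_ ^+ 2](real_normK (num_real _)) -[X in _ <= X](real_normK (num_real _)) lerXn2r ?nnegrE.
  have := sqr_ge0 (a%:~R - b%:~R : R); rewrite sqrrB sqrrD; lra.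
have [ij|/ltW ij] := leP `|i%:~R : R| `|j%:~R|.
  by rewrite (le_trans (h _ _ ij)) // ler_wpM2l ?(ltW (wK_gt0 s)) // lerDr hw_ge0.
by rewrite addrC (le_trans (h _ _ ij)) // ler_wpM2l ?(ltW (wK_gt0 s)) // lerDl hw_ge0.
Qed.

Lemma hs_pt s X B k : 0 <= s -> hs s X B -> `|X k| <= B.
Proof.
move=> s0 /(@l2le_pt _ _ _ _ k); apply: le_trans.
by rewrite normrM ler_peMl // ger0_norm ?hw_ge0 // hw_ge1.
Qed.

Lemma hs_mono s t X B : s <= t -> hs t X B -> hs s X B.
Proof.
move=> st; apply: l2le_le => k; rewrite !normrM ler_wpM2r // !ger0_norm ?hw_ge0 //.
exact: hw_le.
Qed.

Lemma hs_le s X Y B : (forall k, `|X k| <= `|Y k|) -> hs s Y B -> hs s X B.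
Proof. by move=> XY; apply: l2le_le => k; rewrite !normrM ler_wpM2l. Qed.

Lemma hsD s X Y Z A B : (forall k, `|Z k| <= `|X k| + `|Y k|) ->
  hs s X A -> hs s Y B -> hs s Z (A + B).
Proof. by move=> ZXY; apply: l2leD => k; rewrite !normrM -mulrDr ler_wpM2l. Qed.

Lemma hsZ s X Y c B : 0 <= c -> (forall k, `|Y k| <= c * `|X k|) ->
  hs s X B -> hs s Y (c * B).
Proof. by move=> c0 YX; apply: l2leZ => // k; rewrite !normrM mulrCA ler_wpM2l. Qed.

Lemma hs_opp s X B : hs s X B -> hs s (fun k => X (- k)) B.
Proof.
move=> h; have := l2le_inj (@oppr_inj _) h.
by congr l2le; apply/funext => k /=; rewrite hwN.
Qed.

Lemma hs_shift s t X B : hs (s + t) X B <-> hs s (fun k => hw t k * X k) B.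
Proof. by rewrite /hs; under eq_fun do rewrite hwD -mulrA. Qed.

(** Integral comparison through the mean value theorem: with q = 2 p > 1, the term (m + 1)^{-q} is
    at most (m^{1 - q} - (m + 1)^{1 - q}) / (q - 1), and these differences telescope. *)
Let pseries p : 2^-1 < p ->
  forall n, \sum_(1 <= k < n.+1) (k%:R : R) `^ (- (2 * p)) <= 1 + (2 * p - 1)^-1.
Proof.
move=> p12 n; set q := 2 * p; have q1 : 0 < q - 1 by rewrite /q; lra.
have step (m : nat) : (0 < m)%N ->
    (m.+1%:R : R) `^ (- q) <= (q - 1)^-1 * (m%:R `^ (1 - q) - m.+1%:R `^ (1 - q)).
  move=> m0; have m0R : 0 < m%:R :> R by rewrite ltr0n.
  have mm : (m%:R : R) < m.+1%:R by rewrite ltr_nat.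
  have d (x : R) : x \in `]m%:R, m.+1%:R[%R ->
      is_derive x (1 : R) (fun y : R => y `^ (1 - q)) ((1 - q) * x `^ (1 - q - 1)).
    by rewrite in_itv /= => /andP[mx _]; apply: is_derive1_powR; exact: lt_trans mx.
  have [|c cm] := MVT mm d.
    apply: derivable_within_continuous => x; rewrite in_itv /= => /andP[mx _].
    by apply: derivable_powR; rewrite in_itv /= andbT; exact: lt_le_trans mx.
  move/itvP: cm => cm; rewrite -natrB // subSnn mulr1 => E.
  have -> : (m%:R `^ (1 - q) - m.+1%:R `^ (1 - q) : R) = (q - 1) * c `^ (- q).
    by rewrite -opprB E -mulNr opprB; congr (_ * _ `^ _); ring.
  have c0 : 0 < c by apply: lt_trans m0R _; rewrite cm.
  rewrite mulKf ?gt_eqF // !powRN lef_pV2 ?posrE ?powR_gt0 //.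
  have cm1 : c <= m.+1%:R by rewrite cm.
  by apply: ge0_ler_powR; rewrite ?nnegrE ?(ltW c0) //; rewrite /q in q1 *; lra.
case: n => [|n]; first by rewrite big_geq // addr_ge0 // invr_ge0 (ltW q1).
have S : forall n, \sum_(1 <= k < n.+2) (k%:R : R) `^ (- q) <=
    1 + (q - 1)^-1 * (1 - n.+1%:R `^ (1 - q)).
  elim=> [|m IHm]; first by rewrite big_nat1 !powR1 subrr mulr0 addr0.
  rewrite big_nat_recr //= (le_trans (lerD IHm (step m.+1 isT))) //.
  by rewrite -addrA -mulrDr addrA subrK.
by rewrite (le_trans (S _)) // lerD2l ler_piMr ?invr_ge0 ?(ltW q1) // gerBl powR_ge0.
Qed.

Lemma sum_winS (V : nmodType) (f : int -> V) n :
  \sum_(k <- win n) f k = f 0 + \sum_(1 <= i < n.+1) (f i%:Z + f (- i%:Z)).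
Proof.
elim: n => [|n IH].
  rewrite big_geq // addr0 (_ : win 0 = [:: 0]) ?big_seq1 //.
rewrite big_nat_recr //= addrA -IH addrC -addrA.
have -> : f n.+1 + (f (- n.+1%:Z) + \sum_(k <- win n) f k) =
    \sum_(k <- [:: n.+1%:Z, - n.+1%:Z & win n]) f k by rewrite !big_cons.
have u : uniq [:: n.+1%:Z, - n.+1%:Z & win n].
  by rewrite 2!cons_uniq in_cons 2!mem_win uniq_win; lia.
apply: perm_big; apply: uniq_perm => //; [exact: uniq_win|].
by move=> k; rewrite mem_win 2!in_cons mem_win; lia.
Qed.

Lemma hw_summable p : 2^-1 < p -> exists2 K, 0 < K & l2le (hw (- p)) K.
Proof.
(* The index 0 contributes 1, and the pairs k, -k contribute twice the series of [pseries]. *)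
move=> p12; set C := 1 + 2 * (1 + (2 * p - 1)^-1).
have C0 : 0 < C by rewrite /C ltr_pwDl // mulr_ge0 // addr_ge0 // invr_ge0; lra.
exists (Num.sqrt C); rewrite ?sqrtr_gt0 //; split=> [|s us]; first exact: sqrtr_ge0.
rewrite sqr_sqrtr ?(ltW C0) //; have [N /(_ N (leqnn N)) sN] := win_cover s.
rewrite (le_trans (sum_subset us (uniq_win N) sN (fun k => sqr_ge0 (hw (- p) k)))) //.
rewrite sum_winS /C lerD //.
  by rewrite hw_sqr expr0n addr0 powR1.
rewrite (le_trans _ (ler_wpM2l _ (pseries p12 N))) // mulr_sumr.
apply: ler_sum_nat => i /andP[i0 _]; rewrite hwN -[X in X <= _]mulr2n -[X in X <= _]mulr_natl ler_wpM2l //.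
have iR : 0 < (i%:R : R) by rewrite ltr0n.
rewrite hw_sqr !powRN lef_pV2 ?posrE ?powR_gt0 // powRrM powR_mulrn ?(ltW iR) //.
by rewrite ge0_ler_powR ?nnegrE ?exprn_ge0 ?(ltW iR) ?(ltW (base_gt0 _)) //; [lra|rewrite lerDr].
Qed.

(** Sobolev embedding by Cauchy-Schwarz against the square-summable weight of order t - s. It is
    applied with (s, t) = (1, 0), which makes H^1 an algebra, and with (1 + gam, 1), which controls
    u_x and forces gam > 1/2. *)
Lemma hs_l1 s t : 2^-1 < s - t -> exists2 K, 0 < K &
  forall X B, hs s X B -> l1le (fun k => hw t k * X k) (K * B).
Proof.
move=> /hw_summable[K K0 hK]; exists K => // X B XB.
have := l1le_CS hK XB; congr l1le; apply/funext => k.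
by rewrite mulrA -hwD; congr (hw _ _ * _); ring.
Qed.

(* Tame estimate: only one factor carries the weight. *)
Lemma rconv_hs s X Y (X1 X2 Y1 Y2 : R) : 0 <= s ->
  (forall k, 0 <= X k) -> (forall k, 0 <= Y k) ->
  l1le X X1 -> l1le Y Y1 -> hs s X X2 -> hs s Y Y2 ->
  hs s (rconv X Y) (wK s * (X1 * Y2 + X2 * Y1)).
Proof.
move=> s0 Xp Yp hX1 hY1 hX2 hY2.
have wXp k : 0 <= hw s k * X k by rewrite mulr_ge0 ?hw_ge0.
have wYp k : 0 <= hw s k * Y k by rewrite mulr_ge0 ?hw_ge0.
have X1p := l1le_ge0 hX1; have Y1p := l1le_ge0 hY1.
have h : l2le (fun k => rconv X (fun k => hw s k * Y k) k +
                        rconv Y (fun k => hw s k * X k) k) (X1 * Y2 + Y1 * X2).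
  apply: (l2leD _ (rconv_l2 Xp hX1 hY2) (rconv_l2 Yp hY1 hX2)) => k.
  exact: ler_normD.
rewrite [X2 * _]mulrC; apply: (l2leZ _ _ h) => [|k]; first exact: ltW (wK_gt0 s).
have ptX k' : `|hw s k' * X k'| <= X2 by exact: (l2le_pt k' hX2).
have ptY k' : `|hw s k' * Y k'| <= Y2 by exact: (l2le_pt k' hY2).
have Yb k' : `|Y k'| <= Y1 by exact: l1le_pt hY1.
rewrite !ger0_norm; first last.
- by rewrite mulr_ge0 ?hw_ge0 //; apply: (rconv_ge0 (A := X1) (B := Y1)).
- by rewrite addr_ge0 //; [apply: (rconv_ge0 (A := X1) (B := Y2))|apply: (rconv_ge0 (A := Y1) (B := X2))].
rewrite (rconvC (X := Y) (A := Y1) (B := X2)) // /rconv.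
have sum1 := rconv_summable k hX1 ptY.
have sum2 : l1le (fun j => hw s j * X j * Y (k - j)) (Y1 * X2).
  have := l1le_inj (@subr_inj k) (rconv_summable k hY1 ptX).
  by congr l1le; apply/funext => j /=; rewrite mulrC subKr.
rewrite -(sumZZ _ (rconv_summable k hX1 Yb)) -(sumZD sum1 sum2).
have sum12 : l1le (fun j => X j * (hw s (k - j) * Y (k - j)) + hw s j * X j * Y (k - j))
    (X1 * Y2 + Y1 * X2) by apply: (l1leD _ sum1 sum2) => j; exact: ler_normD.
rewrite -(sumZZ _ sum12).
apply: (@ler_sumZ _ _ _ (hw s k * (X1 * Y1)) (wK s * (X1 * Y2 + Y1 * X2))).
- apply: (l1leZ (x := fun j => X j * Y (k - j))) => [|j|]; rewrite ?hw_ge0 //.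
    by rewrite normrM (ger0_norm (hw_ge0 _ _)).
  exact: rconv_summable.
- apply: (l1leZ (x := fun j => X j * (hw s (k - j) * Y (k - j)) + hw s j * X j * Y (k - j))) => [|j|//].
    exact: ltW (wK_gt0 s).
  by rewrite normrM (ger0_norm (ltW (wK_gt0 s))).
move=> j; rewrite (_ : X j * _ + _ = (hw s j + hw s (k - j)) * (X j * Y (k - j))); last by ring.
rewrite [X in _ <= X]mulrA ler_wpM2r ?mulr_ge0 //.
by rewrite (le_trans _ (hw_sub j (k - j) s0)) // addrC subrK.
Qed.

End Weights.

(** * Fourier series on the torus *)

Section TorusFunctions.
Variable R : realType.
Implicit Types (f g : R -> R[i]) (a b : int -> R[i]) (x y : R) (k j : int).

Lemma echarE k x : echar k x = eit (k%:~R * x).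
Proof. by rewrite -cexp_eit /echar; congr cexp; apply: complex_ext; rewrite ?ReM ?ImM /=; ring. Qed.

Lemma cn_echar k x : cn (echar k x) = 1.
Proof. by rewrite echarE cn_eit. Qed.

Lemma echarD k j x : echar (k + j) x = echar k x * echar j x.
Proof. by rewrite !echarE intrD mulrDl eitD. Qed.

Lemma echar0 x : echar 0 x = 1.
Proof. by rewrite echarE mul0r eit0. Qed.

Lemma echarN k x : echar (- k) x = ((echar k x)^*)%C.
Proof. by rewrite !echarE mulrNz mulNr eitN. Qed.

Lemma eit_2pi (n : nat) : eit (2 * pi * n%:R) = 1 :> R[i].
Proof.
elim: n => [|n IH]; first by rewrite mulr0 eit0.
rewrite -[n.+1]addn1 natrD mulrDr mulr1 eitD IH mul1r /eit.
by rewrite (_ : 2 * pi = pi *+ 2) ?cos2pi ?sin2pi // mulr_natl.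
Qed.

Lemma echar_periodic k x : echar k (x + 2 * pi) = echar k x.
Proof.
rewrite !echarE mulrDr eitD -[RHS]mulr1; congr (_ * _).
case: k => n; first by rewrite mulrC -pmulrn eit_2pi.
by rewrite NegzE mulrNz mulNr eitN mulrC -pmulrn eit_2pi conjc1.
Qed.

Lemma ccont_cst (c : R[i]) : ccontinuous (fun=> c : R[i]).
Proof. by split=> x; exact: cst_continuous. Qed.

Lemma ccontD f g : ccontinuous f -> ccontinuous g -> ccontinuous (fun x => f x + g x).
Proof.
move=> [fr fi] [gr gi]; split=> x.
  under eq_fun do rewrite ReD; exact: continuousD (fr x) (gr x).
under eq_fun do rewrite ImD; exact: continuousD (fi x) (gi x).
Qed.

Lemma ccontM f g : ccontinuous f -> ccontinuous g -> ccontinuous (fun x => f x * g x).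
Proof.
move=> [fr fi] [gr gi]; split=> x.
  under eq_fun do rewrite ReM; exact: continuousB (continuousM (fr x) (gr x)) (continuousM (fi x) (gi x)).
under eq_fun do rewrite ImM; exact: continuousD (continuousM (fr x) (gi x)) (continuousM (fi x) (gr x)).
Qed.

Lemma ccontB f g : ccontinuous f -> ccontinuous g -> ccontinuous (fun x => f x - g x).
Proof.
move=> cf cg; have := ccontD cf (ccontM (ccont_cst (-1)) cg).
by under eq_fun do rewrite mulN1r.
Qed.

Lemma ccont_sum (I : Type) (s : seq I) (F : I -> R -> R[i]) :
  (forall i, ccontinuous (F i)) -> ccontinuous (fun x => \sum_(i <- s) F i x).
Proof.
move=> cF; elim: s => [|i s IH].
  by under eq_fun do rewrite big_nil; exact: ccont_cst.
by under eq_fun do rewrite big_cons; exact: ccontD.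
Qed.

Lemma ccont_echar k : ccontinuous (@echar R k).
Proof.
have c x : {for x, continuous (fun x => k%:~R * x : R)}.
  by apply: continuousM => //; exact: cst_continuous.
split=> x; under eq_fun do rewrite echarE /=.
  by apply: continuous_comp; [exact: c|exact: continuous_cos].
by apply: continuous_comp; [exact: c|exact: continuous_sin].
Qed.

Lemma ccontP f : (forall x (e : R), 0 < e -> \forall y \near x, cn (f y - f x) < e) ->
  ccontinuous f.
Proof.
move=> h; split=> x; apply/cvgrPdist_lt => e /(h x); apply: filterS => y /= yx.
  by rewrite (le_lt_trans _ yx) // cnC (le_trans _ (Re_le_cn _)) // ReD ReN.
by rewrite (le_lt_trans _ yx) // cnC (le_trans _ (Im_le_cn _)) // ImD ImN.
Qed.

Lemma ccont_near f x (e : R) : ccontinuous f -> 0 < e -> \forall y \near x, cn (f y - f x) < e.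
Proof.
move=> [fr fi] e0; have e2 : 0 < e / 2 by rewrite divr_gt0.
have /cvgrPdist_lt /(_ _ e2) h1 := fr x; have /cvgrPdist_lt /(_ _ e2) h2 := fi x.
near=> y; rewrite cnC (le_lt_trans (cn_le_ReIm _)) // [ltRHS]splitr ReD ReN ImD ImN.
by rewrite ltrD //; near: y.
Unshelve. all: by end_near.
Qed.

Lemma ccont_unif f : (forall e : R, 0 < e -> exists2 g, ccontinuous g &
  forall x, cn (f x - g x) <= e) -> ccontinuous f.
Proof.
move=> h; apply: ccontP => x e e0; have e4 : 0 < e / 4 by rewrite divr_gt0.
have [g cg fg] := h _ e4.
near=> y; have gyx : cn (g y - g x) < e / 4 by near: y; exact: ccont_near.
have -> : f y - f x = (f y - g y) + (g y - g x) + - (f x - g x) by ring.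
have h1 := fg y; have h2 := fg x.
rewrite (le_lt_trans (cnD _ _)) // cnN (le_lt_trans (lerD (cnD _ _) (lexx _))) //; lra.
Unshelve. all: by end_near.
Qed.

Lemma ccont_bounded f (u v : R) : ccontinuous f -> u <= v ->
  exists2 B, 0 <= B & forall x, u <= x <= v -> cn (f x) <= B.
Proof.
move=> [fr fi] uv.
have cr : {within `[u, v], continuous (fun x => `|complex.Re (f x)| + `|complex.Im (f x)|)}.
  have h1 : continuous (fun x => `|complex.Re (f x)|).
    by move=> x; apply: continuous_comp; [exact: fr|exact: norm_continuous].
  have h2 : continuous (fun x => `|complex.Im (f x)|).
    by move=> x; apply: continuous_comp; [exact: fi|exact: norm_continuous].
  by apply: continuous_subspaceT => x; exact: continuousD (h1 x) (h2 x).
have [c _ cM] := EVT_max uv cr; exists (`|complex.Re (f c)| + `|complex.Im (f c)|) => [|x xuv].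
  by rewrite addr_ge0.
by rewrite (le_trans (cn_le_ReIm _)) // cM.
Qed.

Lemma measurable_torus : measurable (@torus R).
Proof. exact: measurable_itv. Qed.

Lemma pi2_gt0 : 0 < 2 * pi :> R.
Proof. by rewrite mulr_gt0 // pi_gt0. Qed.

Lemma mu_torus : lebesgue_measure (@torus R) = (2 * pi)%:E.
Proof. by rewrite /torus lebesgue_measure_itv /= lte_fin pi2_gt0 sube0. Qed.

Lemma torus_integrable (g : R -> R) : continuous g ->
  (@lebesgue_measure R).-integrable (@torus R) (EFin \o g).
Proof.
move=> cg; apply: continuous_compact_integrable; first exact: segment_compact.
exact: continuous_subspaceT.
Qed.

Lemma tintD f g : ccontinuous f -> ccontinuous g ->
  tint (fun x => f x + g x) = tint f + tint g.
Proof.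
move=> [fr fi] [gr gi]; apply: complex_ext; rewrite /tint /=.
  under eq_Rintegral do rewrite ReD.
  by rewrite RintegralD //; [exact: measurable_torus|exact: torus_integrable|exact: torus_integrable].
under eq_Rintegral do rewrite ImD.
by rewrite RintegralD //; [exact: measurable_torus|exact: torus_integrable|exact: torus_integrable].
Qed.

Lemma cont_scale (c : R) (g : R -> R) : continuous g -> continuous (fun x => c * g x).
Proof. by move=> cg x; apply: continuousM; [exact: cst_continuous|exact: cg]. Qed.

Lemma tintZ (c : R[i]) f : ccontinuous f -> tint (fun x => c * f x) = c * tint f.
Proof.
move=> [fr fi]; apply: complex_ext; rewrite ?ReM ?ImM /tint /=.
  under eq_Rintegral do rewrite ReM.
  rewrite RintegralB ?RintegralZl //; try exact: measurable_torus;
    apply: torus_integrable => //; exact: cont_scale.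
under eq_Rintegral do rewrite ImM.
rewrite RintegralD ?RintegralZl //; try exact: measurable_torus;
  apply: torus_integrable => //; exact: cont_scale.
Qed.

Lemma tint_sum (I : Type) (s : seq I) (F : I -> R -> R[i]) :
  (forall i, ccontinuous (F i)) -> tint (fun x => \sum_(i <- s) F i x) = \sum_(i <- s) tint (F i).
Proof.
move=> cF; elim: s => [|i s IH]; last first.
  under [X in tint X]eq_fun do rewrite big_cons.
  by rewrite big_cons tintD ?IH //; exact: ccont_sum.
rewrite big_nil; under [X in tint X]eq_fun do rewrite big_nil.
rewrite /tint /Rintegral /=.
by rewrite (_ : (\int[_]_(x in _) (0 : R)%:E)%E = 0%E) //; exact: integral0.
Qed.

Lemma Rintegral_le_bound (g : R -> R) B : continuous g ->
  (forall x, x \in `[0, 2 * pi] -> `|g x| <= B) ->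
  `|(\int[@lebesgue_measure R]_(x in @torus R) g x)%R| <= 2 * pi * B.
Proof.
move=> cg gB; rewrite (le_trans (le_normr_Rintegral _ _)) //.
- exact: measurable_torus.
- exact: torus_integrable.
have -> : 2 * pi * B = (\int[@lebesgue_measure R]_(x in @torus R) B)%R.
  by rewrite Rintegral_cst; [rewrite mulrC; congr (_ * _); exact: (esym (congr1 fine mu_torus))|exact: measurable_torus].
apply: le_Rintegral.
- exact: measurable_torus.
- apply: torus_integrable => x; apply: continuous_comp; [exact: cg|exact: norm_continuous].
- by apply: torus_integrable => x; exact: cst_continuous.
- by move=> x xT; apply: gB.
Qed.

Lemma fourierE f k : fourier f k = ((2 * pi)^-1)%:C * tint (fun x => f x * echar (- k) x).
Proof. by []. Qed.

Let contfe f k : ccontinuous f -> ccontinuous (fun x => f x * echar (- k) x).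
Proof. by move=> cf; apply: ccontM => //; exact: ccont_echar. Qed.

Lemma fourierD f g k : ccontinuous f -> ccontinuous g ->
  fourier (fun x => f x + g x) k = fourier f k + fourier g k.
Proof.
move=> cf cg; rewrite !fourierE -mulrDr -tintD; [|exact: contfe|exact: contfe].
by congr (_ * tint _); apply/funext => x; rewrite mulrDl.
Qed.

Lemma fourierZ c f k : ccontinuous f -> fourier (fun x => c * f x) k = c * fourier f k.
Proof.
move=> cf; rewrite !fourierE mulrCA -(tintZ c (contfe k cf)).
by congr (_ * tint _); apply/funext => x; rewrite mulrA.
Qed.

Lemma fourierB f g k : ccontinuous f -> ccontinuous g ->
  fourier (fun x => f x - g x) k = fourier f k - fourier g k.
Proof.
move=> cf cg; rewrite (_ : (fun x => f x - g x) = (fun x => f x + (-1) * g x)).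
  rewrite fourierD //; last by apply: ccontM => //; exact: ccont_cst.
  by rewrite fourierZ // mulN1r.
by apply/funext => x; rewrite mulN1r.
Qed.

Lemma fourier_echar f j k : fourier (fun x => f x * echar j x) k = fourier f (k - j).
Proof.
rewrite !fourierE; congr (_ * tint _); apply/funext => x.
by rewrite -mulrA -echarD; congr (_ * echar _ x); ring.
Qed.

Lemma fourier_sum (I : Type) (s : seq I) (F : I -> R -> R[i]) k :
  (forall i, ccontinuous (F i)) ->
  fourier (fun x => \sum_(i <- s) F i x) k = \sum_(i <- s) fourier (F i) k.
Proof.
move=> cF; rewrite fourierE -mulr_sumr -tint_sum; last by move=> i; exact: contfe.
by congr (_ * tint _); apply/funext => x; rewrite mulr_suml.
Qed.

End TorusFunctions.

(** * Absolutely convergent Fourier series and their coefficients *)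

Section FourierSeries.
Variable R : realType.
Implicit Types (f g : R -> R[i]) (a b : int -> R[i]) (x y : R) (k j : int).

Lemma tint_conj f : ccontinuous f -> tint (fun x => ((f x)^*)%C) = ((tint f)^*)%C.
Proof.
move=> [fr fi]; apply: complex_ext; rewrite ?ReJ ?ImJ /tint /=.
  by apply: eq_Rintegral => x _; rewrite ReJ.
rewrite -mulN1r -RintegralZl; [|exact: measurable_torus|exact: torus_integrable].
by apply: eq_Rintegral => x _; rewrite ImJ mulN1r.
Qed.

Lemma fourier_conj f k : ccontinuous f ->
  fourier (fun x => ((f x)^*)%C) k = ((fourier f (- k))^*)%C.
Proof.
move=> cf; rewrite !fourierE conjM; rewrite conjc_real; congr (_ * _).
rewrite -(tint_conj (ccontM cf (@ccont_echar R (- - k)))).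
by congr tint; apply/funext => x; rewrite conjM -echarN !opprK.
Qed.

Lemma is_derive_linear (c x : R) : is_derive x (1 : R) (fun y : R => c * y) c.
Proof.
by have := @is_deriveZ _ _ _ (@id R) c x 1 1 (is_derive_id x 1); rewrite /GRing.scale /= mulr1.
Qed.

Lemma is_derive_shift (c x : R) : is_derive x (1 : R) (fun y : R => c + y) 1.
Proof.
rewrite -[X in is_derive _ _ _ X]add0r.
exact: is_deriveD.
Qed.

Lemma is_derive_cos_lin (c x : R) :
  is_derive x (1 : R) (fun y : R => cos (c * y)) (- sin (c * x) * c).
Proof. by apply: is_derive1_comp; exact: is_derive_linear. Qed.

Lemma is_derive_sin_lin (c x : R) :
  is_derive x (1 : R) (fun y : R => sin (c * y)) (cos (c * x) * c).
Proof. by apply: is_derive1_comp; exact: is_derive_linear. Qed.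

Lemma is_derive_continuous (f : R -> R) x d : is_derive x (1 : R) f d -> {for x, continuous f}.
Proof. by move=> [df _]; apply/differentiable_continuous; rewrite -derivable1_diffP. Qed.

Lemma Rintegral_deriv (f F : R -> R) : (forall x, is_derive x (1 : R) F (f x)) ->
  continuous f -> F (2 * pi) = F 0 ->
  (\int[@lebesgue_measure R]_(x in @torus R) f x)%R = 0.
Proof.
move=> dF cf F2; rewrite /Rintegral.
have -> : (\int[@lebesgue_measure R]_(x in @torus R) (f x)%:E)%E = ((F (2 * pi))%:E - (F 0)%:E)%E.
  apply: continuous_FTC2; first exact: pi2_gt0.
  - exact: continuous_subspaceT.
  - split=> [x _||]; first by have [] := dF x.
    + by apply: cvg_at_right_filter; exact: is_derive_continuous (dF 0).
    + by apply: cvg_at_left_filter; exact: is_derive_continuous (dF (2 * pi)).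
  - by move=> x _; rewrite derive1E; have [_ ->] := dF x.
by rewrite F2 subee.
Qed.

Lemma tint_echar k : tint (echar k) = ((if k == 0 then 2 * pi else 0) : R)%:C.
Proof.
have [->|k0] := eqVneq k 0.
  rewrite (_ : echar 0 = fun=> 1); last by apply/funext => x; rewrite echar0.
  apply: complex_ext; rewrite /tint /=.
    rewrite Rintegral_cst ?mul1r; [exact: (congr1 (@fine R) (@mu_torus R))|exact: measurable_torus].
  by rewrite Rintegral_cst ?mul0r //; exact: measurable_torus.
have kR : (k%:~R : R) != 0 by rewrite intr_eq0.
have [c s] : ccontinuous (fun x : R => eit (k%:~R * x)).
  rewrite (_ : (fun x => _) = echar k); first exact: ccont_echar.
  by apply/funext => x; rewrite echarE.
have E : eit (k%:~R * (2 * pi)) = 1 :> R[i].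
  by rewrite -echarE -[2 * pi]add0r echar_periodic echarE mulr0 eit0.
have Ec : cos (k%:~R * (2 * pi)) = 1 :> R by exact: (congr1 (fun z => complex.Re z) E).
have Es : sin (k%:~R * (2 * pi)) = 0 :> R by exact: (congr1 (fun z => complex.Im z) E).
rewrite (_ : echar k = fun x => eit (k%:~R * x)); last by apply/funext => x; rewrite echarE.
apply: complex_ext; rewrite /tint /=.
  apply: (@Rintegral_deriv _ (fun x => (k%:~R)^-1 * sin (k%:~R * x))) => //.
    move=> x; rewrite /= -[X in is_derive _ _ _ X](mulKf kR) mulrCA mulrC.
    have := @is_deriveZ _ _ _ _ (k%:~R)^-1 x 1 _ (is_derive_sin_lin k%:~R x).
    by rewrite /GRing.scale /=; congr is_derive; ring.
  by rewrite /= Es !mulr0 sin0 mulr0.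
apply: (@Rintegral_deriv _ (fun x => - (k%:~R)^-1 * cos (k%:~R * x))) => //.
  move=> x; rewrite /=.
  have := @is_deriveZ _ _ _ _ (- (k%:~R)^-1) x 1 _ (is_derive_cos_lin k%:~R x).
  by rewrite /GRing.scale /=; congr is_derive; field.
by rewrite /= Ec !mulr0 cos0.
Qed.

Definition fS a x : R[i] := csumZ (fun k => a k * echar k x).

Lemma ma_echar a x : ma (fun k => a k * echar k x) = ma a.
Proof. by apply/funext => k; rewrite /ma cnM cn_echar mulr1. Qed.

Lemma fS_cvg a A x : l1le (ma a) A ->
  ccvg (fun N => \sum_(k <- win N) a k * echar k x) (fS a x).
Proof. by move=> aA; apply: (csumZ_cvg (C := A)); rewrite ma_echar. Qed.

Lemma fS_le a A x : l1le (ma a) A -> cn (fS a x) <= A.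
Proof. by move=> aA; apply: csumZ_le; rewrite ma_echar. Qed.

Lemma fS_periodic a x : fS a (x + 2 * pi) = fS a x.
Proof. by congr csumZ; apply/funext => k; rewrite echar_periodic. Qed.

Lemma fS_tail a A : l1le (ma a) A -> forall e : R, 0 < e -> exists N, forall n, (N <= n)%N ->
  forall x, cn (fS a x - \sum_(k <- win n) a k * echar k x) <= e.
Proof.
move=> aA e e0; have [N NP] := l1_tail aA e0.
exists N => n Nn x; apply: (@csumZ_tail _ _ A); rewrite ?ma_echar // => s us sn.
rewrite (le_trans _ (NP n Nn s us sn)) // ler_sum // => k _.
by rewrite cnM cn_echar mulr1 ma_norm.
Qed.

Lemma ccont_term (c : R[i]) k : ccontinuous (fun x => c * echar k x).
Proof. by apply: ccontM; [exact: ccont_cst|exact: ccont_echar]. Qed.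

Lemma ccont_fS a A : l1le (ma a) A -> ccontinuous (fS a).
Proof.
move=> aA; apply: ccont_unif => e e0; have [N NP] := fS_tail aA e0.
exists (fun x => \sum_(k <- win N) a k * echar k x); last exact: NP (leqnn N).
by apply: ccont_sum => k; exact: ccont_term.
Qed.

Lemma fourier_bounded f : ccontinuous f -> exists2 B, 0 <= B &
  (forall x, x \in `[0, 2 * pi] -> cn (f x) <= B) /\
  forall k, cn (fourier f k) <= 2 * B.
Proof.
move=> cf; have [B B0 fB] := ccont_bounded cf (ltW (@pi2_gt0 R)).
exists B => //; split=> [x|k]; first by rewrite in_itv; exact: fB.
rewrite fourierE cnM cn_pos ?invr_ge0 ?(ltW (@pi2_gt0 _)) //.
rewrite mulrC ler_pdivrMr ?pi2_gt0 //.
have [cr ci] := ccontM cf (@ccont_echar R (- k)).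
rewrite (le_trans (cn_le_ReIm _)) // (_ : 2 * B * _ = 2 * pi * B + 2 * pi * B); last by ring.
apply: lerD; apply: Rintegral_le_bound => // x; rewrite in_itv => /fB xB;
  rewrite (le_trans _ xB) // -[cn (f x)]mulr1 -(cn_echar (- k) x) -cnM ?Re_le_cn ?Im_le_cn //.
Qed.

(** The factor 2 arises because [tint] is defined componentwise, so the real and the imaginary
    integral are bounded separately. *)
Lemma fourier_near f g (B : R) k : ccontinuous f -> ccontinuous g ->
  (forall x, x \in `[0, 2 * pi] -> cn (f x - g x) <= B) ->
  cn (fourier f k - fourier g k) <= 2 * B.
Proof.
move=> cf cg fgB; have cfg := ccontB cf cg; rewrite -fourierB //.
rewrite fourierE cnM cn_pos ?invr_ge0 ?(ltW (@pi2_gt0 _)) //.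
rewrite mulrC ler_pdivrMr ?pi2_gt0 //.
have [cr ci] := ccontM cfg (@ccont_echar R (- k)).
rewrite (le_trans (cn_le_ReIm _)) // (_ : 2 * B * _ = 2 * pi * B + 2 * pi * B); last by ring.
apply: lerD; apply: Rintegral_le_bound => // x /fgB xB;
  rewrite (le_trans _ xB) // -[cn (f x - g x)]mulr1 -(cn_echar (- k) x) -cnM ?Re_le_cn ?Im_le_cn //.
Qed.

(** For a trigonometric polynomial this is the shift rule [fourier_echar]. Its partial sums
    approximate the series uniformly, and a Fourier coefficient is continuous for uniform
    convergence. *)
Lemma fourier_mulS f b B k : ccontinuous f -> l1le (ma b) B ->
  fourier (fun x => f x * fS b x) k = csumZ (fun j => b j * fourier f (k - j)).
Proof.
move=> cf bB; apply/esym/csumZ_lim.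
have [D D0 [fD _]] := fourier_bounded cf; have cS := ccont_fS bB.
apply/cvgrPdist_lt => e e0.
have e1 : 0 < e / (2 * D + 1) / 2 by rewrite !divr_gt0 // ltr_wpDl ?mulr_ge0.
have [N NP] := fS_tail bB e1.
exists N => // n /= Nn; rewrite sub0r normrN ger0_norm ?cn_ge0 //.
have cn_ : ccontinuous (fun x => f x * \sum_(j <- win n) b j * echar j x).
  by apply: ccontM => //; apply: ccont_sum => j; exact: ccont_term.
have -> : \sum_(j <- win n) b j * fourier f (k - j) =
    fourier (fun x => f x * \sum_(j <- win n) b j * echar j x) k.
  under eq_bigr do rewrite -fourier_echar -(fourierZ _ _ (ccontM cf (@ccont_echar R _))).
  rewrite -fourier_sum; last first.
    by move=> j; apply: ccontM; [exact: ccont_cst|apply: ccontM => //; exact: ccont_echar].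
  apply: (congr1 (fun F => fourier F k)); apply/funext => x.
  by rewrite mulr_sumr; apply: eq_bigr => j _; rewrite mulrCA.
rewrite (le_lt_trans (fourier_near (B := D * (e / (2 * D + 1) / 2)) k cn_ (ccontM cf cS) _)) //.
  move=> x /fD fxD; rewrite -mulrBr cnM ler_pM ?cn_ge0 // cnC; exact: NP.
rewrite (_ : 2 * (D * _) = D * e / (2 * D + 1)); last by field; rewrite gt_eqF // ltr_wpDl ?mulr_ge0.
rewrite ltr_pdivrMr ?ltr_wpDl ?mulr_ge0 // mulrDr mulr1; have := mulr_ge0 D0 (ltW e0); nra.
Qed.

Lemma fourier1 k : fourier (fun=> 1 : R[i]) k = (k == 0)%:R.
Proof.
rewrite fourierE (_ : (fun x => 1 * echar (- k) x) = echar (- k)); last first.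
  by apply/funext => x; rewrite mul1r.
rewrite tint_echar oppr_eq0; case: eqP => _; last by rewrite mulr0.
by rewrite -rmorphM mulVf // gt_eqF // pi2_gt0.
Qed.

(** The case f = 1 of the product formula, where only the index j = k survives. *)
Lemma fourier_fS a A k : l1le (ma a) A -> fourier (fS a) k = a k.
Proof.
move=> aA; rewrite (_ : fS a = fun x => 1 * fS a x); last by apply/funext => x; rewrite mul1r.
rewrite (fourier_mulS _ (ccont_cst 1) aA) (@csumZ_delta _ _ k); first by rewrite subrr fourier1 eqxx mulr1.
by move=> j jk; rewrite fourier1 subr_eq0 eq_sym (negbTE jk) mulr0.
Qed.

Lemma fourier_mul_fS a b A B k : l1le (ma a) A -> l1le (ma b) B ->
  fourier (fun x => fS a x * fS b x) k = conv b a k.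
Proof.
move=> aA bB; rewrite (fourier_mulS _ (ccont_fS aA) bB).
by congr csumZ; apply/funext => j; rewrite (fourier_fS _ aA).
Qed.

End FourierSeries.

(** * A positivity argument with trigonometric peaks *)

Section Uniqueness.
Variable R : realType.
Implicit Types (f : R -> R[i]) (g : R -> R) (x y : R).

Lemma cos_far (d y : R) : 0 < d <= pi -> d <= `|y| <= 2 * pi - d -> cos y <= cos d.
Proof.
move=> /andP[d0 dpi].
have h z : d <= z <= pi -> cos z <= cos d.
  move=> /andP[dz zpi]; rewrite leNgt; apply/negP => cdz.
  have : z < d by rewrite -ltr_cos // ?in_itv /= ?zpi ?dpi ?(ltW d0) ?(le_trans (ltW d0)).
  by rewrite ltNge dz.
wlog y0 : y / 0 <= y.
  move=> W; have [/W//|y0] := leP 0 y; rewrite -cosN -normrN; apply: W.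
  by rewrite oppr_ge0 ltW.
rewrite ger0_norm // => /andP[dy y2]; have [ypi|piy] := leP y pi; first by rewrite h // dy.
rewrite -(cosN y) -(cosD2pi (- y)) h // -mulr_natl; lra.
Qed.

Lemma cos_near (d y : R) : 0 <= d <= pi -> `|y| <= d -> cos d <= cos y.
Proof.
move=> /andP[d0 dpi] yd; have -> : cos y = cos `|y|.
  by have [y0|y0] := leP 0 y; [rewrite ger0_norm|rewrite ltr0_norm // cosN].
rewrite leNgt; apply/negP => cdz.
have : d < `|y| by rewrite -ltr_cos // ?in_itv /= ?normr_ge0 ?d0 ?dpi ?(le_trans yd).
by rewrite ltNge yd.
Qed.

Lemma cos_lt (c d : R) : 0 <= c < d -> d <= pi -> cos d < cos c.
Proof.
move=> /andP[c0 cd] dpi; rewrite ltr_cos // in_itv /= ?c0 ?dpi ?(ltW (le_lt_trans c0 cd)) //.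
by rewrite (le_trans (ltW cd)).
Qed.

(* The powers of 1 - cos d + cos (x - x0) peak around x0: they grow geometrically
   on |x - x0| <= d / 2 and stay bounded by 1 outside |x - x0| < d. *)
Definition peak (x0 d x : R) : R := 1 - cos d + cos (x - x0).

Lemma peak_cont x0 d n : continuous (fun x => peak x0 d x ^+ n).
Proof.
have c : continuous (peak x0 d).
  have c1 : continuous (fun x : R => x - x0).
    by move=> x; apply: continuousB; [exact: id|exact: cst_continuous].
  have c2 : continuous (fun x : R => cos (x - x0)).
    by move=> x; apply: continuous_comp; [exact: c1|exact: continuous_cos].
  by move=> x; exact: continuousD (@cst_continuous _ _ _ x) (c2 x).
elim: n => [|n IH] x; first by under eq_fun do rewrite expr0; exact: cst_continuous.
by under eq_fun do rewrite exprS; exact: continuousM (c x) (IH x).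
Qed.

(** If g x0 > 0, the integral of g times the n-th power of the peak over a short interval around x0
    grows geometrically with n, while the contribution from the rest of the period is bounded below;
    this contradicts the vanishing of all these integrals. *)
Lemma peak_le0 g : continuous g ->
  (forall x0 d n, (\int[@lebesgue_measure R]_(x in @torus R) (g x * peak x0 d x ^+ n))%R = 0) ->
  forall x0, 0 < x0 < 2 * pi -> g x0 <= 0.
Proof.
move=> cg g0 x0 /andP[x00 x02]; rewrite leNgt; apply/negP => gx0.
set c := g x0 / 2; have c0 : 0 < c by rewrite divr_gt0.
have [r /= r0 rP] : exists2 r : R, 0 < r & forall y, `|x0 - y| < r -> c < g y.
  have /cvgrPdist_lt /(_ c c0) [r /= r0 rP] := cg x0; exists r => // y /rP.
  by rewrite /c; have := ler_norm (g x0 - g y); lra.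
(* [r / 2] keeps the peak where g > c; [x0 / 2] and [(2 * pi - x0) / 2] keep it inside the period
   and away from the neighbouring maxima of the cosine; [1] keeps d below pi, where the cosine
   decreases. *)
pose d : R := Num.min (r / 2) (Num.min (x0 / 2) (Num.min ((2 * pi - x0) / 2) 1)).
have d0 : 0 < d by rewrite !lt_min ltr01 !divr_gt0 // subr_gt0.
have [dr [dx [d2x d1]]] : d <= r / 2 /\ d <= x0 / 2 /\ d <= (2 * pi - x0) / 2 /\ d <= 1.
  by rewrite /d !ge_min !lexx !orbT.
have pi2 := @pi_ge2 R; have dpi : d <= pi by lra.
have d2 : 0 <= d / 2 < d by apply/andP; split; lra.
have dr' : d < r by lra.
have d2r : d / 2 < r by lra.
set eta := cos (d / 2) - cos d.
have eta0 : 0 < eta by rewrite subr_gt0 cos_lt.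
have [M M0 gM] : exists2 M, 0 <= M & forall x, 0 <= x <= 2 * pi -> `|g x| <= M.
  have cgc : ccontinuous (fun x => (g x)%:C) by split=> x /=; [exact: cg|exact: cst_continuous].
  have [B B0 fB] := ccont_bounded cgc (ltW (@pi2_gt0 R)).
  by exists B => // x /fB; rewrite cn_real.
pose E : set R := `[x0 - d / 2, x0 + d / 2]%classic.
have ET : E `<=` @torus R.
  by move=> x; rewrite /E /torus /= !in_itv /= => /andP[? ?]; apply/andP; split; lra.
have mE : measurable E by exact: measurable_itv.
have muE : lebesgue_measure E = d%:E.
  by rewrite /E lebesgue_measure_itv /= lte_fin ifT -?EFinB; [congr _%:E|]; lra.
have mT := @measurable_torus R.
have mTE : measurable (@torus R `\` E) by exact: measurableD.
pose hn n x := g x * peak x0 d x ^+ n + M.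
have ch n : continuous (hn n).
  by move=> x; exact: continuousD (continuousM (cg x) (@peak_cont x0 d n x)) (@cst_continuous _ _ _ x).
have inT n : (@lebesgue_measure R).-integrable (@torus R) (EFin \o hn n) by exact: torus_integrable.
have inE (k : R -> R) : continuous k -> (@lebesgue_measure R).-integrable E (EFin \o k).
  move=> ck; apply: continuous_compact_integrable; first exact: segment_compact.
  exact: continuous_subspaceT.
have near_peak x n : `|x - x0| <= d / 2 -> (1 + eta) ^+ n <= peak x0 d x ^+ n.
  move=> xd; have h1 : cos (d / 2) <= cos (x - x0) by apply: cos_near => //; apply/andP; split; lra.
  have e0 := eta0; rewrite /eta in e0.
  by apply: lerXn2r; rewrite ?nnegrE /peak /eta; lra.
have hn_ge0 n x : 0 <= x <= 2 * pi -> 0 <= hn n x.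
  move=> xT; have /andP[xT0 xT2] := xT; rewrite /hn; have [xd|xd] := leP `|x - x0| d.
    have g1 : c < g x by apply: rP; rewrite distrC (le_lt_trans xd).
    have h1 : cos d <= cos (x - x0) by apply: cos_near => //; apply/andP; split; lra.
    rewrite addr_ge0 // mulr_ge0 //; first by lra.
    by rewrite exprn_ge0 // /peak; lra.
  have h1 : cos (x - x0) <= cos d.
    apply: cos_far; first by rewrite d0.
    by rewrite (ltW xd) /= ler_norml; apply/andP; split; lra.
  have h2 : `|peak x0 d x| <= 1.
    rewrite /peak ler_norml; have := cos_geN1 (x - x0).
    have : 0 <= cos d by apply: cos_ge0_pihalf; apply/andP; split; lra.
    have := cos_le1 d; move=> *; apply/andP; split; lra.
  have : `|g x * peak x0 d x ^+ n| <= M.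
    by rewrite normrM -[M]mulr1 ler_pM // ?gM // normrX exprn_ile1.
  by rewrite ler_norml => /andP[]; lra.
have key n : d * (c * (1 + eta) ^+ n) <= 2 * pi * M.
  have <- : (\int[@lebesgue_measure R]_(x in @torus R) hn n x)%R = 2 * pi * M.
    rewrite /hn RintegralD //; last 2 first.
    - by apply: torus_integrable => x; exact: continuousM (cg x) (@peak_cont x0 d n x).
    - by apply: torus_integrable => x; exact: cst_continuous.
    rewrite g0 add0r Rintegral_cst // mulrC; congr (_ * _).
    exact: (congr1 (@fine R) (@mu_torus R)).
  have -> : @torus R = E `|` (@torus R `\` E) by rewrite setDUK.
  rewrite Rintegral_setU //; last 2 first.
  - by rewrite setDUK.
  - by rewrite disj_set2E setDIK.
  rewrite -[leLHS]addr0 lerD //; last first.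
    by apply: Rintegral_ge0 => x [xT _]; apply: hn_ge0; move: xT; rewrite /torus /= in_itv.
  have -> : d * (c * (1 + eta) ^+ n) =
      (\int[@lebesgue_measure R]_(x in E) (c * (1 + eta) ^+ n))%R.
    rewrite Rintegral_cst // mulrC; congr (_ * _); exact: (esym (congr1 (@fine R) muE)).
  apply: le_Rintegral => //.
  - by apply: inE => x; exact: cst_continuous.
  - exact: inE.
  move=> x; rewrite /E /= in_itv /= => /andP[x1 x2].
  have xd : `|x - x0| <= d / 2 by rewrite ler_norml; apply/andP; split; lra.
  rewrite /hn -[leLHS]addr0 lerD // ler_pM ?(ltW c0) ?exprn_ge0 //; first by lra.
    by apply: ltW; apply: rP; rewrite distrC (le_lt_trans xd).
  exact: near_peak.
have bernoulli n : 1 + eta *+ n <= (1 + eta) ^+ n.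
  elim: n => [|n IH]; first by rewrite mulr0n expr0 addr0.
  rewrite exprS mulrS; have e1 : 0 <= eta *+ n by rewrite mulrn_wge0 // ltW.
  by have := ler_wpM2l (_ : 0 <= 1 + eta) IH; rewrite addr_ge0 ?(ltW eta0) // => /(_ isT); nra.
have dc : 0 < d * c * eta by rewrite !mulr_gt0.
set n := Num.bound (2 * pi * M / (d * c * eta)).
have := archi_boundP (_ : 0 <= 2 * pi * M / (d * c * eta)).
rewrite divr_ge0 ?(ltW dc) // ?mulr_ge0 ?pi_ge0 // => /(_ isT).
rewrite ltr_pdivrMr // => h1; have h2 := key n; have h3 := bernoulli n.
have h4 : eta *+ n <= (1 + eta) ^+ n by rewrite (le_trans _ h3) // lerDr.
have E1 : n%:R * (d * c * eta) = d * c * (eta *+ n) by rewrite -mulr_natl; ring.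
have : d * c * (eta *+ n) <= d * c * (1 + eta) ^+ n.
  by apply: ler_wpM2l h4; rewrite mulr_ge0 ?(ltW d0) ?(ltW c0).
rewrite mulrA in h2; rewrite E1 in h1.
by rewrite leNgt => /negP; apply; apply: le_lt_trans h2 h1.
Qed.

End Uniqueness.

(** * Uniqueness of Fourier coefficients, inversion, and products of series *)

Section Inversion.
Variable R : realType.
Implicit Types (f : R -> R[i]) (g : R -> R) (a b : int -> R[i]) (x y : R) (k : int).

(** A peak is a trigonometric polynomial of degree one, so multiplying by it only mixes coefficients
    k - 1, k and k + 1; by induction f times any power of a peak has zero coefficients. [peak_le0],
    applied to both signs of the real and imaginary parts, gives f = 0 inside the period; continuity
    at 0 and periodicity do the rest. *)
Lemma fourier_unique f : (forall x, f (x + 2 * pi) = f x) -> ccontinuous f ->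
  (forall k, fourier f k = 0) -> forall x, f x = 0.
Proof.
move=> fper cf f0.
have peakE x0 d x : (peak x0 d x)%:C = (1 - cos d)%:C +
    (2^-1 * eit (- x0)) * echar 1 x + (2^-1 * eit x0) * echar (-1) x.
  rewrite !echarE mul1r mulN1r -!mulrA -!eitD.
  rewrite [- x0 + x]addrC -[x0 - x]opprB eitN /peak realcD -addrA -mulrDr; congr (_ + _).
  by rewrite -[X in _ = X](mulKf (_ : 2 != 0 :> R[i])) ?pnatr_eq0 // mulrA mulVf ?pnatr_eq0 // mul1r addcJ mulKf ?pnatr_eq0.
have cP x0 d n : ccontinuous (fun x => f x * (peak x0 d x ^+ n)%:C).
  by apply: ccontM => //; split=> x /=; [exact: peak_cont|exact: cst_continuous].
have F0 x0 d n : forall k, fourier (fun x => f x * (peak x0 d x ^+ n)%:C) k = 0.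
  elim: n => [|n IH] k.
    by rewrite -(f0 k); apply: (congr1 (fun F => fourier F k)); apply/funext => x; rewrite mulr1.
  set G := (fun x => f x * (peak x0 d x ^+ n)%:C) in IH.
  have cG : ccontinuous G by exact: cP.
  have cGe j : ccontinuous (fun x => G x * echar j x) by apply: ccontM => //; exact: ccont_echar.
  have cGc c j : ccontinuous (fun x => c * (G x * echar j x)) by apply: ccontM => //; exact: ccont_cst.
  have cGz c : ccontinuous (fun x => c * G x) by apply: ccontM => //; exact: ccont_cst.
  rewrite (_ : (fun x => _) = (fun x => (1 - cos d)%:C * G x +
    2^-1 * eit (- x0) * (G x * echar 1 x) + 2^-1 * eit x0 * (G x * echar (-1) x))).
    rewrite fourierD //; last exact: ccontD.
    rewrite fourierD // !fourierZ // !fourier_echar !IH; by rewrite !mulr0 !addr0.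
  by apply/funext => x; rewrite exprS realcM peakE /G; ring.
have I0 x0 d n : tint (fun x => f x * (peak x0 d x ^+ n)%:C) = 0.
  have := F0 x0 d n 0; rewrite fourierE => /eqP; rewrite mulf_eq0 => /orP[].
    by move=> /eqP [] /eqP; rewrite invr_eq0 gt_eqF ?pi2_gt0.
  move=> /eqP <-; apply: (congr1 (@tint R)); apply/funext => x; by rewrite oppr0 echar0 mulr1.
have zero g : continuous g ->
  (forall x0 d n, (\int[@lebesgue_measure R]_(x in @torus R) (g x * peak x0 d x ^+ n))%R = 0) ->
  forall x, 0 < x < 2 * pi -> g x = 0.
  move=> cg g0 x xT; apply/eqP; rewrite eq_le (peak_le0 cg g0 xT) /= -oppr_le0.
  apply: (@peak_le0 R (fun x => - g x)) xT => [y|x0 d n]; first exact: continuousN (cg y).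
  rewrite -[RHS](mulr0 (-1)) -(g0 x0 d n) -RintegralZl; [|exact: measurable_torus|].
    by apply: eq_Rintegral => y _; rewrite mulN1r mulNr.
  by apply: torus_integrable => y; exact: continuousM (cg y) (@peak_cont R x0 d n y).
have open0 x : 0 < x < 2 * pi -> f x = 0.
  move=> xT; have [fr fi] := cf; apply: complex_ext.
    apply: (zero (fun x => complex.Re (f x))) xT => // x0 d n.
    have := congr1 (fun z => complex.Re z) (I0 x0 d n); rewrite /tint /= => <-.
    by apply: eq_Rintegral => y _; rewrite ReM /= mulr0 subr0.
  apply: (zero (fun x => complex.Im (f x))) xT => // x0 d n.
  have := congr1 (fun z => complex.Im z) (I0 x0 d n); rewrite /tint /= => <-.
  by apply: eq_Rintegral => y _; rewrite ImM /= mulr0 add0r.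
have f00 : f 0 = 0.
  apply: cn0_eq0; apply/eqP; rewrite eq_le cn_ge0 andbT; apply/ler_addgt0Pr => e e0.
  have [r /= r0 rP] := ccont_near 0 cf e0.
  pose y := Num.min (r / 2) 1.
  have pi2 := @pi_ge2 R.
  have [y0 [yr y1]] : 0 < y /\ y <= r / 2 /\ y <= 1.
    by rewrite /y lt_min ltr01 divr_gt0 // !ge_min !lexx !orbT.
  have := rP y; rewrite /ball /= sub0r normrN gtr0_norm // => /(_ _).
  rewrite open0 ?sub0r ?cnN ?add0r; last by apply/andP; split; lra.
  by move=> h; apply/ltW/h; lra.
have perN (n : nat) x : f (x + 2 * pi * n%:R) = f x.
  elim: n => [|n IH]; first by rewrite mulr0 addr0.
  by rewrite -[n.+1]addn1 natrD mulrDr mulr1 addrA fper IH.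
have perZ (n : int) x : f (x + 2 * pi * n%:~R) = f x.
  case: n => n; first exact: perN.
  by rewrite -[RHS](@perN n.+1) -[in RHS](subrK (2 * pi * n.+1%:R) x) NegzE mulrNz mulrN perN.
move=> x; set n := Num.floor (x / (2 * pi)).
have pi2 := @pi2_gt0 R.
rewrite -(perZ (- n)); set y := _ + _.
have : 0 <= y < 2 * pi.
  have /andP[h1 h2] := floor_itv (x / (2 * pi)).
  rewrite /y mulrNz mulrN subr_ge0 ltrBlDr.
  rewrite -/n ler_pdivlMr // mulrC in h1; rewrite -/n ltr_pdivrMr // intrD mulrDl mul1r in h2.
  by rewrite h1 /= addrC mulrC.
rewrite le_eqVlt => /andP[/orP[/eqP <-//|y0] y2].
by apply: open0; rewrite y0.
Qed.

Lemma fourier_inversion f A : (forall x, f (x + 2 * pi) = f x) -> ccontinuous f ->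
  l1le (ma (fourier f)) A -> f = fS (fourier f).
Proof.
move=> fper cf fA; apply/funext => x; apply/eqP; rewrite -subr_eq0; apply/eqP.
apply: (@fourier_unique (fun x => f x - fS (fourier f) x)) => [y||k].
- by rewrite fper fS_periodic.
- by apply: ccontB => //; exact: ccont_fS fA.
- by rewrite fourierB ?(fourier_fS _ fA) ?subrr //; exact: ccont_fS fA.
Qed.

(** Both sides are continuous and periodic with the same coefficients, so inversion replaces any
    rearrangement of the double series. *)
Lemma fS_mul a b A B x : l1le (ma a) A -> l1le (ma b) B ->
  fS a x * fS b x = fS (conv b a) x.
Proof.
move=> aA bB; have fE : fourier (fun x => fS a x * fS b x) = conv b a.
  by apply/funext => k; exact: fourier_mul_fS aA bB.
rewrite -fE -(@fourier_inversion _ (B * A)) // => [y||].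
- by rewrite !fS_periodic.
- by apply: ccontM; [exact: ccont_fS aA|exact: ccont_fS bB].
- by rewrite fE; exact: conv_l1.
Qed.

Lemma fS_conj a A x : l1le (ma a) A -> ((fS a x)^*)%C = fS (fun k => ((a (- k))^*)%C) x.
Proof.
move=> aA; rewrite /fS -(@csumZ_conj _ _ A) ?ma_echar // -csumZN.
by congr csumZ; apply/funext => k; rewrite conjM -echarN opprK.
Qed.

Lemma fSD a b A B x : l1le (ma a) A -> l1le (ma b) B ->
  fS (fun k => a k + b k) x = fS a x + fS b x.
Proof.
move=> aA bB; rewrite /fS -(@csumZD _ _ _ A B) ?ma_echar //.
by congr csumZ; apply/funext => k; rewrite mulrDl.
Qed.

Lemma fSB a b A B x : l1le (ma a) A -> l1le (ma b) B ->
  fS (fun k => a k - b k) x = fS a x - fS b x.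
Proof.
move=> aA bB; rewrite /fS -(@csumZB _ _ _ A B) ?ma_echar //.
by congr csumZ; apply/funext => k; rewrite mulrBl.
Qed.

Lemma fSZ a A c x : l1le (ma a) A -> fS (fun k => c * a k) x = c * fS a x.
Proof.
move=> aA; rewrite /fS -(@csumZZ _ _ _ A) ?ma_echar //.
by congr csumZ; apply/funext => k; rewrite mulrA.
Qed.

End Inversion.

(** * Complex-valued functions of time *)

Section ComplexCalculus.
Variable R : realType.
Implicit Types (f g : R -> R[i]) (s t c d : R) (k : int).

Lemma cder_eq f t (d d' : R[i]) : is_cderive f t d -> d = d' -> is_cderive f t d'.
Proof. by move=> h <-. Qed.

Lemma cder_cst (z : R[i]) t : is_cderive (fun=> z) t 0.
Proof. by split; exact: is_derive_cst. Qed.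

Lemma cderD f g t df dg : is_cderive f t df -> is_cderive g t dg ->
  is_cderive (fun s => f s + g s) t (df + dg).
Proof.
move=> [fr fi] [gr gi]; split.
  by under eq_fun do rewrite ReD; rewrite ReD; exact: is_deriveD.
by under eq_fun do rewrite ImD; rewrite ImD; exact: is_deriveD.
Qed.

Lemma cderM f g t df dg : is_cderive f t df -> is_cderive g t dg ->
  is_cderive (fun s => f s * g s) t (df * g t + f t * dg).
Proof.
move=> [fr fi] [gr gi]; split.
  under eq_fun do rewrite ReM; rewrite ReD !ReM.
  apply: is_derive_eq (is_deriveB (is_deriveM fr gr) (is_deriveM fi gi)) _.
  by rewrite /GRing.scale /=; ring.
under eq_fun do rewrite ImM; rewrite ImD !ImM.
apply: is_derive_eq (is_deriveD (is_deriveM fr gi) (is_deriveM fi gr)) _.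
by rewrite /GRing.scale /=; ring.
Qed.

Lemma cderZ (z : R[i]) f t df : is_cderive f t df -> is_cderive (fun s => z * f s) t (z * df).
Proof.
by move=> /(cderM (cder_cst z t)) h; apply: cder_eq h _; rewrite mul0r add0r.
Qed.

Lemma cder_conj f t df : is_cderive f t df -> is_cderive (fun s => ((f s)^*)%C) t (df^*)%C.
Proof.
move=> [fr fi]; split.
  by under eq_fun do rewrite ReJ; rewrite ReJ.
by under eq_fun do rewrite ImJ; rewrite ImJ; exact: is_deriveN.
Qed.

Lemma cderB f g t df dg : is_cderive f t df -> is_cderive g t dg ->
  is_cderive (fun s => f s - g s) t (df - dg).
Proof.
move=> fd /(cderZ (-1)) gd; have := cderD fd gd.
by rewrite mulN1r; under eq_fun do rewrite mulN1r.
Qed.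

Lemma cder_sum (I : Type) (s : seq I) (F : I -> R -> R[i]) (dF : I -> R[i]) t :
  (forall i, is_cderive (F i) t (dF i)) ->
  is_cderive (fun r => \sum_(i <- s) F i r) t (\sum_(i <- s) dF i).
Proof.
move=> h; elim: s => [|i s IH].
  by rewrite big_nil; under eq_fun do rewrite big_nil; exact: cder_cst.
by rewrite big_cons; under eq_fun do rewrite big_cons; exact: cderD.
Qed.

Lemma cder_real (u : R -> R) t du : is_derive t (1 : R) u du -> is_cderive (fun s => (u s)%:C) t du%:C.
Proof. by move=> h; split=> //=; exact: is_derive_cst. Qed.

Lemma cder_id t : is_cderive (fun s => s%:C) t 1.
Proof. by apply: cder_real; exact: is_derive_id. Qed.

Lemma cder_eit c t : is_cderive (fun s => eit (c * s)) t ('i%C * c%:C * eit (c * t)).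
Proof.
split; rewrite ?ReM ?ImM /= ?ReM ?ImM /=.
  by apply: is_derive_eq (is_derive_cos_lin c t) _; ring.
by apply: is_derive_eq (is_derive_sin_lin c t) _; ring.
Qed.

Lemma cder_shift f c t df : is_cderive f (c + t) df -> is_cderive (fun s => f (c + s)) t df.
Proof.
move=> [fr fi]; split.
  by apply: is_derive_eq (is_derive1_comp fr (is_derive_shift c t)) _; rewrite mulr1.
by apply: is_derive_eq (is_derive1_comp fi (is_derive_shift c t)) _; rewrite mulr1.
Qed.

Lemma is_derive_rev (c t : R) : is_derive t (1 : R) (fun y : R => c - y) (- 1).
Proof. by rewrite -[X in is_derive _ _ _ X]add0r; exact: is_deriveD. Qed.

Lemma cder_rev f c t df : is_cderive f (c - t) df -> is_cderive (fun s => f (c - s)) t (- df).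
Proof.
move=> [fr fi]; split.
  by rewrite ReN; apply: is_derive_eq (@is_derive1_comp _ _ (fun y => c - y) t _ _ fr (is_derive_rev c t)) _; rewrite mulrN1.
by rewrite ImN; apply: is_derive_eq (@is_derive1_comp _ _ (fun y => c - y) t _ _ fi (is_derive_rev c t)) _; rewrite mulrN1.
Qed.

(** Continuity relative to the closed interval, since nothing is known about the solution outside
    [0, T]. Together with derivatives in the interior it is what the mean value theorem asks for. *)
Definition ccon (L : R) f : Prop := forall t, 0 <= t <= L -> forall e : R, 0 < e ->
  exists2 d : R, 0 < d & forall s, 0 <= s <= L -> `|t - s| < d -> cn (f t - f s) <= e.

Lemma ccon_le (L L' : R) f : L' <= L -> ccon L f -> ccon L' f.
Proof.
move=> LL h t /andP[t0 tL] e e0.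
have [|d d0 dP] := h t _ e e0; first by rewrite t0 (le_trans tL).
by exists d => // s /andP[s0 sL]; apply: dP; rewrite s0 (le_trans sL).
Qed.

Lemma ccon_cst L (z : R[i]) : ccon L (fun=> z).
Proof. by move=> t _ e e0; exists 1 => // s _ _; rewrite subrr cn0 ltW. Qed.

Lemma cconD L f g : ccon L f -> ccon L g -> ccon L (fun s => f s + g s).
Proof.
move=> cf cg t tL e e0; have e2 : 0 < e / 2 by rewrite divr_gt0.
have [d1 d10 P1] := cf t tL _ e2; have [d2 d20 P2] := cg t tL _ e2.
exists (Num.min d1 d2) => [|s sL]; first by rewrite lt_min d10.
rewrite lt_min => /andP[/(P1 s sL) h1 /(P2 s sL) h2].
by rewrite opprD addrACA (le_trans (cnD _ _)) // [leRHS]splitr lerD.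
Qed.

Lemma cconM L f g : ccon L f -> ccon L g -> ccon L (fun s => f s * g s).
Proof.
move=> cf cg t tL e e0.
set A := cn (f t) + 1; set B := cn (g t) + 1.
have A0 : 0 < A by rewrite ltr_wpDl ?cn_ge0. have B0 : 0 < B by rewrite ltr_wpDl ?cn_ge0.
have e1 : 0 < e / 2 / B by rewrite !divr_gt0.
have e2 : 0 < e / 2 / A by rewrite !divr_gt0.
have [d1 d10 P1] := cf t tL _ e1; have [d2 d20 P2] := cg t tL _ e2.
have [d3 d30 P3] := cg t tL _ ltr01.
exists (Num.min d1 (Num.min d2 d3)) => [|s sL]; first by rewrite !lt_min d10 d20.
rewrite !lt_min => /and3P[/(P1 s sL) h1 /(P2 s sL) h2 /(P3 s sL) h3].
have -> : f t * g t - f s * g s = f t * (g t - g s) + g s * (f t - f s) by ring.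
have gs : cn (g s) <= B.
  have := cnB (g t) (g t - g s); rewrite subKr => /le_trans; apply.
  by rewrite /B lerD2l.
rewrite (le_trans (cnD _ _)) // [leRHS]splitr !cnM lerD //.
  have -> : e / 2 = A * (e / 2 / A) by rewrite [RHS]mulrC divfK // gt_eqF.
  by apply: ler_pM; rewrite ?cn_ge0 // /A lerDl.
have -> : e / 2 = B * (e / 2 / B) by rewrite [RHS]mulrC divfK // gt_eqF.
by apply: ler_pM; rewrite ?cn_ge0.
Qed.

Lemma cconZ L (z : R[i]) f : ccon L f -> ccon L (fun s => z * f s).
Proof. by apply: cconM; exact: ccon_cst. Qed.

Lemma cconB L f g : ccon L f -> ccon L g -> ccon L (fun s => f s - g s).
Proof.
by move=> cf /(cconZ (-1)) /(cconD cf); under eq_fun do rewrite mulN1r.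
Qed.

Lemma ccon_conj L f : ccon L f -> ccon L (fun s => ((f s)^*)%C).
Proof.
move=> cf t tL e e0; have [d d0 dP] := cf t tL e e0.
by exists d => // s sL ts; rewrite -conjN -conjD cn_conj dP.
Qed.

Lemma ccon_sum L (I : Type) (s : seq I) (F : I -> R -> R[i]) :
  (forall i, ccon L (F i)) -> ccon L (fun r => \sum_(i <- s) F i r).
Proof.
move=> h; elim: s => [|i s IH].
  by under eq_fun do rewrite big_nil; exact: ccon_cst.
by under eq_fun do rewrite big_cons; exact: cconD.
Qed.

Lemma ccon_continuous L f : ccontinuous f -> ccon L f.
Proof.
move=> cf t _ e e0; have [d /= d0 dP] := ccont_near t cf e0.
by exists d => // s _ ts; rewrite cnC ltW // dP.
Qed.

Lemma ccon_derive L f (df : R -> R[i]) : (forall t, is_cderive f t (df t)) -> ccon L f.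
Proof.
move=> h; apply: ccon_continuous; split=> t; have [hr hi] := h t.
  exact: is_derive_continuous hr.
exact: is_derive_continuous hi.
Qed.

Lemma ccon_eit L c : ccon L (fun s => eit (c * s)).
Proof. by apply: ccon_derive => t; exact: cder_eit. Qed.

Lemma ccon_shift L (c : R) f L' : 0 <= c -> c + L' <= L -> ccon L f -> ccon L' (fun s => f (c + s)).
Proof.
move=> c0 cL cf t /andP[t0 tL] e e0.
have [|d d0 dP] := cf (c + t) _ e e0; first by apply/andP; split; lra.
exists d => // s /andP[s0 sL] ts; apply: dP; first by apply/andP; split; lra.
by rewrite opprD addrACA subrr add0r.
Qed.

Lemma ccon_rev L (c : R) f L' : c <= L -> L' <= c -> ccon L f -> ccon L' (fun s => f (c - s)).
Proof.
move=> c0 cL cf t /andP[t0 tL] e e0.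
have [|d d0 dP] := cf (c - t) _ e e0; first by apply/andP; split; lra.
exists d => // s /andP[s0 sL] ts; apply: dP; first by apply/andP; split; lra.
by rewrite opprB addrC addrA subrK distrC.
Qed.

Lemma ccon_within L f (z : R[i]) : ccon L f ->
  {within `[0, L], continuous (fun t => complex.Re (z * f t))}.
Proof.
move=> /(cconZ z) cf; apply/subspace_continuousP => t; rewrite /= in_itv /= => tL.
apply/cvgrPdist_lt => e e0; have e2 : 0 < e / 2 by rewrite divr_gt0.
have [d d0 dP] := cf t tL _ e2.
rewrite near_withinE; exists d => //= s ts; rewrite in_itv /= => sL.
have -> : complex.Re (z * f t) - complex.Re (z * f s) = complex.Re (z * f t - z * f s).
  by rewrite ReD ReN.
by rewrite (le_lt_trans (Re_le_cn _)) // (le_lt_trans (dP s sL ts)) //; lra.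
Qed.

(* For d = g(L) - g(0), the mean value theorem is applied to the scalar function
   sum_k w_k^2 Re(conj(d_k) g_k). *)
Lemma mvt_l2 (I : Type) (r : seq I) (w : I -> R) (g dg : I -> R -> R[i]) (L K : R) :
  0 <= L -> (forall i, ccon L (g i)) ->
  (forall i t, 0 < t < L -> is_cderive (g i) t (dg i t)) ->
  (forall t, 0 < t < L -> \sum_(i <- r) (w i * cn (dg i t)) ^+ 2 <= K ^+ 2) ->
  \sum_(i <- r) (w i * cn (g i L - g i 0)) ^+ 2 <= (L * K) ^+ 2.
Proof.
rewrite le_eqVlt => /orP[/eqP <- _ _ _|L0 cg gd gK].
  by rewrite big1 ?mul0r ?expr0n // => i _; rewrite subrr cn0 mulr0 expr0n.
pose e i := g i L - g i 0.
pose G t := complex.Re (\sum_(i <- r) (w i ^+ 2)%:C * (e i)^*%C * g i t).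
pose dG t := complex.Re (\sum_(i <- r) (w i ^+ 2)%:C * (e i)^*%C * dg i t).
have [| |t tL] := @MVT _ G dG _ _ L0.
- move=> t; rewrite in_itv /= => tL.
  have [] // := @cder_sum _ r (fun i s => (w i ^+ 2)%:C * (e i)^*%C * g i s)
     (fun i => (w i ^+ 2)%:C * (e i)^*%C * dg i t) t.
  by move=> i; apply: cderZ; exact: gd.
- have -> : G = fun t => complex.Re (1 * \sum_(i <- r) (w i ^+ 2)%:C * (e i)^*%C * g i t).
    by apply/funext => t; rewrite mul1r.
  apply: ccon_within.
  by apply: ccon_sum => i; exact: cconZ.
rewrite subr0 in_itv /= in tL * => E.
have S : G L - G 0 = \sum_(i <- r) (w i * cn (e i)) ^+ 2.
  rewrite /G -ReN -ReD -sumrB Re_sum; apply: eq_bigr => i _.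
  rewrite -mulrBr -/(e i) -mulrA [_^*%C * _]mulrC mulconj -realcM sqmodulusE /=.
  by rewrite exprMn.
(* AM-GM on each term. The left side equals [G L - G 0], which by [S] is the sum to be bounded, so
   half of it is absorbed. *)
have B : dG t * L <= \sum_(i <- r) (w i * cn (e i)) ^+ 2 / 2 + (L * K) ^+ 2 / 2.
  rewrite (le_trans (_ : _ <= \sum_(i <- r) (w i * cn (e i)) ^+ 2 / 2 +
    \sum_(i <- r) (L * (w i * cn (dg i t))) ^+ 2 / 2)) //.
    rewrite -big_split /= /dG Re_sum mulr_suml ler_sum // => i _.
    have h : complex.Re ((w i ^+ 2)%:C * (e i)^*%C * dg i t) <= w i ^+ 2 * (cn (e i) * cn (dg i t)).
      rewrite (le_trans (ler_norm _)) // (le_trans (Re_le_cn _)) // !cnM cn_conj.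
      by rewrite cn_pos ?sqr_ge0 // mulrA.
    rewrite (le_trans (ler_wpM2r (ltW L0) h)) //.
    rewrite -subr_ge0.
    rewrite (_ : _ - _ = (w i * cn (e i) - L * (w i * cn (dg i t))) ^+ 2 / 2); last by field.
    by rewrite divr_ge0 // sqr_ge0.
  rewrite lerD2l -mulr_suml ler_wpM2r // exprMn.
  under eq_bigr do rewrite exprMn.
  by rewrite -mulr_sumr ler_wpM2l ?sqr_ge0 // gK.
move: B; rewrite -E S -mulr_suml -/(e _); rewrite /e; lra.
Qed.

Lemma mvt_complex L f (df : R -> R[i]) K : 0 <= L -> 0 <= K -> ccon L f ->
  (forall t, 0 < t < L -> is_cderive f t (df t)) ->
  (forall t, 0 < t < L -> cn (df t) <= K) -> cn (f L - f 0) <= L * K.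
Proof.
move=> L0 K0 cf fd fK.
have := @mvt_l2 unit [:: tt] (fun=> 1) (fun=> f) (fun=> df) L K L0 (fun=> cf) (fun=> fd).
rewrite big_seq1 mul1r => h; rewrite -ler_sqr ?nnegrE ?cn_ge0 ?mulr_ge0 //; apply: h => t tL.
by rewrite big_seq1 mul1r lerXn2r ?nnegrE ?cn_ge0 // fK.
Qed.

(** [mvt_l2] holds on every finite set of frequencies with the same constant, and [hs] asks for
    nothing more; derivatives are taken one coefficient at a time, never in a function space. *)
Lemma mvt_hs (sg L K : R) (g dg : int -> R -> R[i]) : 0 <= L -> 0 <= K ->
  (forall i, ccon L (g i)) ->
  (forall i t, 0 < t < L -> is_cderive (g i) t (dg i t)) ->
  (forall t, 0 < t < L -> hs sg (ma (fun k => dg k t)) K) ->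
  hs sg (ma (fun k => g k L - g k 0)) (L * K).
Proof.
move=> L0 K0 cg gd gK; split=> [|s us]; first exact: mulr_ge0.
by apply: (mvt_l2 L0 cg gd) => t tL; have [_ /(_ s us)] := gK t tL.
Qed.

Lemma cn_eit_sub1 (x : R) : cn (eit x - 1) <= `|x|.
Proof.
have := @mvt_complex 1 (fun s => eit (x * s)) (fun t => 'i%C * x%:C * eit (x * t)) `|x|.
rewrite mulr1 mulr0 eit0 mul1r; apply => // [|t _|t _]; first exact: ccon_eit.
  exact: cder_eit.
by rewrite !cnM cn_i cn_eit cn_real mul1r mulr1.
Qed.

Lemma cn_eit_sub1_2 (x : R) : cn (eit x - 1) <= 2.
Proof. by rewrite (le_trans (cnB _ _)) // cn_eit cn1. Qed.

(** Interpolation of the bounds |x| and 2: the first is used for |x| <= 1, where |x| <= |x|^gam, the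
    second beyond. *)
Lemma cn_eit_holder (gam x : R) : 0 <= gam <= 1 -> cn (eit x - 1) <= 2 * `|x| `^ gam.
Proof.
move=> /andP[g0 g1]; have [x1|x1] := leP `|x| 1.
  have [->|x0] := eqVneq x 0; first by rewrite eit0 subrr cn0 mulr_ge0 ?powR_ge0.
  rewrite (le_trans (cn_eit_sub1 x)) //.
  have h : `|x| <= `|x| `^ gam by apply: ger1_powR => //; rewrite normr_gt0 x0.
  by rewrite (le_trans h) // ler_peMl ?powR_ge0 // ler1n.
rewrite (le_trans (cn_eit_sub1_2 x)) // ler_peMr //.
by rewrite -(powRr0 `|x|) ler_powR // ltW.
Qed.

(* The integral of e^{i c r} over 0 <= r <= s. *)
Definition Iph (c s : R) : R[i] := s%:C * phi1 ('i%C * (c * s)%:C).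

Lemma Iph0 s : Iph 0 s = s%:C.
Proof. by rewrite /Iph /phi1 mul0r mulr0 eqxx mulr1. Qed.

Lemma i_neq0 : ('i%C : R[i]) != 0.
Proof. by apply/eqP => -[] /eqP; rewrite oner_eq0. Qed.

Lemma realc_eq0 (x : R) : (x%:C == 0 :> R[i]) = (x == 0).
Proof. by apply/eqP/eqP => [[]|->]. Qed.

Lemma IphE c s : c != 0 -> Iph c s = (eit (c * s) - 1) / ('i%C * c%:C).
Proof.
move=> c0; rewrite /Iph /phi1 mulf_eq0 (negbTE i_neq0) /= realc_eq0 mulf_eq0 (negbTE c0) /=.
have [->|s0] := eqVneq s 0; first by rewrite mulr0 eit0 subrr !mul0r.
rewrite cexp_eit realcM; field.
by rewrite !realc_eq0 s0 c0 i_neq0.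
Qed.

Lemma cder_Iph c t : is_cderive (Iph c) t (eit (c * t)).
Proof.
have [->|c0] := eqVneq c 0.
  by rewrite (_ : Iph 0 = fun s => s%:C); [rewrite mul0r eit0; exact: cder_id|apply/funext => s; exact: Iph0].
rewrite (_ : Iph c = fun s => ('i%C * c%:C)^-1 * (eit (c * s) - 1)); last first.
  by apply/funext => s; rewrite IphE // mulrC.
have := cderZ ('i%C * c%:C)^-1 (cderB (cder_eit c t) (cder_cst 1 t)).
move=> h; apply: cder_eq h _; rewrite subr0 mulKf //.
by rewrite mulf_neq0 ?i_neq0 // realc_eq0.
Qed.

Lemma Iph_s0 c : Iph c 0 = 0.
Proof. by rewrite /Iph mul0r. Qed.

Lemma cn_Iph c s : 0 <= s -> cn (Iph c s) <= s.
Proof.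
move=> s0; rewrite -[X in cn X]subr0 -(Iph_s0 c) -[leRHS]mulr1.
apply: (@mvt_complex s (Iph c) (fun t => eit (c * t))) => // [|t _|t _].
- by apply: ccon_derive => t; exact: cder_Iph.
- exact: cder_Iph.
- by rewrite cn_eit.
Qed.

(** The modulus of (e^{i c s} - 1) / (i c) is at most 2 / |c|. This is the smoothing of phi_1: with
    c = - k^2 it gains two derivatives, without a power of s. *)
Lemma cn_Iph_c c s : 0 <= s -> `|c| * cn (Iph c s) <= 2.
Proof.
move=> s0; have [->|c0] := eqVneq c 0; first by rewrite normr0 mul0r.
rewrite IphE // cnM cnV cnM cn_i mul1r cn_real mulrCA divff ?normr_eq0 // mulr1.
exact: cn_eit_sub1_2.
Qed.

Lemma phi1_conj (z : R[i]) : (phi1 z)^*%C = phi1 z^*%C.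
Proof.
rewrite /phi1 conjc_eq0; case: eqP => _; first exact: conjc1.
rewrite conjM conjc_inv conjD conjN conjc1; congr ((_ - _) / _).
by case: z => a b; rewrite /cexp /= cosN sinN mulrN.
Qed.

Lemma Iph_conj c s : (Iph c s)^*%C = Iph (- c) s.
Proof.
rewrite /Iph conjM phi1_conj conjc_real; congr (_ * phi1 _).
by apply: complex_ext; rewrite ?ReJ ?ImJ ?ReM ?ImM /=; ring.
Qed.

End ComplexCalculus.

(** * Termwise differentiation of series *)

Section SeriesDerivative.
Variable R : realType.
Implicit Types (f : R -> R[i]) (s t : R).

Lemma is_derive_epsP (f : R -> R) t (df : R) :
  is_derive t (1 : R) f df <->
  forall e : R, 0 < e -> exists2 d : R, 0 < d & forall h, h != 0 -> `|h| < d ->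
    `|f (t + h) - f t - h * df| <= e * `|h|.
Proof.
have E h : h != 0 -> `|f (t + h) - f t - h * df| =
    `|df - h^-1 *: ((f \o shift t) (h *: 1) - f t)| * `|h|.
  move=> h0; rewrite -normrM -normrN /GRing.scale /= mulr1; congr `|_|.
  rewrite [h + t]addrC; field; exact: h0.
split=> [[fd fv] e e0|H].
  have : h^-1 *: ((f \o shift t) (h *: 1) - f t) @[h --> 0^'] --> df by rewrite -fv; exact: fd.
  move=> /cvgrPdist_lt /(_ e e0) [d /= d0 dP]; exists d => // h h0 hd.
  by rewrite E // ler_wpM2r // ltW // dP //= sub0r normrN.
have L : h^-1 *: ((f \o shift t) (h *: 1) - f t) @[h --> 0^'] --> df.
  apply/cvgrPdist_le => e /H[d d0 dP]; exists d => //= h; rewrite /ball /= sub0r normrN => hd h0.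
  by have := dP h h0 hd; rewrite E // ler_pM2r ?normr_gt0.
by apply: DeriveDef; [apply/cvg_ex; exists df|exact: cvg_lim L].
Qed.

Lemma is_cderive_epsP f t (df : R[i]) :
  is_cderive f t df <->
  forall e : R, 0 < e -> exists2 d : R, 0 < d & forall h, h != 0 -> `|h| < d ->
    cn (f (t + h) - f t - h%:C * df) <= e * `|h|.
Proof.
have Re_ (h : R) : complex.Re (f (t + h) - f t - h%:C * df) =
    complex.Re (f (t + h)) - complex.Re (f t) - h * complex.Re df.
  by rewrite ReD ReN ReM ReD ReN /= mul0r subr0.
have Im_ (h : R) : complex.Im (f (t + h) - f t - h%:C * df) =
    complex.Im (f (t + h)) - complex.Im (f t) - h * complex.Im df.
  by rewrite ImD ImN ImM ImD ImN /= mul0r addr0.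
split=> [[/is_derive_epsP hr /is_derive_epsP hi] e e0|H].
  have e2 : 0 < e / 2 by rewrite divr_gt0.
  have [d1 d10 P1] := hr _ e2; have [d2 d20 P2] := hi _ e2.
  exists (Num.min d1 d2) => [|h h0]; first by rewrite lt_min d10.
  rewrite lt_min => /andP[/(P1 h h0) h1 /(P2 h h0) h2].
  rewrite (le_trans (cn_le_ReIm _)) // Re_ Im_; lra.
split; apply/is_derive_epsP => e /H[d d0 dP]; exists d => // h h0 /(dP h h0);
  apply: le_trans; rewrite -?Re_ -?Im_ ?Re_le_cn ?Im_le_cn //.
Qed.

Lemma mvt_complex_int f (df : R -> R[i]) (K t h : R) : 0 <= K ->
  (forall t, is_cderive f t (df t)) -> (forall t, cn (df t) <= K) ->
  cn (f (t + h) - f t) <= `|h| * K.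
Proof.
move=> K0 fd fK; have [h0|h0] := leP 0 h.
  have := @mvt_complex _ h (fun s => f (t + s)) (fun s => df (t + s)) K h0 K0.
  rewrite addr0 ger0_norm //; apply=> // [|s _].
    by apply: (ccon_derive (df := fun s => df (t + s))) => s; exact: cder_shift.
  exact: cder_shift.
have h0' : 0 <= - h by rewrite oppr_ge0 ltW.
have := @mvt_complex _ (- h) (fun s => f (t + h + s)) (fun s => df (t + h + s)) K h0' K0.
rewrite addr0 addrK cnC ltr0_norm //; apply=> // [|s _].
  by apply: (ccon_derive (df := fun s => df (t + h + s))) => s; exact: cder_shift.
exact: cder_shift.
Qed.

(** By the mean value theorem the increment of term j is at most [M j] times |h|. The tails of the
    difference quotients are thus small uniformly in h, and only a finite sum is really
    differentiated. *)
Lemma cder_csumZ (F dF : int -> R -> R[i]) (M : int -> R) (C t : R) :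
  l1le M C -> (forall j s, is_cderive (F j) s (dF j s)) ->
  (forall j s, cn (dF j s) <= M j) -> (forall s, exists A, l1le (ma (fun j => F j s)) A) ->
  is_cderive (fun s => csumZ (fun j => F j s)) t (csumZ (fun j => dF j t)).
Proof.
move=> MC Fd dFM FA; apply/is_cderive_epsP => e e0.
have M0 j : 0 <= M j by apply: le_trans (cn_ge0 _) (dFM j 0).
have e4 : 0 < e / 4 by rewrite divr_gt0.
have [N NP] := l1_tail MC e4.
have tailM r : uniq r -> (forall k, k \in r -> k \notin win N) -> \sum_(k <- r) M k <= e / 4.
  move=> ur rN; rewrite (le_trans _ (NP N (leqnn N) r ur rN)) // ler_sum // => k _.
  exact: ler_norm.
have [d d0 dP] := (is_cderive_epsP _ _ _).1 (@cder_sum _ _ (win N) F (fun j => dF j t) t (fun j => Fd j t)) _ e4.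
exists d => // h h0 hd.
have [A1 hA1] := FA (t + h); have [A2 hA2] := FA t.
have dFC : l1le (ma (fun j => dF j t)) C by apply: (l1le_ma (x := M)).
have lip j : cn (F j (t + h) - F j t) <= `|h| * M j.
  exact: (@mvt_complex_int (F j) (dF j)).
have hA3 : l1le (ma (fun j => F j (t + h) - F j t)) (A1 + A2).
  by apply: (l1leD _ hA1 hA2) => j; rewrite !ma_norm cnB.
have T1 : cn (csumZ (fun j => F j (t + h) - F j t) - \sum_(j <- win N) (F j (t + h) - F j t)) <= `|h| * (e / 4).
  apply: (csumZ_tail hA3) => r ur rN; rewrite (le_trans _ (ler_wpM2l (normr_ge0 h) (tailM r ur rN))) //.
  by rewrite mulr_sumr ler_sum.
have T2 : cn (csumZ (fun j => dF j t) - \sum_(j <- win N) dF j t) <= e / 4.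
  by apply: (csumZ_tail dFC) => r ur rN; rewrite (le_trans _ (tailM r ur rN)) // ler_sum.
have T3 := dP h h0 hd.
rewrite -(csumZB hA1 hA2).
set S := csumZ _ in T1 *; set S' := csumZ _ in T2 *.
rewrite sumrB in T1.
set P1 := \sum_(j <- win N) F j (t + h) in T1 T3 *; set P2 := \sum_(j <- win N) F j t in T1 T3 *.
set P3 := \sum_(j <- win N) dF j t in T2 T3 *.
have -> : S - h%:C * S' = (S - (P1 - P2)) + ((P1 - P2 - h%:C * P3) + - (h%:C * (S' - P3))) by ring.
rewrite (le_trans (cnD _ _)) // (le_trans (lerD (lexx _) (cnD _ _))) // cnN cnM cn_real.
have := mulr_ge0 (normr_ge0 h) (ltW e0); have := ler_wpM2l (normr_ge0 h) T2; move: T1 T3; rewrite -/P1 -/P2; set nh := `|h|; nra.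
Qed.

End SeriesDerivative.

(** * Convergence of the Schroedinger scheme *)

Section Trilinear.
Variable R : realType.
Implicit Types (a b c mu : int -> R[i]) (s : R) (k j i : int).

(* Fourier coefficients of the complex conjugate. *)
Definition cr a k : R[i] := (a (- k))^*%C.

(* Fourier coefficients of f^2 m(conj f), for f with coefficients a and m the
   multiplier mu. *)
Definition tri mu a : int -> R[i] := conv (fun j => mu j * cr a j) (conv a a).

Lemma crB a b : cr (fun k => a k - b k) = fun k => cr a k - cr b k.
Proof. by apply/funext => k; rewrite /cr conjD conjN. Qed.

Lemma l1_cr a A : l1le (ma a) A -> l1le (ma (cr a)) A.
Proof.
move=> /(l1le_inj (@oppr_inj _)) h; apply: l1le_le h => k /=.
by rewrite !ma_norm cn_conj.
Qed.

Lemma hs_cr s a A : hs s (ma a) A -> hs s (ma (cr a)) A.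
Proof. by move=> /hs_opp h; apply: hs_le h => k; rewrite !ma_norm cn_conj. Qed.

Lemma l1_mult mu a A : (forall k, cn (mu k) <= 1) -> l1le (ma a) A ->
  l1le (ma (fun k => mu k * a k)) A.
Proof. by move=> m1; apply: l1le_le => k; rewrite !ma_norm cnM ler_piMl ?cn_ge0. Qed.

Lemma hs_mult s mu a A : (forall k, cn (mu k) <= 1) -> hs s (ma a) A ->
  hs s (ma (fun k => mu k * a k)) A.
Proof. by move=> m1; apply: hs_le => k; rewrite !ma_norm cnM ler_piMl ?cn_ge0. Qed.

Lemma hs_maD s a b (A B : R) : hs s (ma a) A -> hs s (ma b) B ->
  hs s (ma (fun k => a k + b k)) (A + B).
Proof. by apply: hsD => k; rewrite !ma_norm cnD. Qed.

Lemma hs_maB s a b (A B : R) : hs s (ma a) A -> hs s (ma b) B ->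
  hs s (ma (fun k => a k - b k)) (A + B).
Proof. by apply: hsD => k; rewrite !ma_norm cnB. Qed.

Lemma hs_maZ s (z : R[i]) a (A : R) : hs s (ma a) A ->
  hs s (ma (fun k => z * a k)) (cn z * A).
Proof. by apply: hsZ => [|k]; rewrite ?cn_ge0 // !ma_norm cnM. Qed.

Lemma l1_maD a b (A B : R) : l1le (ma a) A -> l1le (ma b) B ->
  l1le (ma (fun k => a k + b k)) (A + B).
Proof. by apply: l1leD => k; rewrite !ma_norm cnD. Qed.

Lemma ma_ge0 a k : 0 <= ma a k. Proof. exact: cn_ge0. Qed.

Lemma conv_hs s a b (A1 A2 B1 B2 : R) : 0 <= s -> l1le (ma a) A1 -> l1le (ma b) B1 ->
  hs s (ma a) A2 -> hs s (ma b) B2 ->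
  hs s (ma (conv a b)) (wK s * (A1 * B2 + A2 * B1)).
Proof.
move=> s0 a1 b1 a2 b2.
have := rconv_hs s0 (ma_ge0 a) (ma_ge0 b) a1 b1 a2 b2; apply: hs_le => k.
rewrite ma_norm (le_trans (cn_conv k a1 (fun k => ma_pt k b1))) //; exact: ler_norm.
Qed.

Lemma tri_l1 mu a A : (forall k, cn (mu k) <= 1) -> l1le (ma a) A ->
  l1le (ma (tri mu a)) (A * (A * A)).
Proof. by move=> m1 aA; apply: conv_l1; [apply: l1_mult m1 _; exact: l1_cr|exact: conv_l1]. Qed.

Lemma tri_hs s mu a A B : 0 <= s -> (forall k, cn (mu k) <= 1) ->
  l1le (ma a) A -> hs s (ma a) B ->
  hs s (ma (tri mu a)) (wK s * (2 * wK s + 1) * (A ^+ 2 * B)).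
Proof.
move=> s0 m1 aA aB; set W := wK s.
have D2 := conv_hs s0 aA aA aB aB.
have := conv_hs s0 (l1_mult m1 (l1_cr aA)) (conv_l1 aA aA) (hs_mult m1 (hs_cr aB)) D2.
by congr hs; rewrite -/W; ring.
Qed.

(** The factor of [d1 * M1 * M2] when the three terms of [tri_lip] are added; it is twice that of
    [d2 * M1 ^+ 2]. *)
Definition triK s : R := wK s * (4 * wK s + 2).

Lemma triK_gt0 s : 0 < triK s.
Proof. by have W0 := @wK_gt0 R s; rewrite mulr_gt0 // addr_gt0 // mulr_gt0. Qed.

(** The three factors are replaced one at a time, which leaves three terms with exactly one factor
    [a - b] each; [conv_hs] is applied twice to every one of them. *)
Lemma tri_lip s mu a b M1 M2 d1 d2 : 0 <= s -> (forall k, cn (mu k) <= 1) ->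
  l1le (ma a) M1 -> hs s (ma a) M2 -> l1le (ma b) M1 -> hs s (ma b) M2 ->
  l1le (ma (fun k => a k - b k)) d1 -> hs s (ma (fun k => a k - b k)) d2 ->
  hs s (ma (fun k => tri mu a k - tri mu b k)) (triK s * (d2 * M1 ^+ 2 + d1 * M1 * M2)).
Proof.
move=> s0 m1 a1 a2 b1 b2 e1 e2; set e := fun k => a k - b k in e1 e2.
have M10 := l1le_ge0 a1; have M20 := l2le_ge0 a2.
have d10 := l1le_ge0 e1; have d20 := l2le_ge0 e2.
have W0 := @wK_gt0 R s.
have E k : tri mu a k - tri mu b k = conv (fun j => mu j * cr e j) (conv a a) k +
  (conv (fun j => mu j * cr b j) (conv e a) k + conv (fun j => mu j * cr b j) (conv b e) k).
  have mc := l1_mult m1 (l1_cr b1); have mca := l1_mult m1 (l1_cr a1).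
  have p x y (X Y : R) : l1le (ma x) X -> l1le (ma y) Y -> forall k, cn (conv x y k) <= X * Y.
    by move=> hx hy k'; exact: ma_pt (conv_l1 hx hy).
  have pa := p _ _ _ _ a1 a1; have pba := p _ _ _ _ b1 a1; have pbb := p _ _ _ _ b1 b1.
  have -> : conv e a = fun k => conv a a k - conv b a k.
    by apply/funext => k'; rewrite (convBl k' a1 b1 (fun i => ma_pt i a1)).
  have -> : conv b e = fun k => conv b a k - conv b b k.
    by apply/funext => k'; rewrite (convBr k' b1 (fun i => ma_pt i a1) (fun i => ma_pt i b1)).
  rewrite (convBr k mc pa pba) (convBr k mc pba pbb).
  rewrite (_ : (fun j => mu j * cr e j) = fun j => mu j * cr a j - mu j * cr b j); last first.
    by apply/funext => j; rewrite crB mulrBr.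
  by rewrite (convBl k mca mc pa) /tri; ring.
have T1 := conv_hs s0 (l1_mult m1 (l1_cr e1)) (conv_l1 a1 a1) (hs_mult m1 (hs_cr e2)) (conv_hs s0 a1 a1 a2 a2).
have T2 := conv_hs s0 (l1_mult m1 (l1_cr b1)) (conv_l1 e1 a1) (hs_mult m1 (hs_cr b2)) (conv_hs s0 e1 a1 e2 a2).
have T3 := conv_hs s0 (l1_mult m1 (l1_cr b1)) (conv_l1 b1 e1) (hs_mult m1 (hs_cr b2)) (conv_hs s0 b1 e1 b2 e2).
have := hs_maD T1 (hs_maD T2 T3).
under eq_fun do rewrite -E; apply: l2leW.
rewrite /triK; set W := wK s in W0 *.
have P1 : 0 <= W * W * (d1 * M1 * M2) by rewrite !mulr_ge0 // ltW.
have P2 : 0 <= W * W * (d2 * M1 ^+ 2) by rewrite !mulr_ge0 ?exprn_ge0 // ltW.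
have P3 : 0 <= W * (d2 * M1 ^+ 2) by rewrite !mulr_ge0 ?exprn_ge0 // ltW.
rewrite -subr_ge0.
rewrite (_ : _ - _ = 2 * (W * W * (d2 * M1 ^+ 2)) + W * (d2 * M1 ^+ 2)); last by ring.
lra.
Qed.

(* A multiplier bounded by eps w(j) w(i) w(l), where j + i + l = k, costs one
   weight w on every factor. *)
Lemma tri_mult_hs s t (m : int -> int -> int -> R[i]) a (T : int -> R[i]) (eps A B : R) :
  0 <= s -> 0 <= eps ->
  (forall k j i, cn (m k j i) <= eps * (hw t j * hw t i * hw t (k - j - i))) ->
  l1le (fun k => hw t k * ma a k) A -> hs (s + t) (ma a) B ->
  (forall k, T k = csumZ (fun j => csumZ (fun i => m k j i * (cr a j * (a i * a (k - j - i)))))) ->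
  hs s (ma T) (eps * (wK s * (2 * wK s + 1) * (A ^+ 2 * B))).
Proof.
move=> s0 e0 mb a1 /hs_shift a2 TE.
set X := fun k => hw t k * ma a k in a1 a2.
have X0 k : 0 <= X k by rewrite mulr_ge0 ?hw_ge0 ?ma_ge0.
pose Y k := X (- k).
have Y0 k : 0 <= Y k by exact: X0.
have y1 : l1le Y A by exact: l1le_inj (@oppr_inj _) a1.
have y2 : hs s Y B by exact: hs_opp.
have D0 k : 0 <= rconv X X k by apply: (rconv_ge0 (A := A) (B := A)) => // i; exact: l1le_pt a1.
have D2 := rconv_hs s0 X0 X0 a1 a1 a2 a2.
have F2 := rconv_hs s0 Y0 D0 y1 (rconv_l1 a1 a1) y2 D2.
have -> : wK s * (2 * wK s + 1) * (A ^+ 2 * B) =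
  wK s * (A * (wK s * (A * B + B * A)) + B * (A * A)) by ring.
apply: (hsZ _ _ F2) => // k; rewrite ma_norm TE.
have Xb k' : `|X k'| <= A by exact: l1le_pt a1.
have Db k' : `|rconv X X k'| <= A * A by exact: l1le_pt (rconv_l1 a1 a1).
have S1 := rconv_summable k y1 Db.
rewrite [`|_|]ger0_norm; last by apply: (rconv_ge0 (A := A) (B := A * A)).
rewrite /rconv -(sumZZ eps S1).
have S1e : l1le (fun j => eps * (Y j * rconv X X (k - j))) (eps * (A * (A * A))).
  by apply: (l1leZ (x := fun j => Y j * rconv X X (k - j))) S1 => // j; rewrite normrM ger0_norm.
apply: (csumZ_le_sumZ _ S1e) => j.
have S2 := rconv_summable (k - j) a1 Xb.
have S2e : l1le (fun i => eps * Y j * (X i * X (k - j - i))) (eps * Y j * (A * A)).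
  apply: (l1leZ (x := fun i => X i * X (k - j - i))) S2 => [|i]; first by rewrite mulr_ge0.
  by rewrite normrM ger0_norm // mulr_ge0.
rewrite mulrA /rconv -(sumZZ (eps * Y j) S2).
apply: (csumZ_le_sumZ _ S2e) => i.
rewrite !cnM cn_conj (le_trans (ler_wpM2r _ (mb k j i))) ?mulr_ge0 ?cn_ge0 //.
by rewrite /Y /X hwN /ma le_eqVlt; apply/orP; left; apply/eqP; ring.
Qed.

End Trilinear.

(** * The exact Schroedinger flow on coefficients, its symmetries and its phases *)

Section ExactFlow.
Variable R : realType.
Implicit Types (a c : int -> R[i]) (u : R -> int -> R[i]) (s t L gam rho : R) (k j i : int).

Definition ksq k : R := k%:~R ^+ 2.
Definition one_mult (k : int) : R[i] := 1.

Lemma cn_one_mult k : cn (one_mult k) <= 1. Proof. by rewrite cn1. Qed.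

Lemma ksqN k : ksq (- k) = ksq k. Proof. by rewrite /ksq mulrNz sqrrN. Qed.
Lemma ksq_ge0 k : 0 <= ksq k. Proof. exact: sqr_ge0. Qed.
(* Fourier coefficients of an H^{1+gam} solution on [0, L] with norm at most rho. *)
Definition seqsol L rho gam u : Prop :=
  [/\ forall t, 0 <= t <= L -> hs (1 + gam) (ma (u t)) rho,
      forall k, ccon L (fun t => u t k)
    & forall k t, 0 < t < L -> is_cderive (fun r => u r k) t
        (- ('i%C * (ksq k)%:C * u t k) + 'i%C / 2 * tri one_mult (u t) k)].

Lemma seqsol_shift L rho gam u t0 L' : 0 <= t0 -> t0 + L' <= L ->
  seqsol L rho gam u -> seqsol L' rho gam (fun t => u (t0 + t)).
Proof.
move=> t00 tL [ub uc ud]; split=> [t /andP[h1 h2]|k|k t /andP[h1 h2]].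
- by apply: ub; apply/andP; split; lra.
- exact: (ccon_shift (f := fun t => u t k) t00 tL).
- by apply: (cder_shift (f := fun t => u t k)); apply: ud; apply/andP; split; lra.
Qed.

Lemma conv_cr a b A B m : l1le (ma a) A -> l1le (ma b) B ->
  conv (cr a) (cr b) m = cr (conv a b) m.
Proof.
move=> aA bB; rewrite /cr /conv -(csumZ_conj (conv_summable _ aA (fun i => ma_pt i bB))).
rewrite -csumZN; congr csumZ; apply/funext => i.
by rewrite opprK conjM; congr (_ * (b _)^*%C); ring.
Qed.

Lemma tri_cr (mu mu' : int -> R[i]) a A k : (forall j, cn (mu j) <= 1) ->
  (forall j, mu' j = (mu (- j))^*%C) -> l1le (ma a) A ->
  tri mu' (cr a) k = cr (tri mu a) k.
Proof.
move=> m1 mm aA; rewrite /tri.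
have mc := l1_mult m1 (l1_cr aA).
rewrite -(conv_cr _ mc (conv_l1 aA aA)) /conv; congr csumZ; apply/funext => j.
congr (_ * _); first by rewrite /cr mm conjM.
by rewrite -[LHS]/(conv (cr a) (cr a) (k - j)) (conv_cr _ aA aA).
Qed.

(** If u solves the equation, so does the conjugate of u(L - t). With this symmetry the second
    bracket of the scheme, which uses the value at the end of the step, is treated as a half step
    forward. *)
Lemma seqsol_rev L rho gam u A : 0 <= L -> (forall t, 0 <= t <= L -> l1le (ma (u t)) A) ->
  seqsol L rho gam u -> seqsol L rho gam (fun t => cr (u (L - t))).
Proof.
move=> L0 uA [ub uc ud]; split=> [t /andP[h1 h2]|k|k t /andP[h1 h2]].
- by apply: hs_cr; apply: ub; apply/andP; split; lra.
- apply: ccon_conj; exact: (ccon_rev (f := fun t => u t (- k)) (lexx L) (lexx L)).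
- have tL : 0 < L - t < L by apply/andP; split; lra.
  have tL' : 0 <= L - t <= L by apply/andP; split; lra.
  have := cder_conj (cder_rev (f := fun t => u t (- k)) (ud (- k) _ tL)).
  move=> h; apply: cder_eq h _.
  rewrite (tri_cr (mu := one_mult) _ cn_one_mult _ (uA _ tL')); last by move=> j; rewrite /one_mult conjc1.
  rewrite /cr ksqN !(conjM, conjN, conjD) conjc_real conjc_inv conjc_nat.
  have -> : ('i%C : R[i])^*%C = - 'i%C by apply: complex_ext; rewrite /= ?oppr0.
  ring.
Qed.

Lemma hs1_l1 : exists2 K0 : R, 0 < K0 & forall X (B : R), hs 1 X B -> l1le X (K0 * B).
Proof.
have [|K K0 KP] := @hs_l1 R 1 0; first by rewrite subr0; lra.
by exists K => // X B /KP; under eq_fun do rewrite hw0 mul1r.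
Qed.

Lemma hsg_l1 gam : 2^-1 < gam -> exists2 K1 : R, 0 < K1 &
  forall X (B : R), hs (1 + gam) X B -> l1le (fun k => hw 1 k * X k) (K1 * B).
Proof.
move=> g2; have [|K K0 KP] := @hs_l1 R (1 + gam) 1; first by rewrite addrC addKr.
by exists K.
Qed.

(** The interaction picture: the free flow is undone, so that only the cubic term is left in the
    time derivative ([cder_inter]) and no derivative in x is lost. *)
Definition inter s a k : R[i] := eit (ksq k * s) * a k.

Lemma cn_inter s a k : cn (inter s a k) = cn (a k).
Proof. by rewrite cnM cn_eit mul1r. Qed.

Lemma ma_inter s a : ma (inter s a) = ma a.
Proof. by apply/funext => k; exact: cn_inter. Qed.

Lemma inter0 a : inter 0 a = a.
Proof. by apply/funext => k; rewrite /inter mulr0 eit0 mul1r. Qed.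

Lemma cder_inter L rho gam u k t : seqsol L rho gam u -> 0 < t < L ->
  is_cderive (fun s => inter s (u s) k) t ('i%C / 2 * inter t (tri one_mult (u t)) k).
Proof.
move=> [_ _ ud] tL; have := cderM (cder_eit (ksq k) t) (ud k t tL).
by move=> h; apply: cder_eq h _; rewrite /inter; ring.
Qed.

Lemma ccon_inter L rho gam u k : seqsol L rho gam u -> ccon L (fun s => inter s (u s) k).
Proof. by move=> [_ uc _]; apply: cconM; [exact: ccon_eit|exact: uc]. Qed.

(** H^{1 + gam} is an algebra, so the cubic term is bounded there; the mean value theorem turns this
    into a Lipschitz bound for the twisted coefficients. Both facts are exported, as the frame
    quadrature also needs the bound on the cubic term. *)
Lemma hs_flow gam rho : 2^-1 < gam <= 1 -> 0 <= rho -> exists2 K : R, 0 < K &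
  forall L u, 0 <= L -> seqsol L rho gam u ->
    (forall t, 0 <= t <= L -> hs (1 + gam) (ma (tri one_mult (u t))) K) /\
    hs (1 + gam) (ma (fun k => inter L (u L) k - u 0 k)) (L * K).
Proof.
move=> /andP[g2 g1] r0; have [K0 K00 KP] := hs1_l1.
set W := @wK R (1 + gam); have W0 := @wK_gt0 R (1 + gam).
set K := W * (2 * W + 1) * ((K0 * rho) ^+ 2 * rho).
have Kp : 0 <= K by rewrite !mulr_ge0 ?sqr_ge0 ?addr_ge0 ?mulr_ge0 // ltW.
exists (K + 1) => [|L u L0 us]; first by rewrite ltr_wpDl.
have H t : 0 <= t <= L -> hs (1 + gam) (ma (tri one_mult (u t))) (K + 1).
  have [ub _ _] := us => /ub h.
  have h1 : l1le (ma (u t)) (K0 * rho) by apply: KP; apply: hs_mono h; lra.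
  have g0 : 0 <= 1 + gam by lra.
  by apply: l2leW (tri_hs g0 cn_one_mult h1 h); rewrite lerDl.
split=> //.
have := @mvt_hs R (1 + gam) L (K + 1) (fun k s => inter s (u s) k)
  (fun k t => 'i%C / 2 * inter t (tri one_mult (u t)) k) L0.
under [X in _ -> _ -> _ -> _ -> hs _ (ma X) _]eq_fun do rewrite inter0.
apply.
- by rewrite addr_ge0.
- by move=> k; exact: ccon_inter us.
- by move=> k t tL; exact: cder_inter us tL.
- move=> t /andP[t0 tL]; have /H : 0 <= t <= L by rewrite !ltW.
  apply: hs_le => k; rewrite !ma_norm !cnM cn_i cnV mul1r cn_eit mul1r.
  have -> : cn (2 : R[i]) = 2 by rewrite -[2 in LHS](_ : (2 : R)%:C = _) ?cn_pos //; exact: rmorph_nat.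
  by rewrite ler_piMl ?cn_ge0 // invf_le1 // ler1n.
Qed.

(* The scheme integrates the phase 2 j^2 s exactly; every remaining term is a
   product of two frequencies, so that its power gam costs only gam derivatives. *)
Lemma resonance s k j i : ksq k * s + (ksq j * s - ksq i * s - ksq (k - j - i) * s) - 2 * ksq j * s
  = 2 * s * (i%:~R * j%:~R + i%:~R * (k - j - i)%:~R + j%:~R * (k - j - i)%:~R).
Proof. by rewrite /ksq !intrB; ring. Qed.

Lemma hw1_powR gam k : hw 1 k `^ gam = hw gam k.
Proof. by rewrite /hw -powRrM; congr (_ `^ _); rewrite mul1r mulrC. Qed.

(** The constant 12 is 2 * 6: the factor 2 of [cn_eit_holder], and 6 from twice three products, each
    at most the product of all three weights; finally 6^gam <= 6. *)
Lemma phase_bound gam s k j i : 0 <= gam <= 1 -> 0 <= s ->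
  cn (eit (ksq k * s + (ksq j * s - ksq i * s - ksq (k - j - i) * s)) - eit (2 * ksq j * s)) <=
  12 * s `^ gam * (hw gam j * hw gam i * hw gam (k - j - i)).
Proof.
move=> g01 s0; have /andP[g0 g1] := g01; set Om := _ + (_ - _); set Om' := 2 * _ * s.
have -> : eit Om - eit Om' = eit Om' * (eit (Om - Om') - 1) :> R[i].
  by rewrite mulrBr mulr1 -eitD [Om' + _]addrC subrK.
rewrite cnM cn_eit mul1r /Om /Om' resonance; set l := k - j - i.
rewrite (le_trans (cn_eit_holder _ g01)) //.
have hi := @abs_le_hw1 R i; have hj := @abs_le_hw1 R j; have hl := @abs_le_hw1 R l.
have wi := @hw_ge1 R 1 i ler01; have wj := @hw_ge1 R 1 j ler01; have wl := @hw_ge1 R 1 l ler01.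
have prod x y (X Y Z : R) : `|x| <= X -> `|y| <= Y -> 1 <= Z -> `|x * y : R| <= X * Y * Z.
  move=> hx hy hz; rewrite normrM (le_trans (ler_pM _ _ hx hy)) // ler_peMr //.
  by rewrite mulr_ge0 // (le_trans _ hx, le_trans _ hy).
set P : R := hw 1 j * hw 1 i * hw 1 l.
have b : `|2 * s * (i%:~R * j%:~R + i%:~R * l%:~R + j%:~R * l%:~R)| <= 6 * s * P.
  rewrite normrM ger0_norm ?mulr_ge0 //.
  have : `|i%:~R * j%:~R + i%:~R * l%:~R + j%:~R * l%:~R : R| <= 3 * P.
    have p1 := prod _ _ _ _ _ hi hj wl; have p2 := prod _ _ _ _ _ hi hl wj; have p3 := prod _ _ _ _ _ hj hl wi.
    have t1 := ler_normD (i%:~R * j%:~R + i%:~R * l%:~R : R) (j%:~R * l%:~R).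
    have t2 := ler_normD (i%:~R * j%:~R : R) (i%:~R * l%:~R).
    have e1 : hw 1 i * hw 1 j * hw 1 l = P by rewrite /P; ring.
    have e2 : hw 1 i * hw 1 l * hw 1 j = P by rewrite /P; ring.
    have e3 : hw 1 j * hw 1 l * hw 1 i = P by rewrite /P; ring.
    rewrite e1 in p1; rewrite e2 in p2; rewrite e3 in p3; lra.
  have E : 6 * s * P = 2 * s * (3 * P) by ring.
  by move=> h; rewrite E; apply: ler_wpM2l h; rewrite mulr_ge0.
have P0 : 0 <= P by rewrite !mulr_ge0 ?hw_ge0.
have b2 : `|2 * s * (i%:~R * j%:~R + i%:~R * l%:~R + j%:~R * l%:~R)| `^ gam <= (6 * s * P) `^ gam.
  have Q : 0 <= 6 * s * P by rewrite mulr_ge0 // mulr_ge0.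
  by apply: ge0_ler_powR => //; rewrite nnegrE.
have -> : 12 * s `^ gam * (hw gam j * hw gam i * hw gam l) = 2 * (6 * (s `^ gam * P `^ gam)).
  by rewrite /P !powRM ?mulr_ge0 ?hw_ge0 // !hw1_powR; ring.
have E6 : (6 * s * P) `^ gam = 6 `^ gam * (s `^ gam * P `^ gam).
  have sP : 0 <= s * P by rewrite mulr_ge0.
  by rewrite -[6 * s * P]mulrA powRM // powRM.
rewrite ler_pM2l // (le_trans b2) // E6 ler_wpM2r ?mulr_ge0 ?powR_ge0 //.
by rewrite ler1_powR // ler1n.
Qed.

End ExactFlow.

(** * The defect of one step of the Schroedinger scheme *)

Section LocalError.
Variable R : realType.
Implicit Types (a c v w : int -> R[i]) (u : R -> int -> R[i]) (s t h L gam rho : R) (k j i : int).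

Lemma inter_inv s a k : a k = eit (- (ksq R k * s)) * inter s a k.
Proof. by rewrite /inter mulrA eitNK mul1r. Qed.

(** Written in twisted coefficients, the cubic term carries the full four-wave phase while the
    scheme keeps only 2 j^2 s. The difference is a trilinear sum whose multiplier satisfies the
    hypothesis of [tri_mult_hs]. *)
Lemma phase_split s a A k : l1le (ma a) A ->
  inter s (tri (@one_mult R) a) k - tri (fun j => eit (2 * ksq R j * s)) (inter s a) k =
  csumZ (fun j => csumZ (fun i =>
    (eit (ksq R k * s + (ksq R j * s - ksq R i * s - ksq R (k - j - i) * s)) - eit (2 * ksq R j * s)) *
    (cr (inter s a) j * (inter s a i * inter s a (k - j - i))))).
Proof.
move=> aA; set c := inter s a; set mu := fun j => eit (2 * ksq R j * s).
have cA : l1le (ma c) A by rewrite /c ma_inter.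
have m1 j : cn (mu j) <= 1 by rewrite cn_eit.
have pA := fun i => ma_pt i aA; have pc := fun i => ma_pt i cA.
have aAA := fun i => ma_pt i (conv_l1 aA aA); have cAA := fun i => ma_pt i (conv_l1 cA cA).
have s1 := conv_summable k (l1_mult (@cn_one_mult R) (l1_cr aA)) aAA.
have s2 := conv_summable k (l1_mult m1 (l1_cr cA)) cAA.
rewrite {1}/inter /tri /conv -(csumZZ _ s1) -(csumZB (C := A * (A * A)) _ s2); last first.
  by apply: l1le_ma s1 => j; rewrite cnM cn_eit mul1r.
congr csumZ; apply/funext => j; rewrite /conv.
have s3 := conv_summable (k - j) aA pA; have s4 := conv_summable (k - j) cA pc.
rewrite [eit _ * (_ * csumZ _)]mulrA -(csumZZ _ s3) -(csumZZ _ s4).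
rewrite -(csumZB (C := A * (A * A)) (D := A * (A * A))); first last.
- have := l1leZ (c := A) (y := ma (fun i => mu j * cr c j * (c i * c (k - j - i)))) _ _ s4.
  apply; first exact: l1le_ge0 aA.
  move=> i; rewrite !ma_norm cnM ler_wpM2r ?cn_ge0 // cnM cn_eit mul1r cn_conj.
  exact: pc.
- have := l1leZ (c := A) (y := ma (fun i => eit (ksq R k * s) * (one_mult R j * cr a j) * (a i * a (k - j - i)))) _ _ s3.
  apply; first exact: l1le_ge0 aA.
  move=> i; rewrite !ma_norm cnM ler_wpM2r ?cn_ge0 // !cnM cn_eit cn1 !mul1r cn_conj.
  exact: pA.
congr csumZ; apply/funext => i; rewrite mulrBl; congr (_ - _); last by rewrite -mulrA.
have -> : cr a j = eit (ksq R j * s) * cr c j.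
  by rewrite /cr /c (inter_inv s a) conjM -eitN opprK ksqN.
rewrite (inter_inv s a i) (inter_inv s a (k - j - i)) -/c !eitD !eitN /one_mult; ring.
Qed.

Lemma tri_scale (z : R[i]) mu a A k : (forall j, cn (mu j) <= 1) -> l1le (ma a) A ->
  tri (fun j => z * mu j) a k = z * tri mu a k.
Proof.
move=> m1 aA; rewrite /tri /conv.
have s1 := conv_summable k (l1_mult m1 (l1_cr aA)) (fun i => ma_pt i (conv_l1 aA aA)).
by rewrite -(csumZZ _ s1); congr csumZ; apply/funext => j; rewrite !mulrA.
Qed.

Lemma tri_mult0 a k : tri (fun=> 0) a k = 0.
Proof. by rewrite /tri /conv (@csumZ_delta _ _ 0) ?mul0r // => j _; rewrite !mul0r. Qed.

Lemma cder_tri_Iph a A k t : l1le (ma a) A ->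
  is_cderive (fun s => tri (fun j => Iph (2 * ksq R j) s) a k) t
    (tri (fun j => eit (2 * ksq R j * t)) a k).
Proof.
move=> aA; have pD := fun i => ma_pt i (conv_l1 aA aA).
have S := conv_summable k (l1_cr aA) pD.
apply: (@cder_csumZ R (fun j s => Iph (2 * ksq R j) s * cr a j * conv a a (k - j))
  (fun j s => eit (2 * ksq R j * s) * cr a j * conv a a (k - j))
  (ma (fun j => cr a j * conv a a (k - j))) _ t S).
- move=> j s; have := cderZ (cr a j * conv a a (k - j)) (cder_Iph (2 * ksq R j) s).
  under eq_fun do rewrite mulrC mulrA.
  by move=> h; apply: cder_eq h _; ring.
- by move=> j s; rewrite -mulrA cnM cn_eit mul1r.
- move=> s; exists (`|s| * (A * (A * A))).
  apply: (l1leZ (x := ma (fun j => cr a j * conv a a (k - j)))) S => // j.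
  rewrite !ma_norm -mulrA cnM ler_wpM2r ?cn_ge0 //.
  have := @mvt_complex_int R (Iph (2 * ksq R j)) (fun t => eit (2 * ksq R j * t)) 1 0 s ler01.
  rewrite add0r Iph_s0 subr0 mulr1; apply=> r; first exact: cder_Iph.
  by rewrite cn_eit.
Qed.

Lemma cn_half_i : cn ('i%C / 2 : R[i]) <= 1.
Proof.
rewrite cnM cn_i cnV mul1r.
have -> : cn (2 : R[i]) = 2 by rewrite -[2 in LHS](_ : (2 : R)%:C = _) ?cn_pos //; exact: rmorph_nat.
by rewrite invf_le1 // ler1n.
Qed.

(** The time derivative of the defect splits in two: [P1], the error from dropping all phases except
    2 j^2 t, of size t^gam; and [P2], the error from freezing the twisted data at time 0, of size t
    by their Lipschitz bound. [mvt_hs] integrates both. *)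
Lemma half_step gam rho : 2^-1 < gam <= 1 -> 0 <= rho -> exists2 K : R, 0 < K &
  forall L u, 0 <= L <= 1 -> seqsol L rho gam u ->
    hs 1 (ma (fun k => inter L (u L) k - u 0 k -
       'i%C / 2 * tri (fun j => Iph (2 * ksq R j) L) (u 0) k)) (K * (L * L `^ gam)).
Proof.
move=> g01 r0; have /andP[g2 g1] := g01.
have g0 : 0 <= gam <= 1 by apply/andP; split; lra.
have [K0 K00 K0P] := @hs1_l1 R; have [K1 K10 K1P] := hsg_l1 g2; have [Kf Kf0 KfP] := hs_flow g01 r0.
set W := @wK R 1; have W0 := @wK_gt0 R 1; have TK := @triK_gt0 R 1.
set C1 := W * (2 * W + 1) * ((K1 * rho) ^+ 2 * rho).
set C2 := triK 1 * (Kf * (K0 * rho) ^+ 2 + K0 * Kf * (K0 * rho) * rho).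
have C10 : 0 <= C1 by rewrite !mulr_ge0 ?sqr_ge0 ?addr_ge0 ?mulr_ge0 // ltW.
have C20 : 0 <= C2.
  have k0r := mulr_ge0 (ltW K00) r0.
  rewrite mulr_ge0 ?(ltW TK) // addr_ge0 //; first by rewrite mulr_ge0 ?sqr_ge0 ?ltW.
  by rewrite mulr_ge0 // mulr_ge0 // mulr_ge0 ?ltW.
exists (12 * C1 + C2 + 1) => [|L u /andP[L0 L1] us]; first by rewrite ltr_wpDl // addr_ge0 // mulr_ge0.
have [ub _ _] := us.
have hsu t : 0 <= t <= L -> hs 1 (ma (u t)) rho by move=> /ub; apply: hs_mono; lra.
have l1u t : 0 <= t <= L -> l1le (ma (u t)) (K0 * rho) by move=> /hsu/K0P.
have L00 : 0 <= (0 : R) <= L by rewrite lexx.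
pose g k s := inter s (u s) k - 'i%C / 2 * tri (fun j => Iph (2 * ksq R j) s) (u 0) k.
pose dg k t := 'i%C / 2 * (inter t (tri (@one_mult R) (u t)) k - tri (fun j => eit (2 * ksq R j * t)) (u 0) k).
have E : (fun k => inter L (u L) k - u 0 k - 'i%C / 2 * tri (fun j => Iph (2 * ksq R j) L) (u 0) k) =
    fun k => g k L - g k 0.
  apply/funext => k; rewrite /g inter0.
  rewrite (_ : (fun j => Iph (2 * ksq R j) 0) = fun=> 0); last by apply/funext => j; exact: Iph_s0.
  by rewrite tri_mult0; ring.
rewrite E mulrCA; apply: (mvt_hs (dg := dg)) => //.
- by rewrite mulr_ge0 ?powR_ge0 // !addr_ge0 // mulr_ge0.
- move=> k; apply: cconB; first exact: ccon_inter us.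
  apply: cconZ; apply: ccon_derive => t; exact: cder_tri_Iph (l1u _ L00).
- move=> k t tL; have := cderB (cder_inter k us tL) (cderZ ('i%C / 2) (cder_tri_Iph k t (l1u _ L00))).
  by move=> h; apply: cder_eq h _; rewrite /dg mulrBr.
move=> t /andP[t0 tL].
have t0' := ltW t0; have tL' : 0 <= t <= L by rewrite t0' ltW.
have t1 : t <= 1 by rewrite (le_trans (ltW tL)).
have tg : t <= t `^ gam by apply: ger1_powR => //; rewrite t0 t1.
have tgL : t `^ gam <= L `^ gam.
  have /andP[gg _] := g0; by apply: ge0_ler_powR => //; rewrite ?nnegrE // ltW.
have l1c := l1u _ tL'.
have P1 : hs 1 (ma (fun k => inter t (tri (@one_mult R) (u t)) k -
    tri (fun j => eit (2 * ksq R j * t)) (inter t (u t)) k)) (12 * t `^ gam * C1).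
  apply: (@tri_mult_hs R 1 gam (fun k j i => eit (ksq R k * t + (ksq R j * t - ksq R i * t - ksq R (k - j - i) * t)) - eit (2 * ksq R j * t)) (inter t (u t))) => //.
  - by rewrite mulr_ge0 ?powR_ge0.
  - by move=> k j i; exact: phase_bound.
  - rewrite ma_inter; apply: l1le_le (K1P _ _ (ub _ tL')) => k.
    by rewrite !normrM ler_wpM2r // !ger0_norm ?hw_ge0 // hw_le.
  - by rewrite ma_inter; exact: ub.
  - by move=> k; exact: phase_split l1c.
have ust : seqsol t rho gam u.
  have := seqsol_shift (t0 := 0) (L' := t) (lexx 0) _ us; rewrite add0r => /(_ (ltW tL)).
  by rewrite (_ : (fun r => u (0 + r)) = u) //; apply/funext => r; rewrite add0r.
have lip : hs 1 (ma (fun k => inter t (u t) k - u 0 k)) (t * Kf).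
  by have [_] := KfP t u t0' ust; apply: hs_mono; lra.
have P2 : hs 1 (ma (fun k => tri (fun j => eit (2 * ksq R j * t)) (inter t (u t)) k -
    tri (fun j => eit (2 * ksq R j * t)) (u 0) k)) (t * C2).
  have := @tri_lip R 1 (fun j => eit (2 * ksq R j * t)) (inter t (u t)) (u 0) (K0 * rho) rho (K0 * (t * Kf)) (t * Kf).
  rewrite !ma_inter => h; have -> : t * C2 = triK 1 * (t * Kf * (K0 * rho) ^+ 2 + K0 * (t * Kf) * (K0 * rho) * rho).
    by rewrite /C2; ring.
  apply: h => //; try exact: l1u; try exact: hsu.
  - by move=> j; rewrite cn_eit.
  - exact: K0P.
have := hs_maD P1 P2 => P3.
have {}P3 : hs 1 (ma (fun k => dg k t)) (12 * t `^ gam * C1 + t * C2).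
  apply: hs_le P3 => k; rewrite !ma_norm /dg cnM.
  rewrite (_ : inter t (tri (@one_mult R) (u t)) k - _ = inter t (tri (@one_mult R) (u t)) k -
    tri (fun j => eit (2 * ksq R j * t)) (inter t (u t)) k +
    (tri (fun j => eit (2 * ksq R j * t)) (inter t (u t)) k - tri (fun j => eit (2 * ksq R j * t)) (u 0) k));
    last by rewrite addrA subrK.
  by rewrite ler_piMl ?cn_ge0 // cn_half_i.
apply: l2leW P3; have h1 := ler_wpM2r C10 (ler_wpM2l (_ : 0 <= 12) tgL).
have {}h1 : 12 * t `^ gam * C1 <= 12 * L `^ gam * C1 by rewrite ler_wpM2r // ler_wpM2l.
have h2 : t * C2 <= L `^ gam * C2 by rewrite ler_wpM2r // (le_trans tg).
have := powR_ge0 L gam; nra.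
Qed.

(** The symbol of phi_1(-i h d_x^2), that is of [phi1_dxx (- h)]: the multiplier d_x^2 is - k^2,
    which reverses the sign. *)
Definition nu h j : R[i] := phi1 ('i%C * (h * ksq R j)%:C).

Lemma nu_conj h j : nu (- h) j = (nu h j)^*%C.
Proof. by rewrite /nu phi1_conj; congr phi1; apply: complex_ext; rewrite ?ReJ ?ImJ ?ReM ?ImM /=; ring. Qed.

Lemma Iph_nu h j : Iph (ksq R j) h = h%:C * nu h j.
Proof. by rewrite /Iph /nu; congr (_ * phi1 ('i%C * _%:C)); rewrite mulrC. Qed.

Lemma cn_nu h j : 0 < h -> cn (nu h j) <= 1.
Proof.
move=> h0; have := @cn_Iph R (ksq R j) h (ltW h0).
by rewrite Iph_nu cnM cn_pos ?(ltW h0) // -[leRHS]mulr1 ler_pM2l.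
Qed.

Lemma cn_nuN h j : 0 < h -> cn (nu (- h) j) <= 1.
Proof. by move=> h0; rewrite nu_conj cn_conj cn_nu. Qed.

(* The right-hand side of the implicit equation for one step, on Fourier
   coefficients. *)
Definition rhs h v w k : R[i] :=
  eit (- (ksq R k * h)) * (v k + 'i%C * (h / 4)%:C * tri (nu h) v k) +
  'i%C * (h / 4)%:C * tri (nu (- h)) w k.

(** [half_step] is applied to u from the left end and to the time-reversed conjugate from the right
    end. Both estimates concern the value at h / 2, and subtracting them eliminates it. *)
Lemma local_error gam rho : 2^-1 < gam <= 1 -> 0 <= rho -> exists2 K : R, 0 < K &
  forall h u, 0 < h <= 1 -> seqsol h rho gam u ->
    hs 1 (ma (fun k => u h k - rhs h (u 0) (u h) k)) (K * (h * h `^ gam)).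
Proof.
move=> g01 r0; have /andP[g2 g1] := g01.
have [K0 K00 K0P] := @hs1_l1 R; have [K K0' KP] := half_step g01 r0.
exists (2 * K) => [|h u /andP[h0 h1] us]; first by rewrite mulr_gt0.
have [ub _ _] := us.
have l1u t : 0 <= t <= h -> l1le (ma (u t)) (K0 * rho).
  by move=> /ub tb; apply: K0P; apply: hs_mono tb; lra.
have h00 : 0 <= (0 : R) <= h by rewrite lexx ltW.
have hhh : 0 <= h <= h by rewrite lexx ltW.
have hh2 : 0 <= h / 2 <= h by apply/andP; split; lra.
have hL : 0 <= h / 2 <= 1 by apply/andP; split; lra.
have us1 : seqsol (h / 2) rho gam u.
  have := seqsol_shift (t0 := 0) (L' := h / 2) (lexx 0) _ us; rewrite add0r.
  by case/andP: hh2 => _ hh /(_ hh); rewrite (_ : (fun r => u (0 + r)) = u) //; apply/funext => r; rewrite add0r.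
have us2 : seqsol (h / 2) rho gam (fun t => cr (u (h - t))).
  have := seqsol_shift (t0 := 0) (L' := h / 2) (lexx 0) _ (seqsol_rev (ltW h0) l1u us); rewrite add0r.
  by case/andP: hh2 => _ hh /(_ hh); rewrite (_ : (fun r => cr (u (h - (0 + r)))) = fun r => cr (u (h - r))) //; apply/funext => r; rewrite add0r.
have P1 := KP _ _ hL us1; have P2 := KP _ _ hL us2.
have cnI j : cn (nu h j) <= 1 by exact: cn_nu.
have cnIN j : cn (nu (- h) j) <= 1 by exact: cn_nuN.
(* Over half a step the phase 2 j^2 reaches 2 j^2 (h / 2) = j^2 h, so [Iph] becomes h / 2 times
   [nu h]; with the factor i / 2 of the equation this is the coefficient i h / 4 of the scheme. *)
have T a A k : l1le (ma a) A -> 'i%C / 2 * tri (fun j => Iph (2 * ksq R j) (h / 2)) a k =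
    'i%C * (h / 4)%:C * tri (nu h) a k.
  move=> aA.
  have -> : tri (fun j => Iph (2 * ksq R j) (h / 2)) a k = (h / 2)%:C * tri (nu h) a k.
    rewrite -(tri_scale (h / 2)%:C k cnI aA); congr (tri _ a k); apply/funext => j.
    by rewrite /Iph /nu; congr (_ * phi1 ('i%C * _%:C)); field.
  rewrite mulrA; congr (_ * _).
  have -> : 'i%C / 2 = (2^-1)%:C * 'i%C :> R[i] by rewrite fmorphV rmorph_nat mulrC.
  by apply: complex_ext; rewrite ?ReM ?ImM /=; field.
have h24 : h / 2 <= h by lra.
have bound : K * (h / 2 * (h / 2) `^ gam) <= K * (h * h `^ gam).
  rewrite ler_wpM2l ?(ltW K0') // ler_pM ?powR_ge0 //; first by lra.
  by apply: ge0_ler_powR; rewrite ?nnegrE //; lra.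
have {}P1 := l2leW bound P1; have {}P2 := l2leW bound P2.
have P1' : hs 1 (ma (fun k => eit (- (ksq R k * h)) * (inter (h / 2) (u (h / 2)) k - u 0 k -
    'i%C / 2 * tri (fun j => Iph (2 * ksq R j) (h / 2)) (u 0) k))) (K * (h * h `^ gam)).
  by apply: hs_le P1 => k; rewrite !ma_norm cnM cn_eit mul1r.
have P2' := hs_cr P2.
have P3 := hs_maB P1' P2'.
rewrite (_ : 2 * K * _ = K * (h * h `^ gam) + K * (h * h `^ gam)); last by ring.
apply: hs_le P3 => k; rewrite !ma_norm.
rewrite le_eqVlt; apply/orP; left; apply/eqP; congr cn.
rewrite (T _ _ _ (l1u _ h00)) /cr !(conjD, conjN).
rewrite (T _ _ _ (l1_cr (l1u _ (_ : 0 <= h - 0 <= h)))) ?subr0 //.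
have -> : tri (nu h) (cr (u h)) (- k) = (tri (nu (- h)) (u h) k)^*%C.
  rewrite (tri_cr (mu := nu (- h)) (A := K0 * rho)) ?/cr ?opprK //; last exact: l1u.
  by move=> j; rewrite nu_conj conjcK /nu ksqN.
have Eh : h - h / 2 = h / 2 by field.
rewrite Eh /cr /inter ksqN opprK !(conjM, conjcK) conjc_real -eitN.
have -> : ('i%C : R[i])^*%C = - 'i%C by apply: complex_ext; rewrite /= ?oppr0.
have -> : eit (- (ksq R k * (h / 2))) = eit (- (ksq R k * h)) * eit (ksq R k * (h / 2)) :> R[i].
  by rewrite -eitD; congr eit; field.
by rewrite /rhs; ring.
Qed.

End LocalError.

(** * Solvability of the implicit step *)

Section NumericalStep.
Variable R : realType.
Implicit Types (a b v w : int -> R[i]) (h s gam rho x : R) (k j : int) (n p : nat).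

Lemma fun_dxxE (m : R -> R[i]) f x : fun_dxx m f x = fS (fun k => m (- ksq R k) * fourier f k) x.
Proof. by []. Qed.

Lemma schroedingerE h a A : l1le (ma a) A ->
  schroedinger h (fS a) = fS (fun k => eit (- (ksq R k * h)) * a k).
Proof.
move=> aA; apply/funext => x; rewrite /schroedinger fun_dxxE; congr (fS _ x).
by apply/funext => k; rewrite cexp_eit (fourier_fS _ aA); congr (eit _ * _); ring.
Qed.

Lemma phi1_dxx_conj h a A : l1le (ma a) A ->
  phi1_dxx (- h) (fun z => ((fS a z)^*)%C) = fS (fun k => nu h k * cr a k).
Proof.
move=> aA; apply/funext => x; rewrite /phi1_dxx fun_dxxE; congr (fS _ x).
apply/funext => k; rewrite (fourier_conj _ (ccont_fS aA)) (fourier_fS _ aA).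
by rewrite /nu; congr (phi1 ('i%C * _%:C) * _); ring.
Qed.

Lemma l1_nuM h a A : 0 < h -> l1le (ma a) A -> l1le (ma (fun k => nu h k * cr a k)) A.
Proof. by move=> h0 aA; apply: l1_mult (l1_cr aA) => k; exact: cn_nu. Qed.

Lemma l1_nuNM h a A : 0 < h -> l1le (ma a) A -> l1le (ma (fun k => nu (- h) k * cr a k)) A.
Proof. by move=> h0 aA; apply: l1_mult (l1_cr aA) => k; exact: cn_nuN. Qed.

Lemma sqr_mul_fS a b A B x : l1le (ma a) A -> l1le (ma b) B ->
  fS a x ^+ 2 * fS b x = fS (conv b (conv a a)) x.
Proof. by move=> aA bB; rewrite expr2 (fS_mul x aA aA) (fS_mul x (conv_l1 aA aA) bB). Qed.

Lemma nls_rhsE h a b A B : 0 < h -> l1le (ma a) A -> l1le (ma b) B ->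
  nls_rhs h (fS a) (fS b) = fS (rhs h a b).
Proof.
move=> h0 aA bB; apply/funext => x; rewrite /nls_rhs (schroedingerE h aA).
have ta := tri_l1 (fun j => cn_nu j h0) aA; have tb := tri_l1 (fun j => cn_nuN j h0) bB.
have -> : (fun y => fS a y ^+ 2 * phi1_dxx (- h) (fun z => (fS a z)^*%C) y) = fS (tri (nu h) a).
  by apply/funext => y; rewrite (phi1_dxx_conj h aA) (sqr_mul_fS y aA (l1_nuM h0 aA)).
have -> : phi1_dxx h (fun z => (fS b z)^*%C) = fS (fun k => nu (- h) k * cr b k).
  by rewrite -{1}[h]opprK (phi1_dxx_conj (- h) bB).
rewrite (sqr_mul_fS x bB (l1_nuNM h0 bB)) (schroedingerE h ta) -/(tri _ _).
set z := 'i%C * _.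
have l1e c C : l1le (ma c) C -> l1le (ma (fun k => eit (- (ksq R k * h)) * c k)) C.
  by apply: l1_mult => k; rewrite cn_eit.
have sc c C : l1le (ma c) C -> l1le (ma (fun k => z * c k)) (cn z * C).
  by apply: l1leZ => [|k]; rewrite ?cn_ge0 // !ma_norm cnM.
rewrite -(fSZ z x (l1e _ _ ta)) -(fSZ z x tb) -(fSD x (l1e _ _ aA) (sc _ _ (l1e _ _ ta))).
rewrite -(fSD x (l1_maD (l1e _ _ aA) (sc _ _ (l1e _ _ ta))) (sc _ _ tb)).
by congr (fS _ x); apply/funext => k; rewrite /rhs -/z; ring.
Qed.

Lemma ccvg_shift (u : nat -> R[i]) l n : ccvg u l -> ccvg (fun p => u (n + p)%N) l.
Proof.
move=> /cvgrPdist_lt h; apply/cvgrPdist_lt => e /h [N _ NP]; exists N => // p /= Np.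
by apply: NP => /=; exact: leq_trans Np (leq_addl _ _).
Qed.

Lemma geometric_cvg0 (c : R) : (fun n => c / 2 ^+ n) @ \oo --> (0 : R).
Proof.
rewrite (_ : (fun n => _) = geometric c 2^-1); last first.
  by apply/funext => n; rewrite /geometric /= exprVn.
by apply: cvg_geometric; rewrite ger0_norm ?invr_ge0 // invf_lt1 // ltr1n.
Qed.

Lemma real_geometric_cvg (u : nat -> R) c : (forall n p, `|u (n + p)%N - u n| <= c / 2 ^+ n) ->
  cvgn u.
Proof.
move=> h; have c0 : 0 <= c by have := h 0%N 0%N; rewrite expr0 divr1; apply: le_trans.
(* The correction outweighs the possible increments, as it decreases by c / 2^n from n to n + 1;
   hence [w] is nonincreasing and bounded below. *)
pose w n := u n + 2 * c / 2 ^+ n.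
have cw : cvgn w.
  apply: nonincreasing_is_cvgn.
    apply/nonincreasing_seqP => n; have := h n 1%N; rewrite addn1 ler_norml => /andP[_ h1].
    have e : 2 * c / 2 ^+ n.+1 = c / 2 ^+ n by rewrite exprS; field; rewrite gt_eqF // exprn_gt0.
    have e2 : 2 * c / 2 ^+ n = c / 2 ^+ n + c / 2 ^+ n by field; rewrite gt_eqF // exprn_gt0.
    by rewrite /w e e2; lra.
  exists (u 0%N - c) => _ [n _ <-]; have := h 0%N n; rewrite add0n expr0 divr1 ler_norml => /andP[h1 _].
  have : 0 <= 2 * c / 2 ^+ n by rewrite divr_ge0 ?mulr_ge0 ?exprn_ge0.
  by rewrite /w; lra.
rewrite (_ : u = fun n => w n - 2 * c / 2 ^+ n); last by apply/funext => n; rewrite /w addrK.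
by apply: is_cvgB => //; apply/cvg_ex; exists 0; exact: geometric_cvg0.
Qed.

Lemma complex_geometric_cvg (u : nat -> R[i]) c :
  (forall n p, cn (u (n + p)%N - u n) <= c / 2 ^+ n) -> exists l, ccvg u l.
Proof.
move=> h; exists (clim u); apply: ccvgP => /=; apply: (real_geometric_cvg (c := c)) => n p.
  by rewrite -ReN -ReD (le_trans (Re_le_cn _)).
by rewrite -ImN -ImD (le_trans (Im_le_cn _)).
Qed.

Lemma cn_ih4 h : 0 < h -> cn ('i%C * (h / 4)%:C : R[i]) = h / 4.
Proof. by move=> h0; rewrite cnM cn_i mul1r cn_pos // divr_ge0 // ltW. Qed.

Lemma hs_rhs s h a b (A TA TB : R) : 0 < h -> hs s (ma a) A ->
  hs s (ma (tri (nu h) a)) TA -> hs s (ma (tri (nu (- h)) b)) TB ->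
  hs s (ma (rhs h a b)) (A + h / 4 * TA + h / 4 * TB).
Proof.
move=> h0 aA ta tb; have z := cn_ih4 h0.
have := hs_maD (hs_mult (mu := fun k => eit (- (ksq R k * h))) _ (hs_maD aA (hs_maZ ('i%C * (h / 4)%:C) ta)))
  (hs_maZ ('i%C * (h / 4)%:C) tb).
by rewrite z; apply=> k; rewrite cn_eit.
Qed.

Lemma hs_rhs_diff s h a b a' b' (D TA TB : R) : 0 < h ->
  hs s (ma (fun k => a k - a' k)) D ->
  hs s (ma (fun k => tri (nu h) a k - tri (nu h) a' k)) TA ->
  hs s (ma (fun k => tri (nu (- h)) b k - tri (nu (- h)) b' k)) TB ->
  hs s (ma (fun k => rhs h a b k - rhs h a' b' k)) (D + h / 4 * TA + h / 4 * TB).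
Proof.
move=> h0 aA ta tb; have z := cn_ih4 h0.
have := hs_maD (hs_mult (mu := fun k => eit (- (ksq R k * h))) _ (hs_maD aA (hs_maZ ('i%C * (h / 4)%:C) ta)))
  (hs_maZ ('i%C * (h / 4)%:C) tb).
rewrite z => H; apply: hs_le (H _) => k; last by rewrite cn_eit.
rewrite !ma_norm le_eqVlt; apply/orP; left; apply/eqP; congr cn; rewrite /rhs.
move: (eit _) ('i%C * _) (tri _ a k) (tri _ a' k) (tri _ b k) (tri _ b' k) => e z' ? ? ? ?; ring.
Qed.

(** One constant for every multiplier of modulus at most 1, hence uniform in h for [nu h] and
    [nu (- h)]. The middle estimate is linear in the higher norm, which is what lets regularity
    persist in [fixed_point]. *)
Lemma tri_nu_consts gam : 0 <= gam -> exists2 C : R, 0 < C & forall mu, (forall j, cn (mu j) <= 1) ->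
  [/\ forall a M, hs 1 (ma a) M -> hs 1 (ma (tri mu a)) (C * M ^+ 2 * M),
      forall a M B, hs 1 (ma a) M -> hs (1 + gam) (ma a) B ->
        hs (1 + gam) (ma (tri mu a)) (C * M ^+ 2 * B)
    & forall a b M d, hs 1 (ma a) M -> hs 1 (ma b) M -> hs 1 (ma (fun k => a k - b k)) d ->
        hs 1 (ma (fun k => tri mu a k - tri mu b k)) (C * M ^+ 2 * d)].
Proof.
move=> g0; have [K0 K00 KP] := @hs1_l1 R.
pose c s : R := @wK R s * (2 * @wK R s + 1) * K0 ^+ 2.
have c0 s : 0 <= c s.
  by rewrite !mulr_ge0 ?sqr_ge0 ?addr_ge0 ?mulr_ge0 // ltW // wK_gt0.
pose c3 : R := 2 * triK 1 * K0 ^+ 2.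
have t0 := @triK_gt0 R 1.
have c30 : 0 <= c3 by rewrite mulr_ge0 ?sqr_ge0 // mulr_ge0 // ltW.
have sc X Y (C M : R) : X <= C -> 0 <= Y -> X * M ^+ 2 * Y <= C * M ^+ 2 * Y.
  by move=> XC Y0; rewrite ler_wpM2r // ler_wpM2r // sqr_ge0.
exists (c 1 + c (1 + gam) + c3 + 1) => [|mu m1]; first by rewrite ltr_wpDl // !addr_ge0.
have q1 := c0 1; have q2 := c0 (1 + gam).
split.
- move=> a M aM; apply: l2leW (tri_hs ler01 m1 (KP _ _ aM) aM).
  rewrite (_ : _ * _ * _ = c 1 * M ^+ 2 * M); last by rewrite /c; ring.
  by apply: sc (l2le_ge0 aM); lra.
- move=> a M B aM aB; have g1 : 0 <= 1 + gam by rewrite addr_ge0.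
  apply: l2leW (tri_hs g1 m1 (KP _ _ aM) aB).
  rewrite (_ : _ * _ * _ = c (1 + gam) * M ^+ 2 * B); last by rewrite /c; ring.
  by apply: sc (l2le_ge0 aB); lra.
- move=> a b M d aM bM ab.
  apply: l2leW (tri_lip ler01 m1 (KP _ _ aM) aM (KP _ _ bM) bM (KP _ _ ab) ab).
  rewrite (_ : _ * _ = c3 * M ^+ 2 * d); last by rewrite /c3; ring.
  by apply: sc (l2le_ge0 ab); lra.
Qed.

(** The iteration contracts in an H^1 ball. Smallness of h is measured against the H^1 radius only;
    by the tame estimate the H^{1 + gam} norm obeys a linear recursion with the same small factor,
    so it stays finite without restricting h further. *)
Lemma fixed_point gam : 0 <= gam -> exists2 C : R, 0 < C &
  forall rho h a B, 0 < rho -> 0 < h -> h * C * rho ^+ 2 <= 1 ->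
    hs 1 (ma a) rho -> hs (1 + gam) (ma a) B ->
    exists b, [/\ nls_step h (fS a) = fS b, forall k, b k = rhs h a b k,
      hs 1 (ma b) (2 * rho) & hs (1 + gam) (ma b) (3 * B)].
Proof.
move=> g0; have [K0 K00 KP] := @hs1_l1 R; have [C C0 CP] := tri_nu_consts g0.
exists (4 * C) => [|rho h a B rho0 h0 small a1 a2]; first by rewrite mulr_gt0.
have [T1 T2 T3] := CP (nu h) (fun j => cn_nu j h0).
have [S1 S2 S3] := CP (nu (- h)) (fun j => cn_nuN j h0).
have B0 := l2le_ge0 a2; have h4 : 0 <= h / 4 by rewrite divr_ge0 // ltW.
pose bn n := iter n (rhs h a) (fun k => eit (- (ksq R k * h)) * a k).
have e0 s A : hs s (ma a) A -> hs s (ma (bn 0%N)) A.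
  by apply: hs_le => k; rewrite !ma_norm cnM cn_eit mul1r.
(* With this factor the iterates obey rho (1 + 1/16 + 8/16) <= 2 rho in H^1 and B (1 + 1/16 + 12/16)
   <= 3 B in H^{1 + gam}, and differences shrink by 4/16 <= 1/2. *)
have q : h / 4 * (C * rho ^+ 2) <= 1 / 16 by lra.
have q0 : 0 <= h / 4 * (C * rho ^+ 2).
  by rewrite mulr_ge0 // mulr_ge0 ?sqr_ge0 // ltW.
have bn1 n : hs 1 (ma (bn n)) (2 * rho).
  elim: n => [|n IH].
    by apply: l2leW (e0 _ _ a1); lra.
  have H := hs_rhs h0 a1 (T1 _ _ a1) (S1 _ _ IH); apply: l2leW H.
  have := ler_wpM2r (ltW rho0) q.
  rewrite (_ : (2 * rho) ^+ 2 = 4 * rho ^+ 2); last by ring.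
  rewrite (_ : h / 4 * (C * rho ^+ 2 * rho) = h / 4 * (C * rho ^+ 2) * rho); last by ring.
  rewrite (_ : h / 4 * (C * (4 * rho ^+ 2) * (2 * rho)) = 8 * (h / 4 * (C * rho ^+ 2) * rho)); last by ring.
  lra.
have bn2 n : hs (1 + gam) (ma (bn n)) (3 * B).
  elim: n => [|n IH].
    by apply: l2leW (e0 _ _ a2); lra.
  have H := hs_rhs h0 a2 (T2 _ _ _ a1 a2) (S2 _ _ _ (bn1 n) IH); apply: l2leW H.
  have := ler_wpM2r B0 q.
  rewrite (_ : (2 * rho) ^+ 2 = 4 * rho ^+ 2); last by ring.
  rewrite (_ : h / 4 * (C * rho ^+ 2 * B) = h / 4 * (C * rho ^+ 2) * B); last by ring.
  rewrite (_ : h / 4 * (C * (4 * rho ^+ 2) * (3 * B)) = 12 * (h / 4 * (C * rho ^+ 2) * B)); last by ring.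
  lra.
have zero_diff s : hs s (ma (fun k => a k - a k)) 0.
  split=> // r ur; rewrite big1 ?expr0n // => k _; rewrite /ma subrr cn0 mulr0 expr0n //.
have zero_tri : hs 1 (ma (fun k => tri (nu h) a k - tri (nu h) a k)) 0.
  split=> // r ur; rewrite big1 ?expr0n // => k _; rewrite /ma subrr cn0 mulr0 expr0n //.
have contract b b' d : hs 1 (ma b) (2 * rho) -> hs 1 (ma b') (2 * rho) ->
    hs 1 (ma (fun k => b k - b' k)) d -> hs 1 (ma (fun k => rhs h a b k - rhs h a b' k)) (d / 2).
  move=> hb hb' hd; apply: l2leW (hs_rhs_diff h0 (zero_diff 1) zero_tri (S3 _ _ _ _ hb hb' hd)).
  have := ler_wpM2r (l2le_ge0 hd) q.
  rewrite (_ : h / 4 * (C * (2 * rho) ^+ 2 * d) = 4 * (h / 4 * (C * rho ^+ 2) * d)); last by ring.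
  have := l2le_ge0 hd; lra.
have cauchy n p : hs 1 (ma (fun k => bn (n + p)%N k - bn n k)) (4 * rho / 2 ^+ n).
  elim: n => [|n IH].
    rewrite expr0 divr1; apply: l2leW (hs_maB (bn1 _) (bn1 _)); lra.
  rewrite addSn exprS invfM mulrA mulrAC; exact: contract.
pose P k l := ccvg (fun n => bn n k) l.
have Pex k : exists l, P k l.
  apply: (@complex_geometric_cvg _ (4 * rho)) => n p.
  by have := hs_pt k ler01 (cauchy n p); rewrite ma_norm.
have [b bP] := choice Pex; rewrite /P in bP.
have lim_b n : hs 1 (ma (fun k => b k - bn n k)) (4 * rho / 2 ^+ n).
  apply: (l2le_lim (u := fun p k => hw 1 k * ma (fun k => bn (n + p)%N k - bn n k) k)) => [p|k].
    exact: cauchy.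
  apply: cvgMl_tmp; apply: (ccvg_cn (u := fun p => bn (n + p)%N k - bn n k)).
  apply: ccvgB; last exact: ccvg_cst.
  exact: (ccvg_shift (u := fun m => bn m k) n (bP k)).
have lim_hs s D : (forall n, hs s (ma (bn n)) D) -> hs s (ma b) D.
  move=> H; apply: (l2le_lim (u := fun n k => hw s k * ma (bn n) k)) => // k.
  by apply: cvgMl_tmp; exact: ccvg_cn (bP k).
have b1 : hs 1 (ma b) (2 * rho) by exact: lim_hs.
have b2 : hs (1 + gam) (ma b) (3 * B) by exact: lim_hs.
have bfix k : b k = rhs h a b k.
  apply: (ccvg_unique (u := fun n => bn n.+1 k)).
    exact: (ccvg_shift (u := fun m => bn m k) 1 (bP k)).
  apply: (ccvg_le (f := fun n => 4 * rho / 2 ^+ n)); last exact: geometric_cvg0.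
  move=> n; rewrite cnC; have := hs_pt k ler01 (contract _ _ _ b1 (bn1 n) (lim_b n)).
  rewrite ma_norm => /le_trans; apply.
  by rewrite ler_pdivrMr // ler_peMr ?ler1n // divr_ge0 ?exprn_ge0 ?mulr_ge0 // ltW.
exists b; split=> //.
(* [nls_step] takes the limit at each x. Convergence of the coefficients in H^1 gives it, with a
   geometric rate uniform in x. *)
apply/funext => x; rewrite /nls_step; apply: clim_lim.
apply: (ccvg_le (f := fun n => K0 * (4 * rho) / 2 ^+ n)); last exact: geometric_cvg0.
have aA := KP _ _ a1; have bnA n := KP _ _ (bn1 n).
have iterE n : iter n (nls_rhs h (fS a)) (schroedinger h (fS a)) = fS (bn n).
  elim: n => [|n IH]; first exact: (schroedingerE h aA).
  by rewrite iterS IH (nls_rhsE h0 aA (bnA n)).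
move=> n; rewrite iterE -(fSB x (bnA n) (KP _ _ b1)).
have hd : l1le (ma (fun k => bn n k - b k)) (K0 * (4 * rho / 2 ^+ n)).
  by apply: l1le_le (KP _ _ (lim_b n)) => k; rewrite !ma_norm cnC.
by rewrite -mulrA; exact: fS_le hd.
Qed.

End NumericalStep.

(** * Global H^1 error of the Schroedinger scheme *)

Section Convergence.
Variable R : realType.
Implicit Types (a b : int -> R[i]) (u : R -> int -> R[i]) (h s gam rho T : R) (k : int) (m n : nat).

(* A bound that improves by the map x |-> A + th x improves down to its fixed point. *)
Lemma hs_selfbound s (X : int -> R) (A th X0 : R) : 0 <= th < 1 -> 0 <= A -> hs s X X0 ->
  (forall x, hs s X x -> hs s X (A + th * x)) -> hs s X (A / (1 - th)).
Proof.
move=> /andP[th0 th1] A0 h0 step; have X00 := l2le_ge0 h0.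
have t1 : 0 < 1 - th by lra.
have A1 : 0 <= A / (1 - th) by rewrite divr_ge0 // ltW.
pose x n := A / (1 - th) + X0 * th ^+ n.
have hx n : hs s X (x n).
  elim: n => [|n IH]; first by apply: l2leW h0; rewrite /x expr0 mulr1 lerDr.
  have := step _ IH; congr hs; rewrite /x exprS; field; rewrite gt_eqF //.
split=> // r ur.
have cx : (fun n => x n ^+ 2) @ \oo --> (A / (1 - th)) ^+ 2.
  have g : x @ \oo --> A / (1 - th) + 0.
    apply: cvgD; first exact: cvg_cst.
    by apply: cvg_geometric; rewrite ger0_norm.
  by rewrite addr0 in g; under eq_fun do rewrite expr2; rewrite expr2; exact: cvgM.
rewrite -(cvg_lim _ cx) //; apply: limr_ge; first by apply/cvg_ex; eexists; exact: cx.
by near=> n; have [_ /(_ r ur)] := hx n.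
Unshelve. all: by end_near.
Qed.

(** The clause C h^gam <= 1 keeps the numerical solution in the H^1 ball of radius rho + 1, on which
    the constants of the step depend. The radius [B] is existential, since it is not bounded
    uniformly in m. *)
Lemma nls_converges gam rho T : 2^-1 < gam <= 1 -> 0 < rho -> 0 < T ->
  exists h0 C : R, [/\ 0 < h0 <= 1, 0 < C & forall u, seqsol T rho gam u ->
    forall h m, 0 < h < h0 -> m%:R * h <= T -> C * h `^ gam <= 1 /\
    exists a B, [/\ nls_num h (fS (u 0)) m = fS a, hs (1 + gam) (ma a) B &
      hs 1 (ma (fun k => a k - u (m%:R * h) k)) (C * h `^ gam)]].
Proof.
move=> g01 rho0 T0; have /andP[g2 g1] := g01.
have g0 : 0 <= gam by lra.
have [Cf Cf0 FP] := fixed_point g0; have [Ct Ct0 CtP] := tri_nu_consts g0.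
have [K K0 LE] := local_error g01 (ltW rho0).
set r1 := rho + 1; have r10 : 0 < r1 by rewrite /r1; lra.
set M := 2 * r1; have M0 : 0 < M by rewrite mulr_gt0.
set Lam := Ct * M ^+ 2; have Lam0 : 0 < Lam by rewrite mulr_gt0 // exprn_gt0.
set C := 2 * K * T * expR (Lam * T).
have C0 : 0 < C by rewrite !mulr_gt0 // expR_gt0.
(* Three thresholds: [h1] for solvability of the implicit step on the ball of radius [r1], [h2] for
   absorbing the implicit term, [h3] for C h^gam <= 1. *)
set h1 := (Cf * r1 ^+ 2)^-1; have h10 : 0 < h1 by rewrite invr_gt0 mulr_gt0 // exprn_gt0.
set h2 := Lam^-1; have h20 : 0 < h2 by rewrite invr_gt0.
set h3 := (C^-1) `^ (gam^-1); have h30 : 0 < h3 by rewrite powR_gt0 // invr_gt0.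
exists (Num.min 1 (Num.min h1 (Num.min h2 h3))), C; split=> //.
  by rewrite !lt_min ltr01 h10 h20 h30 ge_min lexx.
move=> u us h m /andP[hp]; rewrite !lt_min => /and4P[hl1 hlh1 hlh2 hlh3] mT.
have hg0 : 0 <= h `^ gam by exact: powR_ge0.
have Chg : C * h `^ gam <= 1.
  have : h `^ gam <= h3 `^ gam.
    by apply: ge0_ler_powR; rewrite ?nnegrE // ltW.
  rewrite /h3 -powRrM mulVf ?gt_eqF //; last by lra.
  rewrite powRr1 ?invr_ge0 ?(ltW C0) // => hC.
  by rewrite -(divff (lt0r_neq0 C0)) ler_pM2l.
have small : h * Cf * r1 ^+ 2 <= 1.
  rewrite -mulrA -(mulVf (lt0r_neq0 (_ : 0 < Cf * r1 ^+ 2))) ?mulr_gt0 ?exprn_gt0 //.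
  by rewrite ler_wpM2r ?ltW // mulr_gt0 // exprn_gt0.
have hLam : h * Lam <= 1.
  by rewrite -(mulVf (lt0r_neq0 Lam0)) ler_wpM2r ?ltW.
have [ub _ _] := us.
have hsu t : 0 <= t <= T -> hs 1 (ma (u t)) rho by move=> /ub; apply: hs_mono; lra.
(* The discrete Gronwall bound in closed form: n local errors, amplified by the exponential; the
   factor 2 pays for solving the implicit inequality. *)
pose d n := 2 * K * (h * h `^ gam) * (n%:R * expR (Lam * (n%:R * h))).
have dC n : n%:R * h <= T -> d n <= C * h `^ gam.
  move=> nT; rewrite /d /C.
  have e1 : expR (Lam * (n%:R * h)) <= expR (Lam * T) by rewrite ler_expR ler_wpM2l // ltW.
  have n0 : 0 <= n%:R * h by rewrite mulr_ge0 // ltW.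
  have := ler_pM n0 (expR_ge0 _) nT e1.
  have k0 : 0 <= 2 * K * h `^ gam by rewrite !mulr_ge0 // ltW.
  move=> /(ler_wpM2l k0).
  rewrite (_ : 2 * K * h `^ gam * (n%:R * h * _) =
    2 * K * (h * h `^ gam) * (n%:R * expR (Lam * (n%:R * h)))); last by ring.
  by rewrite (_ : 2 * K * h `^ gam * (T * _) = 2 * K * T * expR (Lam * T) * h `^ gam) //; ring.
split=> //.
suff [a [B [E aB ad]]] : exists a B, [/\ nls_num h (fS (u 0)) m = fS a, hs (1 + gam) (ma a) B &
      hs 1 (ma (fun k => a k - u (m%:R * h) k)) (d m)].
  by exists a, B; split=> //; apply: l2leW ad; exact: dC.
elim: m mT => [|m IH] mT.
  exists (u 0), rho; split=> //; first by apply: ub; rewrite lexx ltW.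
  by rewrite mul0r; split=> [|r ur]; rewrite /d mul0r mulr0 // big1 ?expr0n // => k _; rewrite /ma subrr cn0 mulr0 expr0n.
have mT' : m%:R * h + h <= T by move: mT; rewrite -natr1 mulrDl mul1r.
have mh0 : 0 <= m%:R * h by rewrite mulr_ge0 // ltW.
have mT2 : m%:R * h <= T by lra.
have [a [B [E aB ad]]] := IH mT2.
set t := m%:R * h in mT' mh0 mT2 ad.
have tT : 0 <= t <= T by rewrite mh0.
have thT : 0 <= t + h <= T by apply/andP; split; lra.
have d1 : d m <= 1 by rewrite (le_trans (dC m mT2)).
have a1 : hs 1 (ma a) r1.
  rewrite /r1; apply: (hsD _ (hsu t tT) (l2leW d1 ad)) => k; rewrite !ma_norm.
  by rewrite -{1}[a k](subrK (u t k)) addrC cnD.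
have [b [Eb bfix b1 b2]] := FP r1 h a B r10 hp small a1 aB.
have us' := seqsol_shift mh0 mT' us.
have le := LE h _ (_ : 0 < h <= 1) us'; rewrite hp ltW // in le; have {}le := le isT.
rewrite addr0 in le.
have M1 x : hs 1 x rho -> hs 1 x M by apply: l2leW; rewrite /M /r1; lra.
have uM := M1 _ (hsu t tT); have wM := M1 _ (hsu _ thT).
have aM : hs 1 (ma a) M by apply: l2leW a1; rewrite /M; lra.
have [_ _ L1] := CtP (nu h) (fun j => cn_nu j hp).
have [_ _ L2] := CtP (nu (- h)) (fun j => cn_nuN j hp).
set th := h / 4 * Lam; have th0 : 0 <= th by rewrite mulr_ge0 ?divr_ge0 // ltW.
have th1 : th <= 1 / 4 by rewrite /th; lra.
set A := d m + th * d m + K * (h * h `^ gam).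
have dm0 : 0 <= d m by exact: l2le_ge0 ad.
have r0 : 0 <= K * (h * h `^ gam) by exact: l2le_ge0 le.
have A0 : 0 <= A by rewrite !addr_ge0 // mulr_ge0.
(* The step is implicit, so the new error also appears on the right, with the factor [th <= 1 / 4].
   [hs_selfbound] absorbs it at the price of dividing by [1 - th]. *)
have self x : hs 1 (ma (fun k => b k - u (t + h) k)) x ->
    hs 1 (ma (fun k => b k - u (t + h) k)) (A + th * x).
  move=> hx.
  have := hs_maB (hs_rhs_diff hp ad (L1 _ _ _ _ aM uM ad) (L2 _ _ _ _ b1 wM hx)) le.
  rewrite (_ : A + th * x = d m + h / 4 * (Ct * M ^+ 2 * d m) + h / 4 * (Ct * M ^+ 2 * x) + K * (h * h `^ gam)); last first.
    by rewrite /A /th /Lam; ring.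
  apply: hs_le => k; rewrite !ma_norm le_eqVlt; apply/orP; left; apply/eqP; congr cn.
  rewrite bfix; move: (rhs _ _ _ _) (rhs _ _ _ _) (u _ _) => *; ring.
have init : hs 1 (ma (fun k => b k - u (t + h) k)) (M + M) by exact: hs_maB.
have fin := hs_selfbound (_ : 0 <= th < 1) A0 init self.
have Em : nls_num h (fS (u 0)) m.+1 = fS b by rewrite /nls_num iterS -/(nls_num _ _ _) E.
exists b, (3 * B); split; [exact: Em|exact: b2|].
rewrite -natr1 mulrDl mul1r -/t.
have {}fin := fin (_ : 0 <= th < 1); rewrite th0 in fin.
have th11 : th < 1 by lra.
apply: l2leW (fin th11).
rewrite ler_pdivrMr; last by lra.
have eh : expR (Lam * (m.+1%:R * h)) = expR (Lam * t) * expR (Lam * h).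
  by rewrite -expRD -natr1 /t; congr expR; ring.
have e1 := expR_ge1Dx (Lam * h).
have e2 : 1 <= expR (Lam * t) by rewrite -expR0 ler_expR mulr_ge0 // ltW.
pose G := K * (h * h `^ gam); have G0 : 0 <= G := r0.
have dE : d m.+1 = 2 * G * (m%:R + 1) * (expR (Lam * t) * expR (Lam * h)).
  by rewrite /d eh -natr1 /G; ring.
have dE' : d m = 2 * G * (m%:R * expR (Lam * t)) by rewrite /d /G /t; ring.
(* For th <= 1/4, multiplying the left side by 1 - th still leaves at least (1 + th) d m + G = [A];
   this is why 4 th and 2 G stand here instead of th and G. *)
have d4 : (1 + 4 * th) * d m + 2 * G <= d m.+1.
  have thL : 4 * th = Lam * h by rewrite /th; field.
  rewrite dE dE' thL.
  have x1 : (1 + Lam * h) * (m%:R * expR (Lam * t)) <= m%:R * (expR (Lam * t) * expR (Lam * h)).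
    rewrite [leLHS]mulrC -mulrA ler_wpM2l // ler_wpM2l ?expR_ge0 //.
  have x2 : 1 <= expR (Lam * t) * expR (Lam * h).
    by rewrite -[leLHS]mulr1 ler_pM // -expR0 ler_expR mulr_ge0 // ltW.
  have := ler_wpM2l (_ : 0 <= 2 * G) (lerD x1 x2); rewrite mulr_ge0 // => /(_ isT).
  by lra.
rewrite /A -/G; move: d4 dm0 G0 th0 th1; set D := d m; set D' := d m.+1 => d4 D0 G0' t0 t1.
have p0 : 0 <= 1 - th by lra.
have p3 : 0 <= 1 - 2 * th by lra.
have := ler_wpM2r p0 d4; have := mulr_ge0 (mulr_ge0 t0 D0) p3; have := mulr_ge0 G0' p3; lra.
Qed.

End Convergence.

(** * The frame scheme *)

Section MatrixExponential.
Variable R : realType.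
Implicit Types (A B : 'M[R[i]]_3) (n p k : nat) (i j : 'I_3).

(** The entrywise l^1 norm: it is submultiplicative, and explicit on [skew3]. *)
Definition mn A : R := \sum_i \sum_j cn (A i j).

Lemma mn_ge0 A : 0 <= mn A.
Proof. by apply: sumr_ge0 => i _; apply: sumr_ge0 => j _; exact: cn_ge0. Qed.

Lemma cn_le_mn A i j : cn (A i j) <= mn A.
Proof.
rewrite /mn (bigD1 i) //= (bigD1 j) //= -addrA lerDl addr_ge0 //.
  by apply: sumr_ge0 => j' _; exact: cn_ge0.
by apply: sumr_ge0 => i' _; apply: sumr_ge0 => j' _; exact: cn_ge0.
Qed.

Lemma mnD A B : mn (A + B) <= mn A + mn B.
Proof.
rewrite /mn -big_split /= ler_sum // => i _; rewrite -big_split /= ler_sum // => j _.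
by rewrite mxE cnD.
Qed.

Lemma mnN A : mn (- A) = mn A.
Proof. by apply: eq_bigr => i _; apply: eq_bigr => j _; rewrite mxE cnN. Qed.

Lemma mnB A B : mn (A - B) <= mn A + mn B.
Proof. by rewrite -(mnN B) mnD. Qed.

Lemma mn_le_bound A (c : R) : (forall i j, cn (A i j) <= c) -> mn A <= 9 * c.
Proof.
move=> h; rewrite /mn (le_trans (_ : _ <= \sum_(i < 3) \sum_(j < 3) c)) //.
  by apply: ler_sum => i _; apply: ler_sum => j _; exact: h.
by rewrite !big_ord_recl !big_ord0; lra.
Qed.

Lemma mnM A B : mn (A *m B) <= mn A * mn B.
Proof.
rewrite /mn mulr_suml ler_sum // => i _.
rewrite (le_trans (_ : _ <= \sum_j \sum_l cn (A i l) * cn (B l j))) //.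
  apply: ler_sum => j _; rewrite mxE (le_trans (cn_sum _ _)) // ler_sum // => l _.
  by rewrite cnM.
rewrite exchange_big /= mulr_suml ler_sum // => l _; rewrite -mulr_sumr ler_wpM2l ?cn_ge0 //.
rewrite [leRHS](bigD1 l) //= lerDl; apply: sumr_ge0 => l' _; apply: sumr_ge0 => j _; exact: cn_ge0.
Qed.

Lemma cn_expM A n i j : cn ((A ^+ n.+1) i j) <= mn A ^+ n.+1.
Proof.
rewrite (le_trans (cn_le_mn _ i j)) //; elim: n => [|n IH]; first by rewrite !expr1.
by rewrite exprS (exprS (mn A)) (le_trans (mnM _ _)) // ler_wpM2l // mn_ge0.
Qed.

Lemma fact_ge n : (2 ^ n <= 2 * n`!)%N.
Proof. by elim: n => // -[//|n] IH; rewrite expnS factS mulnCA leq_mul. Qed.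

Lemma inv_fact n : (n`!%:R : R)^-1 <= 2 / 2 ^+ n.
Proof.
have f0 : 0 < (n`!%:R : R) by rewrite ltr0n fact_gt0.
rewrite ler_pdivlMr ?exprn_gt0 // mulrC ler_pdivrMr //.
by rewrite -natrX -natrM ler_nat fact_ge.
Qed.

Lemma cn_nat n : cn (n%:R : R[i]) = n%:R.
Proof. by rewrite -(rmorph_nat (real_complex R)) cn_pos. Qed.

Definition cmexp_part A n i j : R[i] := (\sum_(k < n) (k`!%:R^-1 *: A ^+ k)) i j.

Lemma cmexp_partS A n i j :
  cmexp_part A n.+1 i j = cmexp_part A n i j + n`!%:R^-1 * (A ^+ n) i j.
Proof. by rewrite /cmexp_part big_ord_recr /= !mxE. Qed.

Lemma cmexp_term A n i j : mn A <= 1 ->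
  cn (n.+1`!%:R^-1 * (A ^+ n.+1) i j) <= 2 / 2 ^+ n.+1 * mn A ^+ n.+1.
Proof.
move=> A1; rewrite cnM cnV cn_nat ler_pM ?cn_ge0 ?invr_ge0 //; first exact: inv_fact.
exact: cn_expM.
Qed.

(** The factor 1 - 2^{-p} makes the induction close, since the term added at stage p is at most
    2^{-(p + 1)} times the final bound. All terms involved have index at least 2, hence [mn A ^+ 2]
    when [mn A <= 1]. *)
Lemma cmexp_part_cauchy A n p i j : mn A <= 1 ->
  cn (cmexp_part A (n.+2 + p) i j - cmexp_part A n.+2 i j) <= (1 - (2 ^+ p)^-1) * (2 / 2 ^+ n.+1 * mn A ^+ 2).
Proof.
move=> A1; have m0 := mn_ge0 A; elim: p => [|p IH].
  by rewrite addn0 subrr cn0 expr0 invr1 subrr mul0r.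
rewrite addnS cmexp_partS addrAC (le_trans (cnD _ _)) //.
have h : cn ((n.+2 + p)`!%:R^-1 * (A ^+ (n.+2 + p)) i j) <= (2 ^+ p.+1)^-1 * (2 / 2 ^+ n.+1 * mn A ^+ 2).
  have -> : (n.+2 + p = (n.+1 + p).+1)%N by rewrite addSn.
  rewrite (le_trans (cmexp_term _ _ _ A1)) // [leRHS]mulrA; apply: ler_pM.
  - by rewrite divr_ge0 ?exprn_ge0.
  - by rewrite exprn_ge0.
  - rewrite -[(n.+1 + p).+1]addnS exprD; rewrite le_eqVlt; apply/orP; left; apply/eqP.
    by field; rewrite !expf_neq0.
  - by rewrite ler_wiXn2l // addnS.
rewrite (le_trans (lerD IH h)) // -mulrDl le_eqVlt; apply/orP; left; apply/eqP; congr (_ * _).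
by rewrite exprS; field; rewrite expf_neq0.
Qed.

(** The partial sums converge by the geometric Cauchy bound, so [clim] is a true limit; the bound
    with n = 0 is then the second-order Taylor remainder. *)
Lemma cmexp_taylor A i j : mn A <= 1 ->
  cn (cmexp A i j - (1 + A) i j) <= mn A ^+ 2.
Proof.
move=> A1; have m0 := mn_ge0 A.
have b n p : cn (cmexp_part A (n.+2 + p) i j - cmexp_part A n.+2 i j) <= 1 / 2 ^+ n.
  rewrite (le_trans (cmexp_part_cauchy _ _ _ _ A1)) //.
  apply: (@le_trans _ _ (1 * (2 / 2 ^+ n.+1 * 1))); first apply: ler_pM.
  - by rewrite subr_ge0 invf_le1 ?exprn_gt0 // exprn_ege1 // ler1n.
  - by rewrite mulr_ge0 ?exprn_ge0 // divr_ge0 ?exprn_ge0.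
  - by rewrite gerBl invr_ge0 exprn_ge0.
  - by rewrite ler_wpM2l ?divr_ge0 ?exprn_ge0 // exprn_ile1.
  by rewrite exprS mul1r mulr1 le_eqVlt; apply/orP; left; apply/eqP; field; rewrite expf_neq0.
have [l lP] : exists l, ccvg (fun n => cmexp_part A n.+2 i j) l.
  apply: (@complex_geometric_cvg _ _ 1) => n p; exact: (b n p).
have {}lP : ccvg (fun n => cmexp_part A n i j) l.
  move/cvgrPdist_lt: lP => H; apply/cvgrPdist_lt => e /H [N _ NP]; exists N.+2 => // -[|[|n]] //= Nn.
  exact: NP.
rewrite mxE (clim_lim (u := fun n => cmexp_part A n i j) lP).
have two : cmexp_part A 2 i j = (1 + A) i j.
  by rewrite /cmexp_part !big_ord_recl big_ord0 /= fact0 !invr1 !scale1r expr0 expr1 addr0.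
have l2 : ccvg (fun p => cmexp_part A (2 + p) i j - cmexp_part A 2 i j) (l - cmexp_part A 2 i j).
  apply: ccvgB; last exact: ccvg_cst.
  exact: (ccvg_shift (u := fun n => cmexp_part A n i j) 2 lP).
rewrite -two; apply: (ler_cn_lim l2) => p.
by rewrite (le_trans (cmexp_part_cauchy 0 _ _ _ A1)) // expr1 divff // mul1r ler_piMl ?exprn_ge0.
Qed.

Lemma mn_cmexp A : mn A <= 1 -> mn (cmexp A - 1 - A) <= 9 * mn A ^+ 2.
Proof.
move=> A1; apply: mn_le_bound => i j.
by have := cmexp_taylor i j A1; rewrite -addrA -opprD !mxE.
Qed.

Lemma skew3E (K : pzRingType) (p q r : K) :
  [/\ [/\ skew3 p q r 0 0 = 0, skew3 p q r 0 1 = - p & skew3 p q r 0 2 = q],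
      [/\ skew3 p q r 1 0 = p, skew3 p q r 1 1 = 0 & skew3 p q r 1 2 = - r] &
      [/\ skew3 p q r 2 0 = - q, skew3 p q r 2 1 = r & skew3 p q r 2 2 = 0]].
Proof. by split; split; rewrite mxE. Qed.

Lemma ord3_cases (P : 'I_3 -> Prop) : P 0 -> P 1 -> P 2 -> forall i, P i.
Proof.
move=> p0 p1 p2 [[|[|[|//]]] lt].
- by rewrite (_ : Ordinal lt = 0) //; apply: val_inj.
- by rewrite (_ : Ordinal lt = 1) //; apply: val_inj.
- by rewrite (_ : Ordinal lt = 2) //; apply: val_inj.
Qed.

Lemma sum_ord3 (V : nmodType) (F : 'I_3 -> V) : \sum_i F i = F 0 + F 1 + F 2.
Proof.
rewrite !big_ord_recl big_ord0 addr0 addrA.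
by congr (_ + F _ + F _); apply: val_inj.
Qed.

Lemma mn_skew3 (p q r : R[i]) : mn (skew3 p q r) = 2 * (cn p + cn q + cn r).
Proof.
have [[a0 a1 a2] [b0 b1 b2] [c0 c1 c2]] := skew3E p q r.
rewrite /mn !sum_ord3 a0 a1 a2 b0 b1 b2 c0 c1 c2 !cnN !cn0; ring.
Qed.

Lemma mx_subE (A B : 'M[R[i]]_3) i j : (A - B) i j = A i j - B i j.
Proof. by rewrite !mxE. Qed.

Lemma skew3B (p q r p' q' r' : R[i]) :
  skew3 p q r - skew3 p' q' r' = skew3 (p - p') (q - q') (r - r').
Proof.
apply/matrixP => i j; rewrite mx_subE.
have [[a0 a1 a2] [b0 b1 b2] [c0 c1 c2]] := skew3E p q r.
have [[d0 d1 d2] [e0 e1 e2] [f0 f1 f2]] := skew3E p' q' r'.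
have [[g0 g1 g2] [h0 h1 h2] [k0 k1 k2]] := skew3E (p - p') (q - q') (r - r').
elim/ord3_cases: i; elim/ord3_cases: j;
  rewrite ?a0 ?a1 ?a2 ?b0 ?b1 ?b2 ?c0 ?c1 ?c2 ?d0 ?d1 ?d2 ?e0 ?e1 ?e2 ?f0 ?f1 ?f2 ?g0 ?g1 ?g2 ?h0 ?h1 ?h2 ?k0 ?k1 ?k2; ring.
Qed.

End MatrixExponential.

(** * From Sobolev functions of x and t to weighted coefficient sequences *)

Section SobolevBridge.
Variable R : realType.
Implicit Types (f : R -> R[i]) (u : R -> R -> R[i]) (s t T gam : R) (k : int).

Let term s f k : R := (1 + k%:~R ^+ 2) `^ s * sqmodulus (fourier f k).

Let termE s f k : term s f k = (hw s k * ma (fourier f) k) ^+ 2.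
Proof. by rewrite /term exprMn hw_sqr sqmodulusE. Qed.

Lemma sobolev_sqnorm_ge s f (r : seq int) : uniq r ->
  ((\sum_(k <- r) (hw s k * ma (fourier f) k) ^+ 2)%:E <= sobolev_sqnorm s f)%E.
Proof.
move=> ur; rewrite /sobolev_sqnorm; apply: esum_ge; exists [set` r].
  by split=> //; exact: finite_seq.
rewrite -fsbig_seq // sumEFin lee_fin le_eqVlt; apply/orP; left; apply/eqP.
by apply: eq_bigr => k _; rewrite -termE.
Qed.

Lemma sobolev_sqnorm_ge0 s f : (0 <= sobolev_sqnorm s f)%E.
Proof. by have := @sobolev_sqnorm_ge s f [::] isT; rewrite big_nil. Qed.

Lemma sobolev_sqnorm_le s f (B : R) : hs s (ma (fourier f)) B ->
  (sobolev_sqnorm s f <= (B ^+ 2)%:E)%E.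
Proof.
move=> [B0 fB]; apply: ge_ereal_sup => _ [A [fA _] <-].
have [r ur rE] : exists2 r : seq int, uniq r & A = [set` r].
  have [r rE] := (finite_seqP A).1 fA; exists (undup r); first exact: undup_uniq.
  by rewrite rE; apply/seteqP; split=> k /=; rewrite mem_undup.
rewrite rE -fsbig_seq // sumEFin lee_fin (le_trans _ (fB r ur)) // le_eqVlt.
by apply/orP; left; apply/eqP; apply: eq_bigr => k _; rewrite -termE.
Qed.

Lemma sobolev_normE s f : (sobolev_sqnorm s f < +oo)%E ->
  ((sobolev_norm s f ^+ 2)%:E = sobolev_sqnorm s f)%E.
Proof.
move=> fin; have f0 := sobolev_sqnorm_ge0 s f.
by rewrite /sobolev_norm sqr_sqrtr ?fine_ge0 // fineK // ge0_fin_numE.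
Qed.

Lemma sobolev_hs s f : (sobolev_sqnorm s f < +oo)%E ->
  hs s (ma (fourier f)) (sobolev_norm s f).
Proof.
move=> fin; split=> [|r ur]; first exact: sqrtr_ge0.
by rewrite -lee_fin sobolev_normE // sobolev_sqnorm_ge.
Qed.

Lemma hs_sobolev s f (B : R) : hs s (ma (fourier f)) B ->
  (sobolev_sqnorm s f < +oo)%E /\ sobolev_norm s f <= B.
Proof.
move=> fB; have h := sobolev_sqnorm_le fB; have B0 := l2le_ge0 fB.
have fin : (sobolev_sqnorm s f < +oo)%E by rewrite (le_lt_trans h) // ltry.
split=> //; rewrite -ler_sqr ?nnegrE //; last exact: sqrtr_ge0.
by rewrite -lee_fin sobolev_normE.
Qed.

(** [fine] sends +oo to 0, so the norm of a difference is informative only once it is known to be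
    finite; that follows from the finiteness of both terms. *)
Lemma sobolev_sub s T u t r : C0_sobolev T s u -> 0 <= t <= T -> 0 <= r <= T ->
  hs s (ma (fun k => fourier (u r) k - fourier (u t) k)) (sobolev_norm s (fun x => u r x - u t x)).
Proof.
move=> [us _] /us[_ ct ft] /us[_ cr fr].
have E : fourier (fun x => u r x - u t x) = fun k => fourier (u r) k - fourier (u t) k.
  by apply/funext => k; rewrite fourierB.
have := hs_maB (sobolev_hs fr) (sobolev_hs ft); rewrite -E => /hs_sobolev[fin _].
exact: sobolev_hs.
Qed.

Lemma C0_sobolev_eps s T u t (e : R) : C0_sobolev T s u -> 0 <= t <= T -> 0 < e ->
  exists2 d : R, 0 < d & forall r, 0 <= r <= T -> `|t - r| < d ->
    sobolev_norm s (fun x => u r x - u t x) <= e.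
Proof.
move=> [_ uc] tT e0; have /cvgrPdist_lt /(_ e e0) := uc t tT.
rewrite near_withinE => -[d /= d0 dP]; exists d => // r rT tr.
have := dP r tr; rewrite /= in_itv /= sub0r normrN => /(_ rT).
by rewrite ger0_norm ?sqrtr_ge0 // => /ltW.
Qed.

Lemma abs_sub_le (a b c : R) : a <= b + c -> b <= a + c -> `|a - b| <= c.
Proof. by move=> h1 h2; rewrite ler_norml; apply/andP; split; lra. Qed.

(** [sup] is a least upper bound only for a set bounded above. The norm is continuous in time by the
    reverse triangle inequality, hence bounded on the compact interval. *)
Lemma sobolev_norm_bounded s T u : 0 < T -> C0_sobolev T s u -> forall t, 0 <= t <= T ->
  sobolev_norm s (u t) <= sup [set sobolev_norm s (u t) | t in `[0, T]%classic].
Proof.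
move=> T0 uC t tT; have [us _] := uC.
have cN : {within `[0, T], continuous (fun t => sobolev_norm s (u t))}.
  apply/subspace_continuousP => r; rewrite /= in_itv /= => rT.
  apply/cvgrPdist_lt => e e0; have e2 : 0 < e / 2 by rewrite divr_gt0.
  have [d d0 dP] := C0_sobolev_eps uC rT e2.
  rewrite near_withinE; exists d => //= q rq; rewrite in_itv /= => qT.
  have [_ _ fr] := us r rT; have [_ _ fq] := us q qT.
  have hd := l2leW (dP q qT rq) (sobolev_sub uC rT qT).
  have h1 : sobolev_norm s (u r) <= sobolev_norm s (u q) + e / 2.
    apply: (proj2 (@hs_sobolev s (u r) _ _)).
    apply: hsD (sobolev_hs fq) hd => k; rewrite !ma_norm.
    by have := cnB (fourier (u q) k) (fourier (u q) k - fourier (u r) k); rewrite subKr.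
  have h2 : sobolev_norm s (u q) <= sobolev_norm s (u r) + e / 2.
    apply: (proj2 (@hs_sobolev s (u q) _ _)).
    apply: hsD (sobolev_hs fr) hd => k; rewrite !ma_norm.
    by have := cnD (fourier (u r) k) (fourier (u q) k - fourier (u r) k); rewrite addrC subrK.
  apply: (@le_lt_trans _ _ (e / 2)); last by rewrite ltr_pdivrMr // ltr_pMr // ltr1n.
  exact: abs_sub_le h1 h2.
have [c _ cM] := EVT_max (ltW T0) cN.
apply: ub_le_sup; last by exists t => //=; rewrite in_itv.
exists (sobolev_norm s (u c)) => _ [r /= rT <-]; exact: cM.
Qed.

Lemma sobolev_l1 s u T : 1 <= s -> C0_sobolev T s u -> forall t, 0 <= t <= T ->
  exists A, l1le (ma (fourier (u t))) A.
Proof.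
move=> s1 [us _] t /us[_ _ fin]; have [K0 _ KP] := @hs1_l1 R.
by eexists; apply: KP; exact: hs_mono s1 (sobolev_hs fin).
Qed.

Lemma C0_sobolev_series s u T : 1 <= s -> C0_sobolev T s u -> forall t, 0 <= t <= T ->
  u t = fS (fourier (u t)).
Proof.
move=> s1 uC t tT; have [A hA] := sobolev_l1 s1 uC tT.
by have [us _] := uC; have [per ct _] := us t tT; exact: fourier_inversion per ct hA.
Qed.

Lemma C0_sobolev_pointwise s u T x : 1 <= s -> C0_sobolev T s u -> ccon T (fun t => u t x).
Proof.
move=> s1 uC t tT e e0; have [K0 K00 KP] := @hs1_l1 R.
have e1 : 0 < e / K0 by rewrite divr_gt0.
have [d d0 dP] := C0_sobolev_eps uC tT e1; exists d => // r rT tr.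
rewrite (C0_sobolev_series s1 uC tT) (C0_sobolev_series s1 uC rT).
have [A hA] := sobolev_l1 s1 uC tT; have [B hB] := sobolev_l1 s1 uC rT.
rewrite cnC -(fSB x hB hA).
have h := KP _ _ (hs_mono s1 (l2leW (dP r rT tr) (sobolev_sub uC tT rT))).
by have := fS_le x h; rewrite mulrC divfK ?gt_eqF.
Qed.

(** Testing against e^{-ikx} leaves one differential equation for each coefficient. Since |u|^2 u =
    u u conj(u), the nonlinearity has the coefficients [tri] with trivial multiplier. *)
Lemma nls_seqsol T gam u (rho : R) : 0 < T -> 0 <= gam -> C0_sobolev T (1 + gam) u ->
  nls_solution T u -> (forall t, 0 <= t <= T -> sobolev_norm (1 + gam) (u t) <= rho) ->
  seqsol T rho gam (fun t => fourier (u t)).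
Proof.
move=> T0 g0 uC nls ub; have [us _] := uC; have s1 : 1 <= 1 + gam by rewrite lerDl.
split=> [t tT|k t tT e e0|k t tT].
- by have [_ _ fin] := us t tT; apply: l2leW (sobolev_hs fin); exact: ub.
- have [d d0 dP] := C0_sobolev_eps uC tT e0; exists d => // r rT tr.
  have := hs_pt k (_ : 0 <= 1 + gam) (l2leW (dP r rT tr) (sobolev_sub uC tT rT)).
  by rewrite addr_ge0 // => /(_ isT); rewrite ma_norm cnC.
have tT' : 0 <= t <= T by case/andP: tT => ? ?; rewrite !ltW.
have [d [hd E]] := nls t tT k; apply: cder_eq hd _.
have [A hA] := sobolev_l1 s1 uC tT'.
have F : fourier (fun x => (sqmodulus (u t x))%:C * u t x) k = tri (@one_mult R) (fourier (u t)) k.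
  have -> : (fun x => (sqmodulus (u t x))%:C * u t x) = fun x => (u t x * u t x) * fS (cr (fourier (u t))) x.
    apply/funext => x; rewrite -mulconj -(fS_conj x hA) -(C0_sobolev_series s1 uC tT'); ring.
  rewrite {1 2}(C0_sobolev_series s1 uC tT').
  rewrite (fourier_mulS _ (ccontM (ccont_fS hA) (ccont_fS hA)) (l1_cr hA)).
  by congr csumZ; apply/funext => j; rewrite mul1r (fourier_mul_fS _ hA hA).
rewrite F in E; set N := tri _ _ k in E *.
have i2 : 'i%C * 'i%C = -1 :> R[i] by rewrite -expr2 sqr_i.
have ksqE : k%:~R ^+ 2 = (ksq R k)%:C :> R[i] by rewrite /ksq rmorphXn /= rmorph_int.
rewrite ksqE in E.
have -> : d = - 'i%C * ('i%C * d) by rewrite mulrA mulNr i2 opprK mul1r.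
have -> : 'i%C * d = (ksq R k)%:C * fourier (u t) k - 2^-1 * N.
  apply/eqP; rewrite -subr_eq0; apply/eqP; rewrite -[RHS]E; ring.
ring.
Qed.

End SobolevBridge.

(** * Double series over pairs of frequencies *)

Section DoubleSums.
Variable R : realType.
Implicit Types (X Y : int -> R) (g : int -> int -> R[i]) (l k : int).

Lemma csumZ_fin (a : int -> R[i]) (s : seq int) : uniq s -> (forall k, k \notin s -> a k = 0) ->
  csumZ a = \sum_(k <- s) a k.
Proof.
move=> us a0; apply: csumZ_lim; rewrite /ccvg; apply: cvg_near_cst.
have [N NP] := win_cover s; near=> n; apply/eqP.
have sn : {subset s <= win n} by apply: NP; near: n; exact: nbhs_infty_ge.
have -> : \sum_(k <- win n) a k = \sum_(k <- s) a k.
  rewrite (bigID (mem s)) /= [X in _ + X]big1 ?addr0; last by move=> k; exact: a0.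
  rewrite -big_filter; apply: perm_big; apply: uniq_perm => //.
    by rewrite filter_uniq ?uniq_win.
  by move=> k; rewrite mem_filter; apply/andP/idP => [[]//|ks]; split=> //; exact: sn.
by rewrite subrr cn0.
Unshelve. all: by end_near.
Qed.

(* Sums over pairs (k1, k2), arranged by the value l of k1 - k2 as in Q2. *)
Definition dsum g : R[i] := csumZ (fun l => csumZ (fun k1 => g k1 (k1 - l))).

Lemma dsum_inner g X Y (A B : R) l : l1le X A -> l1le Y B ->
  (forall k1 k2, cn (g k1 k2) <= X k1 * Y k2) -> l1le (ma (fun k1 => g k1 (k1 - l))) (A * B).
Proof.
move=> XA YB gXY; apply: l1le_ma (l1le_mulb (Y := fun k => Y (k - l)) XA _) => [k|k].
  exact: gXY.
exact: l1le_pt YB.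
Qed.

Lemma dsum_outer g X Y (A B : R) : l1le X A -> l1le Y B ->
  (forall k1 k2, cn (g k1 k2) <= X k1 * Y k2) ->
  l1le (ma (fun l => csumZ (fun k1 => g k1 (k1 - l)))) (A * B).
Proof.
move=> XA YB gXY; apply: l1le_ma (rconv_l1 XA (l1le_inj (@oppr_inj _) YB)) => l.
apply: (@csumZ_le_sumZ _ _ _ (A * B)) => [k|].
  by rewrite /= opprB; exact: gXY.
have := l1le_mulb (Y := fun k => Y (k - l)) XA (fun k => l1le_pt (k - l) YB).
by congr l1le; apply/funext => k /=; rewrite opprB.
Qed.

Lemma dsum_le g X Y (A B : R) : l1le X A -> l1le Y B ->
  (forall k1 k2, cn (g k1 k2) <= X k1 * Y k2) -> cn (dsum g) <= A * B.
Proof. by move=> XA YB gXY; apply: csumZ_le; exact: dsum_outer XA YB gXY. Qed.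

Lemma dsumD g g' X Y X' Y' (A B A' B' : R) : l1le X A -> l1le Y B -> l1le X' A' -> l1le Y' B' ->
  (forall k1 k2, cn (g k1 k2) <= X k1 * Y k2) ->
  (forall k1 k2, cn (g' k1 k2) <= X' k1 * Y' k2) ->
  dsum (fun k1 k2 => g k1 k2 + g' k1 k2) = dsum g + dsum g'.
Proof.
move=> XA YB XA' YB' gb gb'; rewrite /dsum -(csumZD (dsum_outer XA YB gb) (dsum_outer XA' YB' gb')).
congr csumZ; apply/funext => l.
by rewrite -(csumZD (dsum_inner l XA YB gb) (dsum_inner l XA' YB' gb')).
Qed.

Lemma dsum_box g N : (forall k1 k2, ~~ ((k1 \in win N) && (k2 \in win N)) -> g k1 k2 = 0) ->
  dsum g = \sum_(k1 <- win N) \sum_(k2 <- win N) g k1 k2.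
Proof.
move=> g0; rewrite /dsum.
have E l : csumZ (fun k1 => g k1 (k1 - l)) = \sum_(k1 <- win N) g k1 (k1 - l).
  by apply: csumZ_fin; rewrite ?uniq_win // => k kN; apply: g0; rewrite (negbTE kN).
under eq_fun do rewrite E.
(* Two frequencies of size at most N differ by at most 2 N, whence the doubled window for l. *)
rewrite (@csumZ_fin _ (win N.*2)) ?uniq_win //; last first.
  move=> l lN; rewrite big_seq big1 // => k kN; apply: g0; rewrite kN /=.
  by move: lN kN; rewrite !mem_win; lia.
rewrite exchange_big /= [LHS]big_seq [RHS]big_seq; apply: eq_bigr => k1 k1N.
rewrite -(big_map (fun l => k1 - l) xpredT (g k1)).
have ur : uniq [seq k1 - l | l <- win N.*2].
  by rewrite map_inj_uniq; [exact: uniq_win|exact: subr_inj].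
have rin k2 : k2 \in win N -> k2 \in [seq k1 - l | l <- win N.*2].
  move=> k2N; apply/mapP; exists (k1 - k2); last by rewrite subKr.
  by move: k1N k2N; rewrite !mem_win; lia.
move: [seq k1 - l | l <- win N.*2] ur rin => r ur rin.
rewrite (bigID (mem (win N))) /= [X in _ + X]big1 ?addr0; last first.
  by move=> k2 k2N; apply: g0; rewrite (negbTE k2N) andbF.
rewrite -big_filter; apply: perm_big; apply: uniq_perm.
- exact: filter_uniq.
- exact: uniq_win.
by move=> k2; rewrite mem_filter; apply/andP/idP => [[]//|k2N]; split=> //; exact: rin.
Qed.

Lemma l1_out X (A : R) : (forall k, 0 <= X k) -> l1le X A -> forall e : R, 0 < e ->
  exists N, forall n, (N <= n)%N -> l1le (fun k => if k \in win n then 0 else X k) e.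
Proof.
move=> X0 XA e e0; have [N NP] := l1_tail XA e0; exists N => n Nn s us.
rewrite (bigID (mem (win n))) /= big1 ?add0r; last by move=> k ->; rewrite normr0.
rewrite -big_filter.
have h := NP n Nn [seq k <- s | k \notin win n] (filter_uniq _ us) _.
apply: le_trans (h _); last by move=> k; rewrite mem_filter => /andP[].
rewrite !big_filter; apply: ler_sum => k /negbTE ->; exact: lexx.
Qed.

(** Summation along k1 - k2 = l is replaced by summation over squares, where a product of two
    truncated series is a truncated double series. Outside the square either k1 or k2 is large, and
    both remainders are controlled by the tail of X. *)
Lemma dsum_cvg g X (A : R) : (forall k, 0 <= X k) -> l1le X A ->
  (forall k1 k2, cn (g k1 k2) <= X k1 * X k2) ->
  ccvg (fun N => \sum_(k1 <- win N) \sum_(k2 <- win N) g k1 k2) (dsum g).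
Proof.
move=> X0 XA gX; have A0 := l1le_ge0 XA; apply/cvgrPdist_lt => e e0.
have e1 : 0 < e / (2 * A + 1) / 2 by rewrite !divr_gt0 // ltr_wpDl ?mulr_ge0.
have [N NP] := l1_out X0 XA e1; exists N => // n /= Nn.
have XO := NP n Nn; set XX := fun k => _ in XO; set d := _ / 2 in XO e1.
rewrite sub0r normrN ger0_norm ?cn_ge0 // cnC.
pose gb k1 k2 : R[i] := if (k1 \in win n) && (k2 \in win n) then g k1 k2 else 0.
pose g1 k1 k2 : R[i] := if k1 \in win n then 0 else g k1 k2.
pose g2 k1 k2 : R[i] := if (k1 \in win n) && (k2 \notin win n) then g k1 k2 else 0.
have gbb k1 k2 : cn (gb k1 k2) <= X k1 * X k2.
  by rewrite /gb; case: ifP => _; rewrite ?cn0 ?mulr_ge0 ?gX.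
have g1b k1 k2 : cn (g1 k1 k2) <= XX k1 * X k2.
  by rewrite /g1 /XX; case: ifP => _; rewrite ?cn0 ?mul0r ?gX.
have g2b k1 k2 : cn (g2 k1 k2) <= X k1 * XX k2.
  rewrite /g2 /XX; case: ifP => [/andP[_ /negbTE ->]|_]; first exact: gX.
  by rewrite cn0 mulr_ge0 //; case: ifP.
have g12 k1 k2 : cn (gb k1 k2 + g1 k1 k2) <= X k1 * X k2.
  rewrite /gb /g1; case: (k1 \in win n) => /=; rewrite ?add0r ?addr0 ?gX //.
  by case: ifP => _; rewrite ?cn0 ?mulr_ge0 ?gX.
have -> : dsum g = \sum_(k1 <- win n) \sum_(k2 <- win n) g k1 k2 + dsum g1 + dsum g2.
  have E : dsum g = dsum (fun k1 k2 => (gb k1 k2 + g1 k1 k2) + g2 k1 k2).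
    congr dsum; apply/funext => k1; apply/funext => k2; rewrite /gb /g1 /g2.
    by case: (k1 \in win n); case: (k2 \in win n); rewrite /= ?addr0 ?add0r.
  rewrite [LHS]E (dsumD XA XA XA XO g12 g2b) (dsumD XA XA XO XA gbb g1b).
  congr (_ + _ + _).
  rewrite (@dsum_box _ n) => [|k1 k2 /negbTE]; last by rewrite /gb => ->.
  rewrite big_seq [RHS]big_seq; apply: eq_bigr => k1 k1n.
  rewrite big_seq [RHS]big_seq; apply: eq_bigr => k2 k2n.
  by rewrite /gb k1n k2n.
rewrite [X in cn X](_ : _ = dsum g1 + dsum g2); last first.
  by move: (dsum g1) (dsum g2) (\sum_(k1 <- win n) _) => *; ring.
rewrite (le_lt_trans (cnD _ _)) //.
have h1 := dsum_le XO XA g1b; have h2 := dsum_le XA XO g2b.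
have dE : d * (2 * A + 1) = e / 2 by rewrite /d; field; rewrite gt_eqF // ltr_wpDl ?mulr_ge0.
have e20 : e / 2 < e by rewrite ltr_pdivrMr // ltr_pMr // ltr1n.
apply: le_lt_trans e20; rewrite -dE; move: h1 h2 (ltW e1); nra.
Qed.

End DoubleSums.

(** * The quadratures Q1 and Q2 on coefficients: size and Lipschitz bounds *)

Section Quadratures.
Variable R : realType.
Implicit Types (a v w : int -> R[i]) (h x : R) (k j l : int).

Definition ik k : R[i] := 'i%C * k%:~R.

Lemma cn_ik k : cn (ik k) <= hw 1 k.
Proof.
rewrite cnM cn_i mul1r -(rmorph_int (real_complex R)) cn_real; exact: abs_le_hw1.
Qed.

Lemma dx_fS a A : l1le (ma a) A -> dx (fS a) = fS (fun k => ik k * a k).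
Proof.
move=> aA; apply/funext => x; rewrite /dx /fS; congr csumZ; apply/funext => k.
by rewrite -/(fS a) (fourier_fS _ aA).
Qed.

Lemma l1_weight a A : l1le (fun k => hw 1 k * ma a k) A -> l1le (ma a) A.
Proof.
apply: l1le_le => k; rewrite normrM (ger0_norm (hw_ge0 _ _)) ler_peMl //.
exact: hw_ge1.
Qed.

Lemma l1_ik a A : l1le (fun k => hw 1 k * ma a k) A -> l1le (ma (fun k => ik k * a k)) A.
Proof. by apply: l1le_ma => k; rewrite cnM ler_wpM2r ?cn_ge0 // cn_ik. Qed.

Definition q1c h v w k : R[i] :=
  ik k * Iph (- ksq R k) h * ((eit (ksq R k * h) * w k + v k) / 2).

Lemma Q1E h v w A B : 0 < h -> l1le (fun k => hw 1 k * ma v k) A ->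
  l1le (fun k => hw 1 k * ma w k) B -> Q1 h (fS v) (fS w) = fS (q1c h v w).
Proof.
move=> h0 vA wB; have v1 := l1_ik vA; have w1 := l1_ik wB.
apply/funext => x; rewrite /Q1 (dx_fS (l1_weight vA)) (dx_fS (l1_weight wB)) (schroedingerE (- h) w1).
have w2 : l1le (ma (fun k => eit (- (ksq R k * - h)) * (ik k * w k))) B.
  by apply: l1_mult w1 => k; rewrite cn_eit.
have sc c C : l1le (ma c) C -> l1le (ma (fun k => 2^-1 * c k)) (cn (2^-1 : R[i]) * C).
  by apply: l1leZ => [|k]; rewrite ?cn_ge0 // !ma_norm cnM.
have vw := sc _ _ (l1_maD w2 v1).
rewrite (_ : (fun y => _) = fS (fun k => 2^-1 * (eit (- (ksq R k * - h)) * (ik k * w k) + ik k * v k))); last first.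
  by apply/funext => y; rewrite (fSZ _ _ (l1_maD w2 v1)) (fSD _ w2 v1) mulrC.
rewrite /phi1_dxx fun_dxxE -(@fSZ _ _ (1 * (cn (2^-1 : R[i]) * (B + A)))); last first.
  apply: (l1leZ ler01 _ vw) => k; rewrite !ma_norm mul1r cnM (fourier_fS _ vw) ler_piMl ?cn_ge0 //.
  by rewrite (_ : phi1 _ = nu (- h) k) ?cn_nuN // /nu; congr (phi1 ('i%C * _%:C)); ring.
congr (fS _ x); apply/funext => k; rewrite (fourier_fS _ vw) /q1c /Iph.
rewrite (_ : h * - ksq R k = - ksq R k * h); last by rewrite mulrC.
rewrite mulrN opprK; ring.
Qed.

Lemma cn_half : cn (2^-1 : R[i]) = 2^-1.
Proof. by rewrite cnV (cn_nat R 2). Qed.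

Lemma cn_avg (y z : R[i]) : cn ((y + z) / 2) <= (cn y + cn z) / 2.
Proof. by rewrite cnM cn_half ler_wpM2r ?invr_ge0 // cnD. Qed.

Lemma cn_q1c h v w k : 0 <= h -> cn (q1c h v w k) <= h * (hw 1 k * (cn (v k) + cn (w k))).
Proof.
move=> h0; rewrite /q1c cnM [cn (ik k * _)]cnM [cn (_ / 2)]cnM -mulrA.
have a1 := cn_ik k; have a2 : cn (Iph (- ksq R k) h) <= h by exact: cn_Iph.
have a3 : cn (eit (ksq R k * h) * w k + v k) * cn (2^-1 : R[i]) <= cn (v k) + cn (w k).
  rewrite cn_half (le_trans (ler_wpM2r _ (cnD _ _))) ?invr_ge0 // cnM cn_eit mul1r.
  by have := cn_ge0 (v k); have := cn_ge0 (w k); lra.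
rewrite mulrCA; apply: ler_pM => //; first exact: cn_ge0.
  by rewrite !mulr_ge0 ?cn_ge0.
by apply: ler_pM; rewrite ?mulr_ge0 ?cn_ge0.
Qed.

(* The smoothing of phi_1 absorbs the derivative at the cost of half a power of h. *)
Lemma cn_q1c_smooth h v w k : 0 <= h -> cn (q1c h v w k) <= 2 * Num.sqrt h * (cn (v k) + cn (w k)).
Proof.
move=> h0; rewrite /q1c cnM [cn (ik k * _)]cnM [cn (_ / 2)]cnM.
have a2 : cn (Iph (- ksq R k) h) <= h by exact: cn_Iph.
have a1 : ksq R k * cn (Iph (- ksq R k) h) <= 2.
  by have := @cn_Iph_c R (- ksq R k) h h0; rewrite normrN ger0_norm // sqr_ge0.
have i0 := cn_ge0 (Iph (- ksq R k) h).
(* The geometric mean of the two bounds: the square of the left side is (k^2 |I|) |I| <= 2 h, where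
   I is the phase integral. *)
have a4 : cn (ik k) * cn (Iph (- ksq R k) h) <= 2 * Num.sqrt h.
  rewrite -ler_sqr ?nnegrE ?mulr_ge0 ?cn_ge0 ?sqrtr_ge0 // !exprMn sqr_sqrtr //.
  have -> : cn (ik k) ^+ 2 = ksq R k.
    by rewrite cnM cn_i mul1r -(rmorph_int (real_complex R)) cn_real real_normK ?num_real.
  by rewrite [cn _ ^+ 2]expr2 mulrA; have := ler_pM _ i0 a1 a2; rewrite mulr_ge0 ?sqr_ge0 // => /(_ isT); lra.
have a3 : cn (eit (ksq R k * h) * w k + v k) * cn (2^-1 : R[i]) <= cn (v k) + cn (w k).
  rewrite cn_half (le_trans (ler_wpM2r _ (cnD _ _))) ?invr_ge0 // cnM cn_eit mul1r.
  by have := cn_ge0 (v k); have := cn_ge0 (w k); lra.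
by apply: ler_pM => //; rewrite ?mulr_ge0 ?cn_ge0.
Qed.

Lemma q1cB h v w v' w' k : q1c h v w k - q1c h v' w' k =
  q1c h (fun k => v k - v' k) (fun k => w k - w' k) k.
Proof. by rewrite /q1c; move: (Iph _ _) (eit _) (ik k) (v k) (w k) (v' k) (w' k) => *; ring. Qed.

(** The integral of |f|^2 is 2 pi times the coefficient of f conj(f) at index 0; this coefficient is
    a convolution, bounded by Cauchy-Schwarz. *)
Lemma fS_L2 a A B : l1le (ma a) A -> l2le (ma a) B ->
  (\int[@lebesgue_measure R]_(x in @torus R) sqmodulus (fS a x))%R <= 2 * pi * B ^+ 2.
Proof.
move=> aA aB; have B0 := l2le_ge0 aB.
have F : fourier (fun x => fS a x * fS (cr a) x) 0 = conv (cr a) a 0.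
  exact: fourier_mul_fS aA (l1_cr aA).
have c : cn (conv (cr a) a 0) <= B * B.
  apply: csumZ_le; have := l1le_CS (l2le_inj (@oppr_inj _) aB) (l2le_inj (@oppr_inj _) aB).
  by apply: l1le_le => k /=; rewrite ma_norm cnM cn_conj sub0r normrM !ma_norm.
have -> : (\int[@lebesgue_measure R]_(x in @torus R) sqmodulus (fS a x))%R =
    2 * pi * complex.Re (conv (cr a) a 0).
  have TI f : complex.Re (tint f) = (\int[@lebesgue_measure R]_(x in @torus R) complex.Re (f x))%R by [].
  rewrite -F fourierE ReM [complex.Re _%:C]/= [complex.Im _%:C]/= mul0r subr0 mulrA divff ?mul1r; last by rewrite gt_eqF ?pi2_gt0.
  rewrite TI; apply: eq_Rintegral => x _.
  by rewrite oppr0 echar0 mulr1 -(fS_conj _ aA) mulconj.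
by rewrite ler_pM2l ?pi2_gt0 // expr2 (le_trans (ler_norm _)) // (le_trans (Re_le_cn _)).
Qed.

Definition qA h v w k1 k2 : R[i] :=
  Iph (- ksq R k1) h * ((eit (ksq R k1 * h) * w k1 + v k1) / 2) * ((w k2 + v k2) / 2)^*%C.

(** The second sum of the scheme is the conjugate of the first with k1 and k2 exchanged; one
    estimate of [qA] therefore serves both cases. *)
Definition q2 h v w k1 k2 : R[i] :=
  if k2 ^+ 2 <= k1 ^+ 2 then qA h v w k1 k2 else (qA h v w k2 k1)^*%C.

(** A common majorant of the twisted and of the plain average of the two data, uniform in h. *)
Definition mass v w k : R := cn (v k) + cn (w k).

Lemma mass_ge0 v w k : 0 <= mass v w k.
Proof. by rewrite addr_ge0 ?cn_ge0. Qed.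

Lemma l1_mass v w (A B : R) : l1le (ma v) A -> l1le (ma w) B -> l1le (mass v w) (A + B).
Proof. by apply: l1leD => k; rewrite !ma_norm ger0_norm ?mass_ge0. Qed.

Lemma cn_avg_eit h v w k : cn ((eit (ksq R k * h) * w k + v k) / 2) <= mass v w k.
Proof.
rewrite (le_trans (cn_avg _ _)) // cnM cn_eit mul1r /mass.
by have := cn_ge0 (v k); have := cn_ge0 (w k); lra.
Qed.

Lemma cn_avg_mass v w k : cn ((w k + v k) / 2)^*%C <= mass v w k.
Proof.
rewrite cn_conj (le_trans (cn_avg _ _)) // /mass.
by have := cn_ge0 (v k); have := cn_ge0 (w k); lra.
Qed.

Lemma cn_qA h v w k1 k2 : 0 <= h -> cn (qA h v w k1 k2) <= h * (mass v w k1 * mass v w k2).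
Proof.
move=> h0; rewrite /qA cnM [cn (Iph _ _ * _)]cnM mulrA.
apply: ler_pM; rewrite ?mulr_ge0 ?cn_ge0 ?cn_avg_mass //; apply: ler_pM; rewrite ?cn_ge0 ?cn_avg_eit //; exact: cn_Iph.
Qed.

Lemma cn_q2 h v w k1 k2 : 0 <= h -> cn (q2 h v w k1 k2) <= h * (mass v w k1 * mass v w k2).
Proof.
move=> h0; rewrite /q2; case: ifP => _; first exact: cn_qA.
by rewrite cn_conj [mass _ _ k1 * _]mulrC cn_qA.
Qed.

Lemma cn_qA_diff h v w v' w' k1 k2 (D Z : int -> R) : 0 <= h ->
  (forall k, mass (fun k => v k - v' k) (fun k => w k - w' k) k <= D k) ->
  (forall k, mass v w k <= Z k) -> (forall k, mass v' w' k <= Z k) ->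
  cn (qA h v w k1 k2 - qA h v' w' k1 k2) <= h * (D k1 * Z k2 + Z k1 * D k2).
Proof.
move=> h0 dD zZ zZ'; set dv := fun k => v k - v' k in dD; set dw := fun k => w k - w' k in dD.
have -> : qA h v w k1 k2 - qA h v' w' k1 k2 =
   Iph (- ksq R k1) h * (((eit (ksq R k1 * h) * dw k1 + dv k1) / 2) * ((w k2 + v k2) / 2)^*%C +
     ((eit (ksq R k1 * h) * w' k1 + v' k1) / 2) * ((dw k2 + dv k2) / 2)^*%C).
  rewrite /qA.
  have -> : ((w k2 + v k2) / 2)^*%C = ((dw k2 + dv k2) / 2)^*%C + ((w' k2 + v' k2) / 2)^*%C.
    by rewrite -conjD; congr (_^*%C); rewrite /dw /dv; move: (w k2) (v k2) => *; ring.
  rewrite /dw /dv; move: (Iph _ _) (eit _) (_ ^*%C) (_ ^*%C) => *; ring.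
have D0 k : 0 <= D k by apply: le_trans (dD k); exact: mass_ge0.
have Z0 k : 0 <= Z k by apply: le_trans (zZ k); exact: mass_ge0.
rewrite cnM; apply: ler_pM; rewrite ?cn_ge0 //; first exact: cn_Iph.
rewrite (le_trans (cnD _ _)) // lerD //.
  rewrite cnM; apply: ler_pM; rewrite ?cn_ge0 //.
    exact: le_trans (cn_avg_eit _ _ _ _) (dD _).
  exact: le_trans (cn_avg_mass _ _ _) (zZ _).
rewrite cnM; apply: ler_pM; rewrite ?cn_ge0 //.
  exact: le_trans (cn_avg_eit _ _ _ _) (zZ' _).
exact: le_trans (cn_avg_mass dv dw _) (dD _).
Qed.

Lemma cn_q2_diff h v w v' w' k1 k2 (D Z : int -> R) : 0 <= h ->
  (forall k, mass (fun k => v k - v' k) (fun k => w k - w' k) k <= D k) ->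
  (forall k, mass v w k <= Z k) -> (forall k, mass v' w' k <= Z k) ->
  cn (q2 h v w k1 k2 - q2 h v' w' k1 k2) <= h * (D k1 * Z k2 + Z k1 * D k2).
Proof.
move=> h0 dD zZ zZ'; rewrite /q2; case: ifP => _; first exact: cn_qA_diff.
rewrite -conjN -conjD cn_conj; have := cn_qA_diff k2 k1 h0 dD zZ zZ'.
by rewrite (_ : D k2 * Z k1 + Z k2 * D k1 = D k1 * Z k2 + Z k1 * D k2) //; ring.
Qed.

Lemma Q2_cvg h v w (A B x : R) : 0 <= h -> l1le (ma v) A -> l1le (ma w) B ->
  ccvg (fun N => \sum_(k1 <- win N) \sum_(k2 <- win N) echar (k1 - k2) x * q2 h v w k1 k2)
    (Q2 h (fS v) (fS w) x).
Proof.
move=> h0 vA wB; have mAB := l1_mass vA wB.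
(* The factor h of the quadrature is shared between the two frequencies, so that [dsum_cvg] applies
   with a single majorant. *)
set X := fun k => Num.sqrt h * mass v w k.
have X0 k : 0 <= X k by rewrite mulr_ge0 ?sqrtr_ge0 ?mass_ge0.
have XA : l1le X (Num.sqrt h * (A + B)).
  by apply: l1leZ mAB => [|k]; rewrite ?sqrtr_ge0 // normrM ger0_norm ?sqrtr_ge0.
have XX k1 k2 : X k1 * X k2 = h * (mass v w k1 * mass v w k2).
  by rewrite /X mulrACA -expr2 sqr_sqrtr.
have gX k1 k2 : cn (echar (k1 - k2) x * q2 h v w k1 k2) <= X k1 * X k2.
  by rewrite cnM cn_echar mul1r XX cn_q2.
have -> : Q2 h (fS v) (fS w) x = dsum (fun k1 k2 => echar (k1 - k2) x * q2 h v w k1 k2).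
  rewrite /Q2 /dsum; congr csumZ; apply/funext => l.
  have fv k : fourier (fS v) k = v k by exact: fourier_fS vA.
  have fw k : fourier (fS w) k = w k by exact: fourier_fS wB.
  have ksqC k : (h * (k%:~R) ^+ 2)%:C = (h * ksq R k)%:C :> R[i] by [].
  pose F1 k1 : R[i] := if (k1 - l) ^+ 2 <= k1 ^+ 2 then qA h v w k1 (k1 - l) else 0.
  pose F2 k1 : R[i] := if (k1 - l) ^+ 2 <= k1 ^+ 2 then 0 else (qA h v w (k1 - l) k1)^*%C.
  have sX := l1le_mulb (Y := fun k => X (k - l)) XA (fun k => l1le_pt (k - l) XA).
  have F1s : l1le (ma F1) (Num.sqrt h * (A + B) * (Num.sqrt h * (A + B))).
    apply: l1le_ma sX => k; rewrite /F1; case: ifP => _; last by rewrite cn0 mulr_ge0.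
    by rewrite XX cn_qA.
  have F2s : l1le (ma F2) (Num.sqrt h * (A + B) * (Num.sqrt h * (A + B))).
    apply: l1le_ma sX => k; rewrite /F2; case: ifP => _; first by rewrite cn0 mulr_ge0.
    by rewrite XX cn_conj [mass _ _ k * _]mulrC cn_qA.
  have E1 : Q2_coef h (fS v) (fS w) l = csumZ F1 + csumZ F2.
    rewrite /Q2_coef; congr (csumZ _ + csumZ _); apply/funext => k1.
      rewrite /F1; case: ifP => // _; rewrite !fv !fw; rewrite cexp_eit /qA /Iph.
      rewrite -[in LHS](conjD (w (k1 - l)) (v (k1 - l))) [(_ / 2)^*%C]conjM conjc_inv conjc_nat.
      rewrite (_ : - ('i%C * (h * k1%:~R ^+ 2)%:C) = 'i%C * (- ksq R k1 * h)%:C :> R[i]); last first.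
        by apply: complex_ext; rewrite ?ReN ?ImN ?ReM ?ImM /= /ksq; ring.
      by rewrite (_ : h * k1%:~R ^+ 2 = ksq R k1 * h) // mulrC.
    rewrite /F2 ltNge if_neg; case: ifP => // _; rewrite !fv !fw cexp_eit /qA.
    rewrite (conjM (Iph _ _ * _)) (conjM (Iph _ _)) Iph_conj opprK conjcK /Iph [(_ / 2)^*%C]conjM conjc_inv conjc_nat conjD.
    rewrite (_ : h * (k1 - l)%:~R ^+ 2 = ksq R (k1 - l) * h); last by rewrite mulrC.
    by move: (phi1 _) (_^*%C) (_^*%C) => *; ring.
  rewrite E1 -(csumZD F1s F2s) -(csumZZ _ (l1_maD F1s F2s)).
  congr csumZ; apply/funext => k1; rewrite subKr; congr (_ * _).
  by rewrite /F1 /F2 /q2; case: ifP => _; rewrite ?addr0 ?add0r.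
exact: dsum_cvg X0 XA gX.
Qed.

Lemma box_le (X Y : int -> R) (A B : R) (N : nat) :
  (forall k, 0 <= X k) -> (forall k, 0 <= Y k) -> l1le X A -> l1le Y B ->
  \sum_(k1 <- win N) \sum_(k2 <- win N) X k1 * Y k2 <= A * B.
Proof.
move=> X0 Y0 XA YB; under eq_bigr do rewrite -mulr_sumr.
rewrite -mulr_suml; apply: ler_pM; rewrite ?sumr_ge0 //.
  by rewrite (le_trans _ (XA _ (uniq_win N))) // ler_sum // => k _; exact: ler_norm.
by rewrite (le_trans _ (YB _ (uniq_win N))) // ler_sum // => k _; exact: ler_norm.
Qed.

Lemma box_cn_le (g : int -> int -> R[i]) (G : int -> int -> R) (N : nat) :
  (forall k1 k2, cn (g k1 k2) <= G k1 k2) ->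
  cn (\sum_(k1 <- win N) \sum_(k2 <- win N) g k1 k2) <= \sum_(k1 <- win N) \sum_(k2 <- win N) G k1 k2.
Proof.
move=> gG; rewrite (le_trans (cn_sum _ _)) // ler_sum // => k1 _.
by rewrite (le_trans (cn_sum _ _)) // ler_sum.
Qed.

End Quadratures.

(** * Functions continuous on a closed interval and differentiable inside *)

Section SmoothOnInterval.
Variable R : realType.
Implicit Types (F G dF dG : R -> R[i]) (L t : R).

Definition c1on L F dF : Prop :=
  ccon L F /\ forall t, 0 < t < L -> is_cderive F t (dF t).

Lemma c1on_eq L F dF dG : (forall t, 0 < t < L -> dF t = dG t) -> c1on L F dF -> c1on L F dG.
Proof. by move=> E [cF dF']; split=> // t tL; apply: cder_eq (dF' t tL) (E t tL). Qed.

Lemma c1on_cst L (z : R[i]) : c1on L (fun=> z) (fun=> 0).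
Proof. by split=> [|t _]; [exact: ccon_cst|exact: cder_cst]. Qed.

Lemma c1onD L F dF G dG : c1on L F dF -> c1on L G dG ->
  c1on L (fun t => F t + G t) (fun t => dF t + dG t).
Proof.
move=> [cF hF] [cG hG]; split=> [|t tL]; first exact: cconD.
by apply: cderD; [exact: hF|exact: hG].
Qed.

Lemma c1onM L F dF G dG : c1on L F dF -> c1on L G dG ->
  c1on L (fun t => F t * G t) (fun t => dF t * G t + F t * dG t).
Proof.
move=> [cF hF] [cG hG]; split=> [|t tL]; first exact: cconM.
by apply: cderM; [exact: hF|exact: hG].
Qed.

Lemma c1onZ L (z : R[i]) F dF : c1on L F dF -> c1on L (fun t => z * F t) (fun t => z * dF t).
Proof.
by move=> [cF hF]; split=> [|t tL]; [exact: cconZ|apply: cderZ; exact: hF].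
Qed.

Lemma c1onB L F dF G dG : c1on L F dF -> c1on L G dG ->
  c1on L (fun t => F t - G t) (fun t => dF t - dG t).
Proof.
move=> [cF hF] [cG hG]; split=> [|t tL]; first exact: cconB.
by apply: cderB; [exact: hF|exact: hG].
Qed.

Lemma c1on_conj L F dF : c1on L F dF -> c1on L (fun t => (F t)^*%C) (fun t => (dF t)^*%C).
Proof.
by move=> [cF hF]; split=> [|t tL]; [exact: ccon_conj|apply: cder_conj; exact: hF].
Qed.

Lemma c1on_sum L (I : Type) (s : seq I) (F dF : I -> R -> R[i]) :
  (forall i, c1on L (F i) (dF i)) ->
  c1on L (fun t => \sum_(i <- s) F i t) (fun t => \sum_(i <- s) dF i t).
Proof.
move=> h; split=> [|t tL]; first by apply: ccon_sum => i; have [] := h i.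
by apply: (@cder_sum R _ s F (fun i => dF i t) t) => i; have [_] := h i; apply.
Qed.

Lemma c1on_Re L F dF : c1on L F dF ->
  c1on L (fun t => (complex.Re (F t))%:C) (fun t => (complex.Re (dF t))%:C).
Proof.
move=> [cF hF]; split=> [t tL e e0|t /hF[hr _]]; last exact: cder_real.
have [d d0 dP] := cF t tL e e0; exists d => // s sL ts; apply: le_trans (dP s sL ts).
by rewrite -(rmorphB (real_complex R)) cn_real -ReN -ReD Re_le_cn.
Qed.

Lemma c1on_Im L F dF : c1on L F dF ->
  c1on L (fun t => (complex.Im (F t))%:C) (fun t => (complex.Im (dF t))%:C).
Proof.
move=> [cF hF]; split=> [t tL e e0|t /hF[_ hi]]; last exact: cder_real.
have [d d0 dP] := cF t tL e e0; exists d => // s sL ts; apply: le_trans (dP s sL ts).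
by rewrite -(rmorphB (real_complex R)) cn_real -ImN -ImD Im_le_cn.
Qed.

Lemma c1on_Iph L c : c1on L (Iph c) (fun t => eit (c * t)).
Proof.
split=> [|t _]; last exact: cder_Iph.
by apply: ccon_derive => t; exact: cder_Iph.
Qed.

Lemma c1on_mvt L F dF K : 0 <= L -> 0 <= K -> c1on L F dF ->
  (forall t, 0 < t < L -> cn (dF t) <= K) -> cn (F L - F 0) <= L * K.
Proof. by move=> L0 K0 [cF hF]; exact: mvt_complex. Qed.

Lemma cn_div2 (z : R[i]) : cn (z / 2) <= cn z.
Proof. by rewrite cnM cn_half; have := cn_ge0 z; lra. Qed.

Lemma cn_i2 (z : R[i]) : cn ('i%C / 2 * z) <= cn z.
Proof. by rewrite !cnM cn_half cn_i mul1r; have := cn_ge0 z; lra. Qed.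

(** Each entry is a fixed linear form in p, q, r, so derivatives and limits of such matrices follow
    from linearity. *)
Lemma skew3_lin (p q r : R[i]) i j : skew3 p q r i j =
  skew3 1 0 0 i j * p + (skew3 0 1 0 i j * q + skew3 0 0 1 i j * r).
Proof.
have [[a0 a1 a2] [b0 b1 b2] [c0 c1 c2]] := skew3E p q r.
have [[d0 d1 d2] [e0 e1 e2] [f0 f1 f2]] := skew3E (1 : R[i]) 0 0.
have [[g0 g1 g2] [h0 h1 h2] [k0 k1 k2]] := skew3E (0 : R[i]) 1 0.
have [[l0 l1 l2] [m0 m1 m2] [n0 n1 n2]] := skew3E (0 : R[i]) 0 1.
by elim/ord3_cases: i; elim/ord3_cases: j;
  rewrite ?a0 ?a1 ?a2 ?b0 ?b1 ?b2 ?c0 ?c1 ?c2 ?d0 ?d1 ?d2 ?e0 ?e1 ?e2 ?f0 ?f1 ?f2 ?g0 ?g1 ?g2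
   ?h0 ?h1 ?h2 ?k0 ?k1 ?k2 ?l0 ?l1 ?l2 ?m0 ?m1 ?m2 ?n0 ?n1 ?n2; ring.
Qed.

Lemma c1on_skew3 L (p q r dp dq dr : R -> R[i]) i j :
  c1on L p dp -> c1on L q dq -> c1on L r dr ->
  c1on L (fun t => skew3 (p t) (q t) (r t) i j) (fun t => skew3 (dp t) (dq t) (dr t) i j).
Proof.
move=> hp hq hr.
under [X in c1on _ X _]eq_fun do rewrite skew3_lin.
under [X in c1on _ _ X]eq_fun do rewrite skew3_lin.
by apply: c1onD; [exact: c1onZ|apply: c1onD; exact: c1onZ].
Qed.

End SmoothOnInterval.

(** * Derivative of the quadratures along the exact solution *)

Section ExactQuadrature.
Variable R : realType.
Implicit Types (u : R -> int -> R[i]) (h s t x L gam rho : R) (k : int).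

Lemma c1on_inter L rho gam u k : seqsol L rho gam u ->
  c1on L (fun s => inter s (u s) k) (fun s => 'i%C / 2 * inter s (tri (@one_mult R) (u s)) k).
Proof. by move=> us; split=> [|t tL]; [exact: ccon_inter us|exact: cder_inter us tL]. Qed.

Lemma c1on_coef L rho gam u k : seqsol L rho gam u ->
  c1on L (fun s => u s k) (fun s => - ('i%C * (ksq R k)%:C * u s k) + 'i%C / 2 * tri (@one_mult R) (u s) k).
Proof. by move=> [_ uc ud]; split=> [|t tL]; [exact: uc|exact: ud]. Qed.

(** The first term differentiates the phase integral, the second the datum at the moving right end,
    in twisted form. *)
Definition dq1 u k s : R[i] :=
  ik R k * (eit (- ksq R k * s) * ((inter s (u s) k + u 0 k) / 2) +
            Iph (- ksq R k) s * ('i%C / 2 * inter s (tri (@one_mult R) (u s)) k / 2)).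

Lemma c1on_q1 L rho gam u k : seqsol L rho gam u -> c1on L (fun s => q1c s (u 0) (u s) k) (dq1 u k).
Proof.
move=> us; have H := c1onM (c1on_Iph L (- ksq R k)) (c1onZ 2^-1 (c1onD (c1on_inter k us) (c1on_cst L (u 0 k)))).
have E : (fun s => q1c s (u 0) (u s) k) = fun s => ik R k * (Iph (- ksq R k) s * (2^-1 * (inter s (u s) k + u 0 k))).
  by apply/funext => s; rewrite /q1c /inter; move: (Iph _ _) (eit _) (ik R k) (u s k) (u 0 k) => *; ring.
rewrite E; apply: c1on_eq (c1onZ (ik R k) H) => t _; rewrite /dq1.
by move: (Iph _ _) (eit _) (ik R k) (inter _ _ _) (inter _ _ _) (u 0 k) => *; ring.
Qed.

Definition dqA u (k1 k2 : int) s : R[i] :=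
  (eit (- ksq R k1 * s) * ((inter s (u s) k1 + u 0 k1) / 2) +
   Iph (- ksq R k1) s * ('i%C / 2 * inter s (tri (@one_mult R) (u s)) k1 / 2)) * ((u s k2 + u 0 k2) / 2)^*%C +
  Iph (- ksq R k1) s * ((inter s (u s) k1 + u 0 k1) / 2) *
   ((- ('i%C * (ksq R k2)%:C * u s k2) + 'i%C / 2 * tri (@one_mult R) (u s) k2) / 2)^*%C.

Lemma c1on_qA L rho gam u k1 k2 : seqsol L rho gam u ->
  c1on L (fun s => qA s (u 0) (u s) k1 k2) (dqA u k1 k2).
Proof.
move=> us.
have H1 := c1onM (c1on_Iph L (- ksq R k1)) (c1onZ 2^-1 (c1onD (c1on_inter k1 us) (c1on_cst L (u 0 k1)))).
have H2 := c1on_conj (c1onZ 2^-1 (c1onD (c1on_coef k2 us) (c1on_cst L (u 0 k2)))).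
have E : (fun s => qA s (u 0) (u s) k1 k2) = fun s =>
    Iph (- ksq R k1) s * (2^-1 * (inter s (u s) k1 + u 0 k1)) * (2^-1 * (u s k2 + u 0 k2))^*%C.
  apply/funext => s; rewrite /qA /inter [2^-1 * (u s k2 + _)]mulrC.
  by move: (Iph _ _) (eit _) (_^*%C) (u s k1) (u 0 k1) => *; ring.
rewrite E; apply: c1on_eq (c1onM H1 H2) => t _; rewrite /dqA addr0 addr0.
rewrite [2^-1 * (u t k2 + _)]mulrC [2^-1 * (- _ + _)]mulrC.
by move: (Iph _ _) (eit _) (_^*%C) (_^*%C) (inter _ _ _) (inter _ _ _) (u 0 k1) => *; ring.
Qed.

Definition dq2 u (k1 k2 : int) s : R[i] :=
  if k2 ^+ 2 <= k1 ^+ 2 then dqA u k1 k2 s else (dqA u k2 k1 s)^*%C.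

Lemma c1on_q2 L rho gam u k1 k2 : seqsol L rho gam u ->
  c1on L (fun s => q2 s (u 0) (u s) k1 k2) (dq2 u k1 k2).
Proof.
move=> us; rewrite /q2 /dq2; case: (k2 ^+ 2 <= k1 ^+ 2); first exact: c1on_qA us.
by apply: c1on_conj; exact: c1on_qA us.
Qed.

Section Errors.
Variables (u : R -> int -> R[i]) (s : R).
Hypothesis s0 : 0 <= s.
Let dd k : R := hw 1 k * cn (inter s (u s) k - u 0 k).
Let P k : R := hw 1 k * mass (u 0) (u s) k.
Let nn k : R := hw 1 k * cn (tri (@one_mult R) (u s) k).

Let undo k : u s k = eit (- ksq R k * s) * inter s (u s) k.
Proof. by rewrite [LHS](inter_inv s) mulNr. Qed.

(** The exact integrand is the phase times the twisted coefficient at time s. Averaging that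
    coefficient with its value at 0 costs its increment; the moving datum contributes s times the
    cubic term. *)
Lemma dq1_err k : cn (dq1 u k s - ik R k * u s k) <= dd k + s * nn k.
Proof.
rewrite /dq1 undo; set e := eit (- _ * _); set c := inter s (u s) k; set I := Iph _ _.
set n := inter s (tri _ _) k.
rewrite (_ : _ - _ = ik R k * (e * ((u 0 k - c) / 2) + I * ('i%C / 2 * n / 2))); last first.
  by move: (ik R k) e c I n (u 0 k) => *; field.
have -> : dd k + s * nn k = hw 1 k * (cn (c - u 0 k) + s * cn n).
  by rewrite /dd /nn /n cn_inter; ring.
rewrite cnM; apply: ler_pM; rewrite ?cn_ge0 ?cn_ik //.
rewrite (le_trans (cnD _ _)) // lerD //.
  by rewrite cnM cn_eit mul1r (le_trans (cn_div2 _)) // cnC.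
rewrite cnM; apply: ler_pM; rewrite ?cn_ge0 //; first exact: cn_Iph.
by rewrite (le_trans (cn_div2 _)) // cn_i2.
Qed.

Let dd_ge k : cn (inter s (u s) k - u 0 k) <= dd k.
Proof. by rewrite /dd ler_peMl ?cn_ge0 // hw_ge1. Qed.
Let P_ge k : mass (u 0) (u s) k <= P k.
Proof. by rewrite /P ler_peMl ?mass_ge0 // hw_ge1. Qed.
Let nn_ge k : cn (tri (@one_mult R) (u s) k) <= nn k.
Proof. by rewrite /nn ler_peMl ?cn_ge0 // hw_ge1. Qed.
Let dd0 k : 0 <= dd k. Proof. exact: le_trans (cn_ge0 _) (dd_ge k). Qed.
Let P0 k : 0 <= P k. Proof. exact: le_trans (mass_ge0 _ _ _) (P_ge k). Qed.
Let nn0 k : 0 <= nn k. Proof. exact: le_trans (cn_ge0 _) (nn_ge k). Qed.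

(** Each factor carries one weight [hw 1], through [dd], [P] or [nn]. The majorant is symmetric, so
    it covers both branches of [dq2]. *)
Definition qerr (k1 k2 : int) : R := dd k1 * P k2 + P k1 * dd k2 + s * (P k1 * P k2) +
  s * (nn k1 * P k2 + P k1 * nn k2).

(** The average at k2 is not twisted, so both its distance to u and its time derivative contain
    k2^2. As |k2| <= |k1|, this is at most one derivative on each factor; the case distinction in Q2
    secures exactly this. *)
Lemma dqA_err k1 k2 : ksq R k2 <= ksq R k1 ->
  cn (dqA u k1 k2 s - u s k1 * (u s k2)^*%C) <= qerr k1 k2.
Proof.
move=> k21; rewrite /dqA.
set e := eit (- _ * _); set c := inter s (u s) k1; set I := Iph _ _.
set n := inter s (tri _ _) k1; set av := ((u s k2 + u 0 k2) / 2)^*%C.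
set da := (- _ + _) / 2.
have u1 : u s k1 = e * c by exact: undo.
rewrite u1.
have aE : av = (u s k2)^*%C + ((u 0 k2 - u s k2) / 2)^*%C.
  by rewrite /av -conjD; congr (_^*%C); move: (u s k2) (u 0 k2) => *; field.
rewrite (_ : _ - _ = e * ((u 0 k1 - c) / 2) * av + (e * c) * ((u 0 k2 - u s k2) / 2)^*%C +
   (I * ('i%C / 2 * n / 2) * av + I * ((c + u 0 k1) / 2) * da^*%C)); last first.
  clear u1; rewrite aE; move: e c I n (da^*%C) ((u s k2)^*%C) (((u 0 k2 - u s k2) / 2)^*%C) (u 0 k1) => *.
  by field.
have avP : cn av <= P k2 by apply: le_trans (P_ge k2); exact: cn_avg_mass.
have I_ : cn I <= s by exact: cn_Iph.
(* One factor |k2| is traded for |k1|; this is where the ordering of the frequencies is used. *)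
have kk : ksq R k2 <= hw 1 k1 * hw 1 k2.
  rewrite (_ : ksq R k2 = `|k2%:~R| * `|k2%:~R|); last by rewrite -expr2 real_normK ?num_real.
  apply: ler_pM => //; last exact: abs_le_hw1.
  apply: le_trans (abs_le_hw1 _ k1).
  by rewrite -ler_sqr ?nnegrE // !real_normK ?num_real.
have k0 := ksq_ge0 R k2.
have c1 : cn (e * c) <= mass (u 0) (u s) k1 by rewrite -u1 /mass lerDr cn_ge0.
have T1 : cn (e * ((u 0 k1 - c) / 2) * av) <= dd k1 * P k2.
  rewrite cnM; apply: ler_pM; rewrite ?cn_ge0 //.
  by rewrite cnM cn_eit mul1r (le_trans (cn_div2 _)) // cnC dd_ge.
have T2 : cn ((e * c) * ((u 0 k2 - u s k2) / 2)^*%C) <= P k1 * dd k2 + s * (P k1 * P k2) / 2.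
  have h1 : cn ((u 0 k2 - u s k2) / 2)^*%C <= (dd k2 + s * ksq R k2 * cn (u 0 k2)) / 2.
    rewrite cn_conj cnM cn_half ler_wpM2r ?invr_ge0 //.
    have -> : u 0 k2 - u s k2 = - (eit (- ksq R k2 * s) * (inter s (u s) k2 - u 0 k2)) + - ((eit (- ksq R k2 * s) - 1) * u 0 k2).
      by rewrite {1}undo; move: (eit _) (inter _ _ _) (u 0 k2) => *; ring.
    rewrite (le_trans (cnD _ _)) // !cnN !cnM cn_eit mul1r lerD //.
    rewrite ler_wpM2r ?cn_ge0 // (le_trans (cn_eit_sub1 _)) // mulNr normrN (ger0_norm (mulr_ge0 k0 s0)).
    by rewrite mulrC.
  have := ler_pM (cn_ge0 _) (cn_ge0 _) c1 h1; rewrite -cnM => /le_trans; apply.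
  have m0 := mass_ge0 (u 0) (u s) k1.
  have p1 : mass (u 0) (u s) k1 * dd k2 <= P k1 * dd k2 by rewrite ler_wpM2r // P_ge.
  have p2 : mass (u 0) (u s) k1 * (ksq R k2 * cn (u 0 k2)) <= P k1 * P k2.
    rewrite /P mulrCA (le_trans (ler_wpM2r _ kk)) ?mulr_ge0 ?cn_ge0 //.
    rewrite [leRHS](_ : _ = hw 1 k1 * hw 1 k2 * (mass (u 0) (u s) k1 * mass (u 0) (u s) k2)); last by ring.
    by rewrite ler_wpM2l ?mulr_ge0 ?hw_ge0 // ler_wpM2l // /mass lerDl cn_ge0.
  have p3 := ler_wpM2l s0 p2; have := mulr_ge0 (P0 k1) (dd0 k2).
  rewrite (_ : mass (u 0) (u s) k1 * ((dd k2 + s * ksq R k2 * cn (u 0 k2)) / 2) =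
    (mass (u 0) (u s) k1 * dd k2 + s * (mass (u 0) (u s) k1 * (ksq R k2 * cn (u 0 k2)))) / 2); last by ring.
  by lra.
have T3 : cn (I * ('i%C / 2 * n / 2) * av) <= s * (nn k1 * P k2).
  rewrite mulrA cnM; apply: ler_pM; rewrite ?cn_ge0 //.
  rewrite cnM; apply: ler_pM; rewrite ?cn_ge0 //.
  by rewrite (le_trans (cn_div2 _)) // (le_trans (cn_i2 _)) // /n cn_inter nn_ge.
have T4 : cn (I * ((c + u 0 k1) / 2) * da^*%C) <= s * (P k1 * P k2) / 2 + s * (P k1 * nn k2).
  have h1 : cn da^*%C <= (ksq R k2 * cn (u s k2) + nn k2) / 2.
    rewrite cn_conj cnM cn_half ler_wpM2r ?invr_ge0 // (le_trans (cnD _ _)) // lerD //.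
      by rewrite cnN !cnM cn_i mul1r cn_pos.
    by rewrite (le_trans (cn_i2 _)) // nn_ge.
  have m0 := mass_ge0 (u 0) (u s) k1.
  have h2 : cn ((c + u 0 k1) / 2) <= mass (u 0) (u s) k1 by exact: cn_avg_eit.
  have h3 := ler_pM (mulr_ge0 (cn_ge0 _) (cn_ge0 _)) (cn_ge0 _) (ler_pM (cn_ge0 _) (cn_ge0 _) I_ h2) h1.
  rewrite cnM [cn (I * _)]cnM; apply: le_trans h3 _.
  have p1 : mass (u 0) (u s) k1 * nn k2 <= P k1 * nn k2 by rewrite ler_wpM2r // P_ge.
  have p2 : mass (u 0) (u s) k1 * (ksq R k2 * cn (u s k2)) <= P k1 * P k2.
    rewrite /P mulrCA (le_trans (ler_wpM2r _ kk)) ?mulr_ge0 ?cn_ge0 //.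
    rewrite [leRHS](_ : _ = hw 1 k1 * hw 1 k2 * (mass (u 0) (u s) k1 * mass (u 0) (u s) k2)); last by ring.
    by rewrite ler_wpM2l ?mulr_ge0 ?hw_ge0 // ler_wpM2l // /mass lerDr cn_ge0.
  have p3 := ler_wpM2l s0 p2; have p4 := ler_wpM2l s0 p1; have := mulr_ge0 s0 (mulr_ge0 (P0 k1) (nn0 k2)).
  rewrite (_ : s * mass (u 0) (u s) k1 * _ = (s * (mass (u 0) (u s) k1 * (ksq R k2 * cn (u s k2))) + s * (mass (u 0) (u s) k1 * nn k2)) / 2); last by ring.
  move: p3 p4; clear; move: (s * (_ * (ksq R k2 * _))) (s * (_ * nn k2)) (s * (P k1 * nn k2)) (s * (P k1 * P k2)) => * /=; lra.
rewrite (le_trans (cnD _ _)) // (le_trans (lerD (cnD _ _) (cnD _ _))) // /qerr.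
rewrite mulrDr; move: T1 T2 T3 T4; clear; move: (cn _) (cn _) (cn _) (cn _).
by move: (dd k1 * _) (_ * dd k2) (s * (P k1 * _)) (s * (nn k1 * _)) (s * (_ * nn k2)) => *; lra.
Qed.

Lemma qerrC k1 k2 : qerr k1 k2 = qerr k2 k1.
Proof. by rewrite /qerr; move: (dd k1) (dd k2) (P k1) (P k2) (nn k1) (nn k2) => *; ring. Qed.

Lemma dq2_err k1 k2 : cn (dq2 u k1 k2 s - u s k1 * (u s k2)^*%C) <= qerr k1 k2.
Proof.
have int_ksq (i j : int) : i ^+ 2 <= j ^+ 2 -> ksq R i <= ksq R j.
  by rewrite /ksq -!rmorphXn /= ler_int.
rewrite /dq2; case: ifP => [/int_ksq|/negbT]; first exact: dqA_err.
rewrite -ltNge => /ltW/int_ksq /dqA_err; rewrite qerrC.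
by rewrite -cn_conj conjD conjN conjM conjcK [u s k1 * _]mulrC.
Qed.

Lemma qerr_sum (D M C : R) N : l1le dd D -> l1le P M -> l1le nn C ->
  \sum_(k1 <- win N) \sum_(k2 <- win N) qerr k1 k2 <= 2 * (D * M) + s * (M * M) + 2 * s * (C * M).
Proof.
move=> hD hM hC; rewrite /qerr.
have b1 := box_le N dd0 P0 hD hM; have b2 := box_le N P0 dd0 hM hD.
have b3 := box_le N P0 P0 hM hM; have b4 := box_le N nn0 P0 hC hM; have b5 := box_le N P0 nn0 hM hC.
have -> : \sum_(k1 <- win N) \sum_(k2 <- win N) (dd k1 * P k2 + P k1 * dd k2 + s * (P k1 * P k2) +
    s * (nn k1 * P k2 + P k1 * nn k2)) =
    \sum_(k1 <- win N) \sum_(k2 <- win N) dd k1 * P k2 + \sum_(k1 <- win N) \sum_(k2 <- win N) P k1 * dd k2 +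
    s * (\sum_(k1 <- win N) \sum_(k2 <- win N) P k1 * P k2) +
    s * (\sum_(k1 <- win N) \sum_(k2 <- win N) nn k1 * P k2 + \sum_(k1 <- win N) \sum_(k2 <- win N) P k1 * nn k2).
  rewrite -!big_split !mulr_sumr -!big_split; apply: eq_bigr => k1 _.
  by rewrite -!big_split !mulr_sumr -!big_split.
rewrite (_ : 2 * (D * M) + _ + _ = (D * M + M * D) + s * (M * M) + s * (C * M + M * C)); last by ring.
by rewrite !lerD // ler_wpM2l // lerD.
Qed.

End Errors.
End ExactQuadrature.

(** * Real and complex 3 x 3 matrices: bounds and limits *)

Section FrameMatrices.
Variable R : realType.
Implicit Types (A B : 'M[R]_3).

Definition cmat A : 'M[R[i]]_3 := map_mx (fun a : R => a%:C) A.

Lemma cmatE A i j : cmat A i j = (A i j)%:C.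
Proof. by rewrite mxE. Qed.

Lemma cmatM A B : cmat (A *m B) = cmat A *m cmat B.
Proof. exact: (map_mxM (real_complex R)). Qed.

Lemma cmat_skew3 (p q r : R) : cmat (skew3 p q r) = skew3 p%:C q%:C r%:C.
Proof.
apply/matrixP => i j; rewrite cmatE.
have [[a0 a1 a2] [b0 b1 b2] [c0 c1 c2]] := skew3E p q r.
have [[d0 d1 d2] [e0 e1 e2] [f0 f1 f2]] := skew3E (p%:C : R[i]) q%:C r%:C.
by elim/ord3_cases: i; elim/ord3_cases: j;
  rewrite ?a0 ?a1 ?a2 ?b0 ?b1 ?b2 ?c0 ?c1 ?c2 ?d0 ?d1 ?d2 ?e0 ?e1 ?e2 ?f0 ?f1 ?f2
    ?(rmorph0 (real_complex R)) // (rmorphN (real_complex R)).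
Qed.

Lemma cn_mulmx (A B : 'M[R[i]]_3) i j (a b : R) : 0 <= a -> mn A <= a -> mn B <= b ->
  cn ((A *m B) i j) <= a * b.
Proof.
move=> a0 Aa Bb; rewrite (le_trans (cn_le_mn _ _ _)) // (le_trans (mnM _ _)) //.
by apply: ler_pM; rewrite ?mn_ge0.
Qed.

Lemma mn_skew3_ReIm (z w : R[i]) : mn (skew3 (complex.Im z)%:C (complex.Re z)%:C w) <= 4 * cn z + 2 * cn w.
Proof.
by rewrite mn_skew3 !cn_real; have := Re_le_cn z; have := Im_le_cn z; lra.
Qed.

Lemma ccvg_ReC (z : nat -> R[i]) l : ccvg z l -> ccvg (fun n => (complex.Re (z n))%:C) (complex.Re l)%:C.
Proof.
apply: ccvg_le => n; rewrite -(rmorphB (real_complex R)) cn_real -ReN -ReD; exact: Re_le_cn.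
Qed.

Lemma ccvg_ImC (z : nat -> R[i]) l : ccvg z l -> ccvg (fun n => (complex.Im (z n))%:C) (complex.Im l)%:C.
Proof.
apply: ccvg_le => n; rewrite -(rmorphB (real_complex R)) cn_real -ImN -ImD; exact: Im_le_cn.
Qed.

Lemma ccvg_skew3 (p q r : nat -> R[i]) (p' q' r' : R[i]) i j : ccvg p p' -> ccvg q q' -> ccvg r r' ->
  ccvg (fun n => skew3 (p n) (q n) (r n) i j) (skew3 p' q' r' i j).
Proof.
move=> hp hq hr; under eq_fun do rewrite skew3_lin.
by rewrite (skew3_lin p' q' r'); apply: ccvgD; [exact: ccvgZ|apply: ccvgD; exact: ccvgZ].
Qed.

Lemma ccvg_mulmx (A : nat -> 'M[R[i]]_3) (A' B : 'M[R[i]]_3) i j :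
  (forall i j, ccvg (fun n => A n i j) (A' i j)) -> ccvg (fun n => (A n *m B) i j) ((A' *m B) i j).
Proof.
move=> h; under eq_fun do rewrite mxE sum_ord3.
rewrite mxE sum_ord3.
by apply: ccvgD; first apply: ccvgD; apply: ccvgM => //; exact: ccvg_cst.
Qed.

End FrameMatrices.

(** * Truncation of the quadratures and comparison with the frame matrix *)

Section LocalFrameError.
Variable R : realType.
Implicit Types (u : R -> int -> R[i]) (a c v w : int -> R[i]) (h s t x gam rho : R) (k : int).

(** The truncation index depends on the ball only, not on its element. It can thus be fixed before
    the mean value theorem is applied in s. Cauchy-Schwarz against the square-summable weight of
    order -gam gives the uniform tail. *)
Lemma weighted_tail gam rho (e : R) : 2^-1 < gam -> 0 < e -> exists n, forall N, (n <= N)%N ->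
  forall a c x C, hs (1 + gam) (ma a) rho -> (forall k, cn (c k) <= hw 1 k * cn (a k)) ->
  l1le (ma c) C -> cn (fS c x - \sum_(k <- win N) echar k x * c k) <= e.
Proof.
move=> g2 e0; have [K K0 [_ hK]] := hw_summable g2.
have r1 : 0 < `|rho| + 1 by rewrite ltr_wpDl.
have d0 : 0 < e / (`|rho| + 1) by rewrite divr_gt0.
have hK1 : l1le (fun k => hw (- gam) k ^+ 2) (K ^+ 2).
  by move=> s us; under eq_bigr do rewrite ger0_norm ?sqr_ge0 //; exact: hK.
have [n nP] := l1_tail hK1 (exprn_gt0 2 d0).
exists n => N nN a c x C [r0 har] ca cC.
under eq_bigr do rewrite mulrC.
apply: (@csumZ_tail _ _ C) => [|s us sN]; first by rewrite ma_echar.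
apply: (@le_trans _ _ (\sum_(k <- s) hw (- gam) k * (hw (1 + gam) k * cn (a k)))).
  apply: ler_sum => k _; rewrite cnM cn_echar mulr1 mulrA -hwD.
  by rewrite (_ : - gam + (1 + gam) = 1) //; ring.
apply: (@le_trans _ _ (e / (`|rho| + 1) * rho)).
  apply: CauchySchwarz_seq => //; first exact: ltW.
    by have := nP N nN s us sN; under eq_bigr do rewrite ger0_norm ?sqr_ge0 //.
  exact: har.
rewrite mulrAC ler_pdivrMr // ler_wpM2l ?(ltW e0) // (le_trans (ler_norm _)) // lerDl.
exact: ler01.
Qed.

Lemma seqsol_le L L' rho gam u : 0 <= L -> L' <= L -> seqsol L rho gam u -> seqsol L' rho gam u.
Proof.
move=> L0 LL us; have := @seqsol_shift R L rho gam u 0 L' (lexx _).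
by rewrite add0r => /(_ LL us); under eq_fun do rewrite add0r.
Qed.

(** Truncated quadratures can be differentiated in s as finite sums; [Qsum_cvg] removes the
    truncation at the end. *)
Definition q1sum x u N s : R[i] := \sum_(k <- win N) echar k x * q1c s (u 0) (u s) k.
Definition q2sum x u N s : R[i] :=
  \sum_(k1 <- win N) \sum_(k2 <- win N) echar (k1 - k2) x * q2 s (u 0) (u s) k1 k2.

Definition Qsum x u N s : 'M[R[i]]_3 :=
  skew3 (complex.Im (q1sum x u N s))%:C (complex.Re (q1sum x u N s))%:C (2^-1 * q2sum x u N s).

Definition dq1sum x u N s : R[i] := \sum_(k <- win N) echar k x * dq1 u k s.
Definition dq2sum x u N s : R[i] :=
  \sum_(k1 <- win N) \sum_(k2 <- win N) echar (k1 - k2) x * dq2 u k1 k2 s.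

Definition dQsum x u N s : 'M[R[i]]_3 :=
  skew3 (complex.Im (dq1sum x u N s))%:C (complex.Re (dq1sum x u N s))%:C (2^-1 * dq2sum x u N s).

Lemma c1on_Qsum x u L rho gam N i j : seqsol L rho gam u ->
  c1on L (fun s => Qsum x u N s i j) (fun s => dQsum x u N s i j).
Proof.
move=> us; have c1 : c1on L (q1sum x u N) (dq1sum x u N).
  by apply: c1on_sum => k; apply: c1onZ; exact: c1on_q1 us.
apply: c1on_skew3; [exact: c1on_Im|exact: c1on_Re|].
apply: c1onZ; apply: c1on_sum => k1; apply: c1on_sum => k2; apply: c1onZ.
exact: c1on_q2 us.
Qed.

Lemma Qsum0 x u N : Qsum x u N 0 = 0.
Proof.
have -> : Qsum x u N 0 = skew3 0%:C 0%:C (2^-1 * 0).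
  rewrite /Qsum /q1sum /q2sum big1 => [|k _]; last by rewrite /q1c Iph_s0 mulr0 mul0r mulr0.
  rewrite big1 // => k1 _; rewrite big1 // => k2 _; rewrite /q2 /qA !Iph_s0 !mul0r.
  by rewrite (conjc0 R) if_same mulr0.
rewrite mulr0; have [[a0 a1 a2] [b0 b1 b2] [c0 c1 c2]] := skew3E (0%:C : R[i]) 0%:C 0.
by apply/matrixP => i j; rewrite [RHS]mxE; elim/ord3_cases: i; elim/ord3_cases: j;
  rewrite ?a0 ?a1 ?a2 ?b0 ?b1 ?b2 ?c0 ?c1 ?c2 ?oppr0.
Qed.

Lemma q1c_l1 h v w A B : 0 <= h -> l1le (fun k => hw 1 k * ma v k) A ->
  l1le (fun k => hw 1 k * ma w k) B -> l1le (ma (q1c h v w)) (h * (A + B)).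
Proof.
move=> h0 vA wB.
apply: (@l1le_ma _ _ (fun k => h * (hw 1 k * mass v w k))) => [k|]; first exact: cn_q1c.
apply: (l1leZ h0 (x := fun k => hw 1 k * mass v w k)) => [k|].
  by rewrite normrM (ger0_norm h0).
apply: (l1leD _ vA wB) => k; rewrite ger0_norm ?mulr_ge0 ?hw_ge0 ?mass_ge0 //.
by rewrite mulrDr lerD // ler_norm.
Qed.

Lemma Qsum_cvg x u h A B i j : 0 < h -> l1le (fun k => hw 1 k * ma (u 0) k) A ->
  l1le (fun k => hw 1 k * ma (u h) k) B ->
  ccvg (fun N => Qsum x u N h i j) (Qlowreg h (fS (u 0)) (fS (u h)) x i j).
Proof.
move=> h0 uA uB; have h0' := ltW h0.
have m1 := q1c_l1 h0' uA uB.
have c1 : ccvg (fun N => q1sum x u N h) (Q1 h (fS (u 0)) (fS (u h)) x).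
  rewrite (Q1E h0 uA uB); have := fS_cvg x m1; congr ccvg.
  by apply/funext => N; apply: eq_bigr => k _; rewrite mulrC.
apply: ccvg_skew3; [exact: ccvg_ImC|exact: ccvg_ReC|].
by apply: ccvgZ; apply: Q2_cvg (l1_weight uA) (l1_weight uB).
Qed.

Lemma conj_sum_win N (f : int -> R[i]) : (\sum_(k <- win N) f k)^*%C = \sum_(k <- win N) (f k)^*%C.
Proof. exact: (rmorph_sum (@conjc R)). Qed.

Lemma sqmodulus_sum N x (v : int -> R[i]) :
  let S := \sum_(k <- win N) echar k x * v k in
  S * S^*%C = \sum_(k1 <- win N) \sum_(k2 <- win N) echar (k1 - k2) x * (v k1 * (v k2)^*%C).
Proof.
move=> S; rewrite /S conj_sum_win mulr_suml; apply: eq_bigr => k1 _.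
rewrite mulr_sumr; apply: eq_bigr => k2 _.
by rewrite conjM echarD echarN; move: (echar _ _) (_^*%C) (_^*%C) => *; ring.
Qed.

Lemma ReIm_skew3B (z z' w w' : R[i]) :
  skew3 (complex.Im z)%:C (complex.Re z)%:C w - skew3 (complex.Im z')%:C (complex.Re z')%:C w' =
  skew3 (complex.Im (z - z'))%:C (complex.Re (z - z'))%:C (w - w').
Proof.
by rewrite skew3B -!(rmorphB (real_complex R)) !ReD !ImD !ReN !ImN.
Qed.

Lemma real_half (r : R) : (r / 2)%:C = 2^-1 * r%:C :> R[i].
Proof.
by rewrite mulrC (rmorphM (real_complex R)) (fmorphV (real_complex R)) (rmorph_nat (real_complex R)).
Qed.

(* The derivative of the truncated quadrature is the matrix of the frame system,
   up to the truncation error e and a quadrature error of order s. *)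
Lemma dQsum_err x u s N (A e D M C : R) (ux : R[i]) : 0 <= s -> 0 <= A -> 0 <= e ->
  cn (fS (u s) x) <= A ->
  cn (ux - \sum_(k <- win N) echar k x * (ik R k * u s k)) <= e ->
  cn (fS (u s) x - \sum_(k <- win N) echar k x * u s k) <= e ->
  cn (\sum_(k <- win N) echar k x * u s k) <= A ->
  l1le (fun k => hw 1 k * cn (inter s (u s) k - u 0 k)) D ->
  l1le (fun k => hw 1 k * mass (u 0) (u s) k) M ->
  l1le (fun k => hw 1 k * cn (tri (@one_mult R) (u s) k)) C ->
  mn (skew3 (complex.Im ux)%:C (complex.Re ux)%:C (sqmodulus (fS (u s) x) / 2)%:C - dQsum x u N s) <=
  4 * (e + (D + s * C)) + (2 * A * e + (2 * (D * M) + s * (M * M) + 2 * s * (C * M))).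
Proof.
move=> s0 A0 e0 UA uxe Ue SA hD hM hC; rewrite /dQsum ReIm_skew3B.
rewrite (le_trans (mn_skew3_ReIm _ _)) // lerD //.
  rewrite ler_wpM2l //; set S := \sum_(k <- win N) echar k x * (ik R k * u s k) in uxe.
  rewrite (_ : ux - _ = (ux - S) + (S - dq1sum x u N s)); last by rewrite addrA subrK.
  rewrite (le_trans (cnD _ _)) // lerD // cnC /dq1sum /S -sumrB (le_trans (cn_sum _ _)) //.
  have sC : l1le (fun k => hw 1 k * cn (inter s (u s) k - u 0 k) + s * (hw 1 k * cn (tri (@one_mult R) (u s) k))) (D + s * C).
    apply: (l1leD _ hD (l1leZ s0 _ hC)) => k; first exact: ler_normD.
    by rewrite normrM (ger0_norm s0).
  rewrite (le_trans _ (sC _ (uniq_win N))) // ler_sum // => k _.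
  rewrite -mulrBr cnM cn_echar mul1r (le_trans _ (ler_norm _)) //; exact: dq1_err.
set S := \sum_(k <- win N) echar k x * u s k in Ue SA.
have E : (sqmodulus (fS (u s) x) / 2)%:C - 2^-1 * dq2sum x u N s =
   2^-1 * ((fS (u s) x * (fS (u s) x)^*%C - S * S^*%C) + (S * S^*%C - dq2sum x u N s)).
  rewrite mulconj real_half; move: (sqmodulus _)%:C (S * _) (dq2sum _ _ _ _) => *; ring.
rewrite E cnM cn_half mulrA divff ?mul1r ?pnatr_eq0 // (le_trans (cnD _ _)) // lerD //.
  set V := fS (u s) x in UA Ue *.
  rewrite (_ : V * V^*%C - S * S^*%C = (V - S) * V^*%C + S * (V - S)^*%C); last first.
    by rewrite conjD conjN; move: (V^*%C) (S^*%C) => *; ring.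
  rewrite (le_trans (cnD _ _)) // [cn (S * _)]cnM cnM !cn_conj.
  have := ler_pM (cn_ge0 _) (cn_ge0 _) Ue UA; have := ler_pM (cn_ge0 _) (cn_ge0 _) SA Ue.
  by move: (cn _ * cn _) (cn _ * cn _) => a b; rewrite (mulrC e A) -mulrA; move: (A * e) => c; lra.
rewrite sqmodulus_sum /dq2sum cnC -sumrB; under eq_bigr do rewrite -sumrB.
rewrite (le_trans (box_cn_le (G := qerr u s) N _)) //; last exact: qerr_sum.
by move=> k1 k2; rewrite -mulrBr cnM cn_echar mul1r dq2_err.
Qed.

End LocalFrameError.

(** * One step of the frame scheme with exact data *)

Section FrameStep.
Variable R : realType.
Implicit Types (u : R -> int -> R[i]) (v w : int -> R[i]) (h s t x L gam rho : R) (k : int).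

Lemma mn_Qlowreg h v w A B x : 0 < h -> l1le (fun k => hw 1 k * ma v k) A ->
  l1le (fun k => hw 1 k * ma w k) B ->
  mn (Qlowreg h (fS v) (fS w) x) <= h * (4 * (A + B) + (A + B) * (A + B)).
Proof.
move=> h0 vA wB; have h0' := ltW h0.
rewrite (le_trans (mn_skew3_ReIm _ _)) // mulrDr lerD //.
  rewrite (Q1E h0 vA wB) mulrCA ler_wpM2l //; apply: fS_le; exact: q1c_l1.
rewrite cnM cn_half mulrA divff ?mul1r ?pnatr_eq0 //.
apply: (ler_cn_lim (Q2_cvg x h0' (l1_weight vA) (l1_weight wB))) => N.
have mAB := l1_mass (l1_weight vA) (l1_weight wB).
rewrite (le_trans (box_cn_le (G := fun k1 k2 => h * (mass v w k1 * mass v w k2)) N _)) //.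
  by move=> k1 k2; rewrite cnM cn_echar mul1r cn_q2.
under eq_bigr do rewrite -mulr_sumr.
by rewrite -mulr_sumr ler_wpM2l //; apply: box_le => // k; exact: mass_ge0.
Qed.

Lemma c1on_mulmx L (P dP : R -> 'M[R[i]]_3) (B : 'M[R[i]]_3) i j :
  (forall l, c1on L (fun s => P s i l) (fun s => dP s i l)) ->
  c1on L (fun s => (P s *m B) i j) (fun s => (dP s *m B) i j).
Proof.
move=> h; under [X in c1on _ X _]eq_fun do rewrite mxE.
under [X in c1on _ _ X]eq_fun do rewrite mxE.
apply: c1on_sum => l.
under [X in c1on _ X _]eq_fun do rewrite mulrC.
under [X in c1on _ _ X]eq_fun do rewrite mulrC.
exact: c1onZ.
Qed.

(** The mean value theorem compares y with the Euler-like step (1 + Q) y 0, entry by entry and for a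
    truncated Q; both agree at s = 0. The constant does not depend on x or on the truncation, so the
    truncation can be removed afterwards. *)
Lemma frame_local_error gam rho : 2^-1 < gam <= 1 -> 0 < rho -> exists2 K : R, 0 < K &
  forall h u x (y : R -> 'M[R]_3), 0 < h <= 1 -> seqsol h rho gam u ->
    (forall i j, ccon h (fun s => (y s i j)%:C)) ->
    (forall s i j, 0 < s < h ->
       is_cderive (fun r => (y r i j)%:C) s ((frame_matrix (fS (u s)) x *m y s) i j)%:C) ->
    (forall s i j, 0 <= s <= h -> `|y s i j| <= 1) ->
    mn (cmat (y h) - (1 + Qlowreg h (fS (u 0)) (fS (u h)) x) *m cmat (y 0)) <= K * h ^+ 2.
Proof.
move=> g01 rho0; have /andP[g2 g1] := g01.
have [K K0 KP] := hs_flow g01 (ltW rho0).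
have [K1 K10 K1P] := hsg_l1 g2.
set A := K1 * rho; have A0 : 0 <= A by rewrite mulr_ge0 ?ltW.
set KA := 4 * A + A * A; have KA0 : 0 <= KA by apply: addr_ge0; apply: mulr_ge0.
set C := K1 * K; have C0 : 0 <= C by rewrite mulr_ge0 ?ltW.
set M := A + A; have M0 : 0 <= M by rewrite addr_ge0.
set B := 4 * (1 + (C + C)) + (2 * A + (2 * (C * M) + M * M + 2 * (C * M))).
have B0 : 0 <= B by do ?[by [] | exact: ler01 | apply: addr_ge0 | apply: mulr_ge0].
set E := KA * (9 * (KA * 9)) + B * 9.
have E0 : 0 <= E by do ?[by [] | exact: ler01 | apply: addr_ge0 | apply: mulr_ge0].
exists (9 * E + 1) => [|h u x y /andP[h0 h1] us cy dy yb]; first by rewrite ltr_wpDl ?mulr_ge0.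
have h0' := ltW h0; have [ub _ _] := us.
have l1u s : 0 <= s <= h -> l1le (fun k => hw 1 k * ma (u s) k) A.
  by move=> /ub; exact: K1P.
pose ux s := fS (fun k => ik R k * u s k) x.
pose AC s := skew3 (complex.Im (ux s))%:C (complex.Re (ux s))%:C (sqmodulus (fS (u s) x) / 2)%:C.
have FE s : 0 <= s <= h -> cmat (frame_matrix (fS (u s)) x) = AC s.
  by move=> sh; rewrite cmat_skew3 /AC (dx_fS (l1_weight (l1u s sh))).
have uxA s : 0 <= s <= h -> cn (ux s) <= A by move=> sh; exact: fS_le x (l1_ik (l1u s sh)).
have UA s : 0 <= s <= h -> cn (fS (u s) x) <= A by move=> sh; exact: fS_le x (l1_weight (l1u s sh)).
have ACb s : 0 <= s <= h -> mn (AC s) <= KA.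
  move=> sh; rewrite (le_trans (mn_skew3_ReIm _ _)) // lerD ?ler_wpM2l ?uxA //.
  rewrite real_half cnM cn_half mulrA divff ?mul1r ?pnatr_eq0 // sqmodulusE cn_real.
  by rewrite ger0_norm ?sqr_ge0 // expr2; apply: ler_pM; rewrite ?cn_ge0 ?UA.
have yb' s : 0 <= s <= h -> mn (cmat (y s)) <= 9.
  by move=> sh; rewrite -(mulr1 9); apply: mn_le_bound => i j; rewrite cmatE cn_real yb.
have dyE s i j : 0 < s < h -> ((frame_matrix (fS (u s)) x *m y s) i j)%:C = (AC s *m cmat (y s)) i j.
  by move=> /andP[s0 sh]; rewrite -cmatE cmatM FE // (ltW s0) (ltW sh).
have win_sub s t : 0 <= s <= h -> 0 < t < s -> 0 < t < h.
  by move=> /andP[_ sh] /andP[t0 ts]; rewrite t0 (lt_le_trans ts).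
have lt_le t : 0 < t < h -> 0 <= t <= h by move=> /andP[t0 th]; rewrite !ltW.
have ydiff s : 0 <= s <= h -> mn (cmat (y s) - cmat (y 0)) <= 9 * (s * (KA * 9)).
  move=> sh; have /andP[s0 sh'] := sh; apply: mn_le_bound => i j.
  rewrite mx_subE !cmatE.
  apply: (@c1on_mvt _ s (fun r => (y r i j)%:C) (fun r => (AC r *m cmat (y r)) i j)) => //.
  - by rewrite mulr_ge0.
  - split=> [|t ts]; first exact: ccon_le sh' (cy i j).
    by have th := win_sub s t sh ts; rewrite -dyE //; exact: dy.
  - move=> t ts; have /lt_le th := win_sub s t sh ts.
    by apply: cn_mulmx => //; [exact: ACb|exact: yb'].
have zero_h : 0 <= (0 : R) <= h by rewrite lexx h0'.
(* The tolerance is h itself, so truncation costs no more than the quadrature error in the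
   derivative. *)
have [n nP] := weighted_tail rho g2 h0.
have main N i j : (n <= N)%N ->
    cn ((cmat (y h) - (1 + Qsum x u N h) *m cmat (y 0)) i j) <= h * (E * h).
  move=> nN.
  (* Its derivative is A(s) (y s - y 0) + (A(s) - Q'(s)) y 0: the first part is O(s) because y is
     Lipschitz in time, the second O(h) by [dQsum_err]. *)
  pose G s := (y s i j)%:C - ((1 + Qsum x u N s) *m cmat (y 0)) i j.
  pose dG s := (AC s *m cmat (y s)) i j - ((0 + dQsum x u N s) *m cmat (y 0)) i j.
  have cG : c1on h G dG.
    apply: c1onB; first by split=> [|t th]; [exact: cy|rewrite -dyE //; exact: dy].
    apply: (@c1on_mulmx _ (fun s => 1 + Qsum x u N s) (fun s => 0 + dQsum x u N s)) => l.
    under [X in c1on _ X _]eq_fun do rewrite mxE.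
    under [X in c1on _ _ X]eq_fun do rewrite mxE.
    apply: c1onD; last exact: c1on_Qsum us.
    have -> : (fun _ : R => (0 : 'M[R[i]]_3) i l) = fun=> 0 by apply/funext => ?; rewrite mxE.
    exact: c1on_cst.
  have G0 : G 0 = 0 by rewrite /G Qsum0 addr0 mul1mx cmatE subrr.
  have -> : (cmat (y h) - (1 + Qsum x u N h) *m cmat (y 0)) i j = G h - G 0.
    by rewrite G0 subr0 mx_subE cmatE.
  apply: (c1on_mvt h0' _ cG) => [|s sh]; first by rewrite mulr_ge0.
  have sh' := lt_le s sh; have /andP[s0 sh1] := sh'.
  have -> : dG s = (AC s *m (cmat (y s) - cmat (y 0))) i j + ((AC s - dQsum x u N s) *m cmat (y 0)) i j.
    by rewrite /dG add0r mulmxBr mulmxBl !mx_subE addrA subrK.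
  have us_s : seqsol s rho gam u by apply: seqsol_le us.
  have [tK iK] := KP s u s0 us_s.
  have hD := K1P _ _ iK; have hC := K1P _ _ (tK s (introT andP (conj s0 (lexx s)))).
  have hM : l1le (fun k => hw 1 k * mass (u 0) (u s) k) M.
    apply: (l1leD _ (l1u 0 zero_h) (l1u s sh')) => k; rewrite ger0_norm ?mulr_ge0 ?hw_ge0 ?mass_ge0 //.
    by rewrite mulrDr lerD // ler_norm.
  have hus := ub s sh'.
  have t1 : cn (ux s - \sum_(k <- win N) echar k x * (ik R k * u s k)) <= h.
    apply: (nP N nN (u s) _ x A hus _ (l1_ik (l1u s sh'))) => k.
    by rewrite cnM ler_wpM2r ?cn_ge0 // cn_ik.
  have t2 : cn (fS (u s) x - \sum_(k <- win N) echar k x * u s k) <= h.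
    apply: (nP N nN (u s) _ x A hus _ (l1_weight (l1u s sh'))) => k.
    by rewrite ler_peMl ?cn_ge0 ?hw_ge1.
  have SA : cn (\sum_(k <- win N) echar k x * u s k) <= A.
    rewrite (le_trans (cn_sum _ _)) // (le_trans _ (l1_weight (l1u s sh') (uniq_win N))) //.
    by apply: ler_sum => k _; rewrite ma_norm cnM cn_echar mul1r.
  have := dQsum_err s0 A0 h0' (UA s sh') t1 t2 SA hD hM hC.
  rewrite -/(ux s) -/(AC s) => HQ.
  have {}HQ : mn (AC s - dQsum x u N s) <= B * h.
    apply: le_trans HQ _.
    have CM0 : 0 <= C * M by rewrite mulr_ge0.
    have MM0 : 0 <= M * M by rewrite mulr_ge0.
    rewrite (_ : K1 * (s * K) = s * C); last by rewrite mulrCA.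
    rewrite (_ : B * h = 4 * (h + (h * C + h * C)) + (2 * A * h + (2 * (h * (C * M)) + h * (M * M) + 2 * (h * (C * M))))); last by rewrite /B; ring.
    have p1 := ler_wpM2r C0 sh1; have p2 := ler_wpM2r CM0 sh1; have p3 := ler_wpM2r MM0 sh1.
    rewrite -[s * C * M]mulrA -[2 * s * _]mulrA.
    move: p1 p2 p3; clear; move: (s * C) (h * C) (s * (C * M)) (h * (C * M)) (s * (M * M)) (h * (M * M)) (2 * A * h) => *; lra.
  rewrite (le_trans (cnD _ _)) // /E mulrDl lerD //.
    apply: le_trans (cn_mulmx i j KA0 (ACb s sh') (ydiff s sh')) _.
    rewrite -[leRHS]mulrA ler_wpM2l // -mulrA ler_wpM2l // mulrC ler_wpM2l ?mulr_ge0 //.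
  rewrite mulrAC; apply: cn_mulmx HQ (yb' 0 zero_h); rewrite mulr_ge0 //.
apply: (@le_trans _ _ (9 * (h * (E * h)))); last first.
  by rewrite (_ : (9 * E + 1) * h ^+ 2 = 9 * (h * (E * h)) + h * h) ?lerDl ?mulr_ge0 //; ring.
apply: mn_le_bound => i j.
apply: (@ler_cn_lim _ (fun p => (cmat (y h) - (1 + Qsum x u (n + p) h) *m cmat (y 0)) i j)); last first.
  by move=> p; apply: main; rewrite leq_addr.
have hh : 0 <= h <= h by rewrite h0' lexx.
apply: (ccvg_shift (u := fun N => (cmat (y h) - (1 + Qsum x u N h) *m cmat (y 0)) i j)).
under eq_fun do rewrite mx_subE.
rewrite mx_subE; apply: ccvgB; first exact: ccvg_cst.
apply: ccvg_mulmx => i' j'.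
rewrite [X in ccvg _ X](mxE _ _ i' j'); under [X in ccvg X _]eq_fun do rewrite mxE.
apply: ccvgD; first exact: ccvg_cst.
exact: Qsum_cvg h0 (l1u 0 zero_h) (l1u h hh).
Qed.

End FrameStep.

(** * Integrals of pointwise majorants over the torus *)

Section Integrals.
Variable R : realType.

(* No measurability is needed: the integral of a nonnegative function is a
   supremum over the simple functions below it. *)
Lemma ge0_integral_mono d (T : measurableType d) (mu : {measure set T -> \bar R}) (D : set T)
    (f g : T -> \bar R) :
  (forall x, D x -> (0 <= f x)%E) -> (forall x, D x -> (f x <= g x)%E) ->
  (\int[mu]_(x in D) f x <= \int[mu]_(x in D) g x)%E.
Proof.
move=> f0 fg; rewrite !ge0_integralE //; last by move=> x Dx; rewrite (le_trans (f0 x Dx)) ?fg.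
apply: ge_ereal_sup => _ [s /= sf <-]; apply: ereal_sup_ubound; exists s => //= x.
rewrite (le_trans (sf x)) // /patch; case: ifPn => // xD; apply: fg; exact: set_mem.
Qed.

Lemma integral_torus_le (F g : R -> R) (c : R) :
  (forall x, 0 <= F x) -> (forall x, F x <= g x) -> continuous g ->
  (\int[@lebesgue_measure R]_(x in @torus R) g x)%R <= c ->
  (\int[@lebesgue_measure R]_(x in @torus R) (F x)%:E <= c%:E)%E.
Proof.
move=> F0 Fg cg gc; have ig := torus_integrable cg.
apply: (@le_trans _ _ (\int[@lebesgue_measure R]_(x in @torus R) (g x)%:E)%E).
  by apply: ge0_integral_mono => x _; rewrite lee_fin.
have fin : (\int[@lebesgue_measure R]_(x in @torus R) (g x)%:E)%E \is a fin_num.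
  by apply: integrable_fin_num ig; exact: measurable_torus.
rewrite -(fineK fin) lee_fin.
exact: gc.
Qed.

Lemma Rintegral_torus_affine (I : Type) (s : seq I) (a b : R) (f : I -> R -> R) (c : R) :
  0 <= b -> (forall i, continuous (f i)) ->
  (forall i, (\int[@lebesgue_measure R]_(x in @torus R) f i x)%R <= c) ->
  (\int[@lebesgue_measure R]_(x in @torus R) (a + b * \sum_(i <- s) f i x))%R <= 2 * pi * a + b * ((size s)%:R * c) /\
  continuous (fun x => a + b * \sum_(i <- s) f i x).
Proof.
move=> b0 cf fc.
have cS (r : seq I) : continuous (fun x => \sum_(i <- r) f i x).
  elim: r => [|i r IH].
    have -> : (fun x => \sum_(i <- [::]) f i x) = cst 0 by apply/funext => x; rewrite big_nil.
    by move=> x; exact: cst_continuous.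
  have -> : (fun x => \sum_(j <- i :: r) f j x) = (fun x => f i x + \sum_(j <- r) f j x).
    by apply/funext => x; rewrite big_cons.
  by move=> x; apply: cvgD; [exact: cf|exact: IH].
have cbS : continuous (fun x => b * \sum_(i <- s) f i x) by exact: cont_scale.
have ca : continuous (cst a : R -> R) by move=> x; exact: cst_continuous.
split; last by move=> x; apply: cvgD; [exact: ca|exact: cbS].
rewrite RintegralD; [|exact: measurable_torus|exact: torus_integrable|exact: torus_integrable].
rewrite RintegralZl; [|exact: measurable_torus|exact: torus_integrable].
apply: lerD.
  by rewrite Rintegral_cst; [rewrite mulrC; have -> := congr1 fine (@mu_torus R)|exact: measurable_torus].
rewrite ler_wpM2l //; elim: s {cbS} => [|i s IH].
  under eq_Rintegral do rewrite big_nil.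
  by rewrite Rintegral_cst ?mul0r //; exact: measurable_torus.
under eq_Rintegral do rewrite big_cons.
rewrite RintegralD; [|exact: measurable_torus|exact: torus_integrable|exact: torus_integrable].
by rewrite /= -natr1 mulrDl mul1r addrC lerD.
Qed.

End Integrals.

(** * Conservation for the exact frame, and perturbation of the quadratures *)

Section FrameStability.
Variable R : realType.
Implicit Types (v w : int -> R[i]) (h x L : R) (k : int).

(** Each column of y solves the same skew-symmetric system, so its Euclidean norm is constant. The
    rows of a square matrix are orthonormal exactly when its columns are, so this norm is 1. *)
Lemma frame_entries_le1 L (y : R -> 'M[R]_3) (p q r : R -> R) :
  (forall i j, ccon L (fun s => (y s i j)%:C)) ->
  (forall s i j, 0 < s < L ->
     is_cderive (fun t => (y t i j)%:C) s ((skew3 (p s) (q s) (r s) *m y s) i j)%:C) ->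
  orthonormal_rows (y 0) -> forall s i j, 0 <= s <= L -> `|y s i j| <= 1.
Proof.
move=> cy dy /mulmx1C o s i j /andP[s0 sL].
pose F t : R[i] := \sum_(l <- enum 'I_3) (y t l j)%:C * (y t l j)%:C.
pose dF t : R[i] := \sum_(l <- enum 'I_3) (((skew3 (p t) (q t) (r t) *m y t) l j)%:C * (y t l j)%:C +
  (y t l j)%:C * ((skew3 (p t) (q t) (r t) *m y t) l j)%:C).
have cF : c1on s F dF.
  apply: c1on_sum => l; have c1 : c1on s (fun t => (y t l j)%:C) (fun t => ((skew3 (p t) (q t) (r t) *m y t) l j)%:C).
    split=> [|t /andP[t0 ts]]; first exact: ccon_le sL (cy l j).
    by apply: dy; rewrite t0 (lt_le_trans ts).
  exact: c1onM.
have FE t : F t = (\sum_l y t l j ^+ 2)%:C.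
  rewrite /F big_enum (rmorph_sum (real_complex R)); apply: eq_bigr => l _.
  by rewrite expr2 (rmorphM (real_complex R)).
have dF0 t : dF t = 0.
  have -> : dF t = (2 * \sum_l (skew3 (p t) (q t) (r t) *m y t) l j * y t l j)%:C.
    rewrite /dF big_enum mulr_sumr (rmorph_sum (real_complex R)); apply: eq_bigr => l _.
    by rewrite -!(rmorphM (real_complex R)) -(rmorphD (real_complex R)); congr (_%:C); ring.
  rewrite (_ : \sum_l _ = 0) ?mulr0 //.
  have [[a0 a1 a2] [b0 b1 b2] [c0 c1 c2]] := skew3E (p t) (q t) (r t).
  rewrite sum_ord3 !mxE !sum_ord3 a0 a1 a2 b0 b1 b2 c0 c1 c2; ring.
have H : cn (F s - F 0) <= 0.
  by rewrite -[leRHS](mulr0 s); apply: (c1on_mvt s0 _ cF) => // t _; rewrite dF0 cn0.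
have /cn0_eq0/eqP : cn (F s - F 0) = 0 by apply/le_anti; rewrite H cn_ge0.
rewrite subr_eq0 !FE => /eqP/(congr1 (@complex.Re R)) /= E.
have e0 : \sum_l y 0 l j ^+ 2 = 1.
  have := congr1 (fun A : 'M[R]_3 => A j j) o; rewrite !mxE eqxx mulr1n => <-.
  by apply: eq_bigr => l _; rewrite mxE expr2.
have : y s i j ^+ 2 <= 1.
  by rewrite -e0 -E (bigD1 i) //= lerDl sumr_ge0 // => l _; rewrite sqr_ge0.
by move=> y1; rewrite -ler_sqr ?nnegrE ?ler01 // real_normK ?num_real // expr1n.
Qed.

(** The contribution of Q1 is left as a function of x, because its sharp bound exists only in L^2;
    that of Q2 is estimated uniformly in x. *)
Lemma Qlowreg_diff h v w v' w' x (A B A' B' d z : R) : 0 < h ->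
  l1le (fun k => hw 1 k * ma v k) A -> l1le (fun k => hw 1 k * ma w k) B ->
  l1le (fun k => hw 1 k * ma v' k) A' -> l1le (fun k => hw 1 k * ma w' k) B' ->
  l1le (mass (fun k => v k - v' k) (fun k => w k - w' k)) d -> l1le (mass v' w') z ->
  mn (Qlowreg h (fS v) (fS w) x - Qlowreg h (fS v') (fS w') x) <=
  4 * cn (fS (q1c h (fun k => v k - v' k) (fun k => w k - w' k)) x) + h * (2 * (d * (z + d))).
Proof.
move=> h0 vA wB vA' wB' hd hz; have h0' := ltW h0.
rewrite /Qlowreg ReIm_skew3B (le_trans (mn_skew3_ReIm _ _)) // lerD //.
  rewrite (Q1E h0 vA wB) (Q1E h0 vA' wB') -(fSB _ (q1c_l1 h0' vA wB) (q1c_l1 h0' vA' wB')).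
  rewrite ler_wpM2l //; rewrite le_eqVlt; apply/orP; left; apply/eqP/(congr1 (fun c => cn (fS c x))); apply/funext => k; exact: q1cB.
rewrite -mulrBr cnM cn_half mulrA divff ?mul1r ?pnatr_eq0 //.
have c1 := Q2_cvg x h0' (l1_weight vA) (l1_weight wB).
have c2 := Q2_cvg x h0' (l1_weight vA') (l1_weight wB').
apply: (ler_cn_lim (ccvgB c1 c2)) => N.
set D := mass (fun k => v k - v' k) (fun k => w k - w' k) in hd *.
(* A majorant of both pairs of data that is computed from the primed pair and the difference only,
   so that no weighted norm of the other pair enters the bound. *)
pose Z k := mass v' w' k + D k.
have D0 k : 0 <= D k by exact: mass_ge0.
have hZ : l1le Z (z + d).
  by apply: (l1leD _ hz hd) => k; rewrite ler_normD.
have Z0 k : 0 <= Z k by rewrite addr_ge0 ?mass_ge0.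
have mZ k : mass v w k <= Z k.
  rewrite /Z /D /mass addrACA lerD //.
    by rewrite (le_trans _ (cnD _ _)) // addrC subrK.
  by rewrite (le_trans _ (cnD _ _)) // addrC subrK.
have mZ' k : mass v' w' k <= Z k by rewrite lerDl.
rewrite -sumrB; under eq_bigr do rewrite -sumrB.
rewrite (le_trans (box_cn_le (G := fun k1 k2 => h * (D k1 * Z k2 + Z k1 * D k2)) N _)) //.
  move=> k1 k2; rewrite -mulrBr cnM cn_echar mul1r.
  exact: cn_q2_diff.
under eq_bigr do rewrite -mulr_sumr big_split.
rewrite -mulr_sumr big_split ler_wpM2l //.
rewrite (_ : 2 * (d * (z + d)) = d * (z + d) + (z + d) * d); last by ring.
by apply: lerD; exact: box_le.
Qed.

Lemma gronwall (a : R) (e b : nat -> R) (m : nat) : 0 <= a -> (forall n, 0 <= b n) ->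
  (forall n, (n < m)%N -> e n.+1 <= (1 + a) * e n + b n) -> e 0%N = 0 ->
  forall n, (n <= m)%N -> e n <= (1 + a) ^+ n * \sum_(i < n) b i.
Proof.
move=> a0 b0 step e0; elim=> [|n IH] nm; first by rewrite e0 big_ord0 mulr0.
have a1 : 1 <= 1 + a by rewrite lerDl.
rewrite (le_trans (step n nm)) // big_ord_recr /= mulrDr lerD //.
  by rewrite exprS -mulrA ler_wpM2l ?(le_trans ler01) // IH // ltnW.
by rewrite ler_peMl // exprn_ege1.
Qed.

End FrameStability.

(** * Pointwise propagation of the frame error *)

Section GlobalFrameError.
Variable R : realType.
Implicit Types (u : R -> int -> R[i]) (h x T gam rho : R) (k : int) (y : R -> R -> 'M[R]_3).

(** With E = exp Q - 1 - Q, the error is (1 + Q + E) (X - Y) + E Y + (Q - Q') Y - (Y' - (1 + Q') Y):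
    propagated error, exponential remainder, effect of the numerical data, local error with exact
    data. *)
Lemma cmexp_step (Q Q' X Y Y' : 'M[R[i]]_3) : mn Q <= 1 ->
  mn (cmexp Q *m X - Y') <= (1 + mn Q + 9 * mn Q ^+ 2) * mn (X - Y) +
    (9 * mn Q ^+ 2 * mn Y + mn (Q - Q') * mn Y + mn (Y' - (1 + Q') *m Y)).
Proof.
move=> Q1; set E := cmexp Q - 1 - Q; have hE : mn E <= 9 * mn Q ^+ 2 by exact: mn_cmexp.
have -> : cmexp Q = 1 + Q + E by rewrite /E [RHS]addrC addrA addrAC !subrK.
clearbody E.
have -> : (1 + Q + E) *m X - Y' = ((X - Y) + Q *m (X - Y) + E *m (X - Y)) +
    (E *m Y + (Q - Q') *m Y - (Y' - (1 + Q') *m Y)).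
  rewrite !(mulmxBl, mulmxBr) !mulmxDl !mul1mx.
  move: (Q *m X) (Q *m Y) (E *m X) (E *m Y) (Q' *m Y) => a b c d e.
  apply/matrixP => i j; rewrite !mxE.
  by move: (X i j) (Y i j) (Y' i j) (a i j) (b i j) (c i j) (d i j) (e i j) => *; ring.
have EX : mn (E *m (X - Y)) <= 9 * mn Q ^+ 2 * mn (X - Y).
  by rewrite (le_trans (mnM _ _)) // ler_wpM2r ?mn_ge0.
have EY : mn (E *m Y) <= 9 * mn Q ^+ 2 * mn Y.
  by rewrite (le_trans (mnM _ _)) // ler_wpM2r ?mn_ge0.
apply: le_trans (mnD _ _) _; apply: lerD.
  rewrite [leRHS]mulrDl mulrDl mul1r; apply: le_trans (mnD _ _) (lerD _ EX).
  exact: le_trans (mnD _ _) (lerD (lexx _) (mnM _ _)).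
apply: le_trans (mnB _ _) (lerD _ (lexx _)).
exact: le_trans (mnD _ _) (lerD EY (mnM _ _)).
Qed.

(* The pointwise error is driven by the terms fS (c i), which are only of order
   h^{1 + gam} in L^2. *)
Lemma frame_pointwise_error gam rho T : 2^-1 < gam <= 1 -> 0 < rho -> 0 < T ->
  exists h0 C1 G b : R, [/\ 0 < h0 <= 1, 0 < C1, 0 <= G /\ 0 <= b & forall u y,
    seqsol T rho gam u ->
    (forall x i j, ccon T (fun t => (y t x i j)%:C)) ->
    (forall x t i j, 0 < t < T ->
       is_cderive (fun r => (y r x i j)%:C) t ((frame_matrix (fS (u t)) x *m y t x) i j)%:C) ->
    (forall x, orthonormal_rows (y 0 x)) ->
    forall h m, 0 < h < h0 -> m%:R * h <= T -> exists c : nat -> int -> R[i],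
      (forall i, (i < m)%N -> (exists B, l1le (ma (c i)) B) /\
         l2le (ma (c i)) (h * (2 * (C1 * h `^ gam)))) /\
      forall x, mn (frame_num h (fS (u 0)) (y 0) m x - cmat (y (m%:R * h) x)) <=
        G * (T * h `^ gam * b + 36 * \sum_(i < m) cn (fS (c i) x))].
Proof.
move=> g01 rho0 T0; have /andP[g2 g1] := g01.
have [h1 [C1 [/andP[h10 h11] C10 nls]]] := nls_converges g01 rho0 T0.
have [K K0 KP] := frame_local_error g01 rho0.
have [K0' K00 K0P] := @hs1_l1 R.
have [K1 K10 K1P] := hsg_l1 g2.
set A := K1 * rho; have A0 : 0 <= A by rewrite mulr_ge0 ?ltW.
set d1 := 2 * K0'; have d10 : 0 < d1 by rewrite mulr_gt0.
set a1 := 4 * (A + A) + (A + A) * (A + A).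
have a10 : 0 <= a1 by do ?[by [] | exact: ler01 | exact: ltW | apply: addr_ge0 | apply: mulr_ge0].
set b1 := 2 * (d1 * C1 * (A + A + d1)).
have b10 : 0 <= b1 by do ?[by [] | exact: ler01 | exact: ltW | apply: addr_ge0 | apply: mulr_ge0].
(* [h * q] bounds the numerical quadrature matrix: [a1] comes from exact data, [8 * (d1 * C1)] from
   four times the uniform bound on the Q1 perturbation, [b1] from the Q2 perturbation. *)
set q := a1 + 8 * (d1 * C1) + b1.
have q0 : 0 < q by rewrite ltr_wpDr // ltr_wpDl // !mulr_gt0.
(* The exact frame has norm at most 9. Hence 81 = 9 * 9 for the exponential remainder, [9 * b1] for
   the change of Q2, and 36 = 4 * 9 in front of the Q1 terms; [K] is the local error. *)
set b := 81 * q ^+ 2 + 9 * b1 + K.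
have b0 : 0 <= b by do ?[by [] | exact: ltW | exact: sqr_ge0 | apply: addr_ge0 | apply: mulr_ge0].
(* h < 1 / q gives norm at most 1, as [cmexp_step] demands. The amplification per step is then at
   most 1 + h q + 9 h q, and its m-th power is at most the exponential of 10 q T. *)
exists (Num.min h1 q^-1), C1, (expR (10 * q * T)), b; split=> //.
  by rewrite lt_min h10 invr_gt0 q0 ge_min h11.
move=> u y us cy dy oy h m /andP[h0]; rewrite lt_min => /andP[hh1 hq] mT.
have h0' := ltW h0; have hle1 : h <= 1 by rewrite (le_trans (ltW hh1)).
have hq1 : h * q <= 1 by rewrite -ler_pdivlMr // div1r ltW.
set hg := h `^ gam; have hg0 : 0 <= hg by exact: powR_ge0.
have hg1 : hg <= 1.
  have : h `^ gam <= 1 `^ gam by apply: ge0_ler_powR; rewrite ?nnegrE //; lra.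
  by rewrite powR1.
have hhg : h <= hg by apply: ger1_powR => //; rewrite h0 hle1.
pose V i := u (i%:R * h).
pose N i := fourier (nls_num h (fS (u 0)) i).
have iT i : (i <= m)%N -> i%:R * h <= T.
  by move=> im; apply: le_trans mT; rewrite ler_wpM2r // ler_nat.
have facts i : (i <= m)%N -> [/\ nls_num h (fS (u 0)) i = fS (N i),
    exists B, hs (1 + gam) (ma (N i)) B & hs 1 (ma (fun k => N i k - V i k)) (C1 * hg)].
  move=> im; have [_ [a [B [e1 e2 e3]]]] := nls u us h i (introT andP (conj h0 hh1)) (iT i im).
  have -> : N i = a.
    by apply/funext => k; rewrite /N e1; exact: fourier_fS (l1_weight (K1P _ _ e2)).
  by split=> //; exists B.
have Chg : C1 * hg <= 1 by have [] := nls u us h 0%N (introT andP (conj h0 hh1)) (iT 0%N (leq0n _)).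
have Vh i : (i <= m)%N -> hs (1 + gam) (ma (V i)) rho.
  by move=> im; have [ub _ _] := us; apply: ub; rewrite mulr_ge0 ?iT.
pose c i := q1c h (fun k => N i k - V i k) (fun k => N i.+1 k - V i.+1 k).
have cl2 i : (i < m)%N -> l2le (ma (c i)) (h * (2 * (C1 * hg))).
  move=> im; have [_ _ e1] := facts i (ltnW im); have [_ _ e2] := facts i.+1 im.
  rewrite mulr_natl mulr2n.
  apply: (l2leZ h0' (x := fun k => hw 1 k * (cn (N i k - V i k) + cn (N i.+1 k - V i.+1 k)))) => [k|].
    by rewrite ma_norm (le_trans (cn_q1c _ _ _ h0')) // ler_wpM2l // ler_norm.
  by apply: (l2leD _ e1 e2) => k; rewrite mulrDr ler_normD.
(* The step-dependent H^{1 + gam} radii of the numerical solution enter here, but the resulting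
   bound is existential: only summability is retained. *)
have cl1 i : (i < m)%N -> exists B, l1le (ma (c i)) B.
  move=> im; have [_ [B1 e1] _] := facts i (ltnW im); have [_ [B2 e2] _] := facts i.+1 im.
  have vi := Vh i (ltnW im); have vi1 := Vh i.+1 im.
  exists (h * (K1 * (B1 + rho) + K1 * (B2 + rho))); apply: q1c_l1 => //; apply: K1P; exact: hs_maB.
exists c; split=> [i im|x]; first by split; [exact: cl1|exact: cl2].
set f := fun i => cn (fS (c i) x).
pose E i := mn (frame_num h (fS (u 0)) (y 0) i x - cmat (y (i%:R * h) x)).
have E0 : E 0%N = 0 by rewrite /E /= mul0r -/(cmat _) subrr /mn !big1 // => i _; rewrite big1 // => j _; rewrite mxE cn0.
have ybound t i j : 0 <= t <= T -> `|y t x i j| <= 1.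
  apply: (frame_entries_le1 (cy x) _ (oy x)) => s i' j' sT; exact: dy.
have step i : (i < m)%N -> E i.+1 <= (1 + 10 * q * h) * E i + (h * hg * b + 36 * f i).
  move=> im.
  have [n1 [B1 e1] d1e] := facts i (ltnW im); have [n2 [B2 e2] d2e] := facts i.+1 im.
  have vi := K1P _ _ (Vh i (ltnW im)); have vi1 := K1P _ _ (Vh i.+1 im).
  have ni := K1P _ _ e1; have ni1 := K1P _ _ e2.
  set Qe := Qlowreg h (fS (V i)) (fS (V i.+1)) x.
  set Qn := Qlowreg h (nls_num h (fS (u 0)) i) (nls_num h (fS (u 0)) i.+1) x.
  have md := l1_mass (K0P _ _ d1e) (K0P _ _ d2e).
  rewrite -mulrDr (_ : C1 * hg + C1 * hg = 2 * (C1 * hg)) in md; last by ring.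
  rewrite (_ : K0' * _ = d1 * (C1 * hg)) in md; last by rewrite /d1; ring.
  have mz := l1_mass (l1_weight vi) (l1_weight vi1).
  have bQe : mn Qe <= h * a1 by exact: mn_Qlowreg.
  have bd : mn (Qn - Qe) <= 4 * f i + h * hg * b1.
    rewrite /Qn n1 n2 (le_trans (Qlowreg_diff x h0 ni ni1 vi vi1 md mz)) // lerD //.
    rewrite -[leRHS]mulrA ler_wpM2l // /b1.
    rewrite (_ : hg * _ = 2 * (d1 * (C1 * hg) * (A + A + d1))); last by ring.
    rewrite ler_wpM2l // ler_wpM2l ?(mulr_ge0 (ltW d10) (mulr_ge0 (ltW C10) hg0)) // lerD2l.
    by rewrite ler_piMr // ltW.
  (* Smoothing gives sqrt h * h^gam, which is at most h since gam > 1/2 and h <= 1. A weaker power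
     of h would spoil the 1 + O(h) amplification. *)
  have bf : f i <= h * (2 * (d1 * C1)).
    have l1c : l1le (ma (c i)) (2 * Num.sqrt h * (d1 * (C1 * hg))).
      apply: (l1leZ _ _ md) => [|k]; first by rewrite mulr_ge0 // sqrtr_ge0.
      by rewrite ma_norm ger0_norm ?mass_ge0 //; exact: cn_q1c_smooth.
    rewrite (le_trans (fS_le x l1c)) //.
    rewrite (_ : 2 * _ * _ = Num.sqrt h * hg * (2 * (d1 * C1))); last by ring.
    rewrite ler_wpM2r ?(mulr_ge0 _ (mulr_ge0 (ltW d10) (ltW C10))) // -powR12_sqrt // -powRD; last by rewrite (gt_eqF h0) implybT.
    by rewrite -[leRHS]powRr1 //; apply: ger_powR; [rewrite h0 hle1|lra].
  have bQn : mn Qn <= h * q.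
    rewrite -(subrK Qe Qn) (le_trans (mnD _ _)) // (le_trans (lerD bd bQe)) //.
    have := ler_wpM2r b10 (ler_wpM2l h0' hg1); rewrite mulr1 /q => hb.
    by rewrite !mulrDr; lra.
  have bY : mn (cmat (y (i%:R * h) x)) <= 9.
    rewrite -[leRHS]mulr1; apply: mn_le_bound => i' j'; rewrite cmatE cn_real ybound //.
    by rewrite mulr_ge0 // iT // ltnW.
  have loc : mn (cmat (y (i.+1%:R * h) x) - (1 + Qe) *m cmat (y (i%:R * h) x)) <= K * h ^+ 2.
    have it : i%:R * h + h = i.+1%:R * h by rewrite -natr1 mulrDl mul1r.
    have i0 : 0 <= i%:R * h by rewrite mulr_ge0.
    have iL : i%:R * h + h <= T by rewrite it iT.
    have h01 : 0 < h <= 1 by rewrite h0.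
    have := KP h (fun t => u (i%:R * h + t)) x (fun t => y (i%:R * h + t) x) h01 (seqsol_shift i0 iL us).
    rewrite !addr0 it; apply=> [i' j'|s i' j' /andP[s0 sh]|s i' j' /andP[s0 sh]].
    - exact: (ccon_shift (f := fun t => (y t x i' j')%:C) i0 iL).
    - apply: (@cder_shift _ (fun t => (y t x i' j')%:C)); apply: dy.
      by rewrite ltr_wpDl //= (lt_le_trans _ iL) // ltrD2l.
    - by apply: ybound; rewrite addr_ge0 //= (le_trans _ iL) // lerD2l.
  have q1 : mn Qn <= 1 by exact: le_trans hq1.
  have := @cmexp_step Qn Qe (frame_num h (fS (u 0)) (y 0) i x) (cmat (y (i%:R * h) x)) (cmat (y (i.+1%:R * h) x)) q1.
  move=> /le_trans; apply.
  have r0 := mn_ge0 Qn; have E0' : 0 <= E i by exact: mn_ge0.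
  have r2 : mn Qn ^+ 2 <= h * q by rewrite expr2 (le_trans (ler_wpM2l r0 q1)) // mulr1.
  apply: lerD; first rewrite ler_wpM2r //.
    rewrite (_ : 10 * q * h = h * q + 9 * (h * q)); last by ring.
    by rewrite -addrA lerD2l lerD // ler_wpM2l.
  have r3 : mn Qn ^+ 2 <= h * hg * q ^+ 2.
    rewrite (le_trans (_ : _ <= (h * q) ^+ 2)) ?lerXn2r ?nnegrE ?mulr_ge0 ?(ltW q0) //.
    by rewrite exprMn ler_wpM2r ?sqr_ge0 // expr2 ler_wpM2l.
  have p1 : 9 * mn Qn ^+ 2 * mn (cmat (y (i%:R * h) x)) <= 9 * (h * hg * q ^+ 2) * 9.
    by apply: ler_pM; rewrite ?mulr_ge0 ?sqr_ge0 ?mn_ge0 // ler_wpM2l.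
  have p2 : mn (Qn - Qe) * mn (cmat (y (i%:R * h) x)) <= (4 * f i + h * hg * b1) * 9.
    by apply: ler_pM; rewrite ?mn_ge0.
  have p3 : K * h ^+ 2 <= K * (h * hg) by rewrite ler_wpM2l ?(ltW K0) // expr2 ler_wpM2l.
  rewrite (_ : h * hg * b + _ = 9 * (h * hg * q ^+ 2) * 9 + (4 * f i + h * hg * b1) * 9 + K * (h * hg)); last by rewrite /b; ring.
  by rewrite lerD // ?lerD // (le_trans loc).
have b'0 i : 0 <= h * hg * b + 36 * f i by rewrite addr_ge0 ?mulr_ge0 ?cn_ge0.
have qh0 : 0 <= 10 * q * h by rewrite !mulr_ge0 // ltW.
have := gronwall qh0 b'0 step E0 (leqnn m); rewrite -/(E m) => /le_trans; apply.
apply: ler_pM; rewrite ?exprn_ge0 ?sumr_ge0 //; first by rewrite addr_ge0.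
  rewrite (le_trans (_ : _ <= expR (10 * q * h) ^+ m)) //.
    by rewrite lerXn2r ?nnegrE ?expR_ge0 ?addr_ge0 // expR_ge1Dx.
  by rewrite -expRM_natl ler_expR mulrCA ler_wpM2l // mulr_ge0 // ltW.
rewrite big_split /=; apply: lerD; last by rewrite mulr_sumr.
by rewrite sumr_const card_ord -mulr_natl !mulrA !ler_wpM2r.
Qed.

End GlobalFrameError.

(** * The L^2 error of the frame *)

Section GlobalL2Error.
Variable R : realType.
Implicit Types (u : R -> int -> R[i]) (h x T gam rho : R) (k : int) (y : R -> R -> 'M[R]_3).

(** Cauchy-Schwarz against the constant 1. The factor m is harmless: the m squares integrate to
    O(h^{2 + 2 gam}) each, and m * h <= T. *)
Lemma sqr_sum_le (m : nat) (f : 'I_m -> R) : (forall i, 0 <= f i) ->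
  (\sum_i f i) ^+ 2 <= m%:R * \sum_i f i ^+ 2.
Proof.
move=> f0; have S0 : 0 <= \sum_i f i ^+ 2 by apply: sumr_ge0 => i _; exact: sqr_ge0.
have := @CauchySchwarz_seq _ _ (index_enum 'I_m) f (fun=> 1) (Num.sqrt (\sum_i f i ^+ 2)) (Num.sqrt m%:R)
  (sqrtr_ge0 _) (sqrtr_ge0 _).
rewrite !sqr_sqrtr // lexx; under [X in _ -> X <= _ -> _]eq_bigr do rewrite expr1n.
rewrite sumr_const card_ord lexx => /(_ isT isT).
under eq_bigr do rewrite mulr1.
move=> H; rewrite -(sqr_sqrtr (ler0n R m)) mulrC -[X in X * _](sqr_sqrtr S0) -exprMn.
by rewrite lerXn2r ?nnegrE ?mulr_ge0 ?sqrtr_ge0 // sumr_ge0.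
Qed.

Lemma row_sqmodulus_le (D : 'M[R[i]]_3) i : \sum_j sqmodulus (D i j) <= mn D ^+ 2.
Proof.
have s0 j : 0 <= cn (D i j) by exact: cn_ge0.
apply: (@le_trans _ _ ((\sum_j cn (D i j)) ^+ 2)).
  under eq_bigr do rewrite sqmodulusE.
  rewrite !sum_ord3; have := s0 0; have := s0 1; have := s0 2.
  by move: (cn (D i 0)) (cn (D i 1)) (cn (D i 2)); clear; move=> *; nra.
have S0 : 0 <= \sum_j cn (D i j) by apply: sumr_ge0 => j _.
rewrite lerXn2r ?nnegrE ?mn_ge0 // /mn [leRHS](bigD1 i) //= lerDl.
by apply: sumr_ge0 => l _; apply: sumr_ge0 => j _; exact: cn_ge0.
Qed.

(** The squared pointwise bound is majorized by a constant plus a multiple of the sum of |fS (c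
    i)|^2. This majorant is continuous in x and its integral is computed term by term with [fS_L2],
    so the integral of the error itself is only compared. *)
Lemma frame_L2_error gam rho T : 2^-1 < gam <= 1 -> 0 < rho -> 0 < T ->
  exists h0 C : R, [/\ 0 < h0, 0 < C & forall u y,
    seqsol T rho gam u ->
    (forall x i j, ccon T (fun t => (y t x i j)%:C)) ->
    (forall x t i j, 0 < t < T ->
       is_cderive (fun r => (y r x i j)%:C) t ((frame_matrix (fS (u t)) x *m y t x) i j)%:C) ->
    (forall x, orthonormal_rows (y 0 x)) ->
    forall h m, 0 < h < h0 -> m%:R * h <= T ->
      (\int[@lebesgue_measure R]_(x in @torus R)
        (mn (frame_num h (fS (u 0)) (y 0) m x - cmat (y (m%:R * h) x)) ^+ 2)%:E <=
        ((C * h `^ gam) ^+ 2)%:E)%E].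
Proof.
move=> g01 rho0 T0.
have [h0 [C1 [G [b [/andP[h00 h01] C10 [G0 b0] H]]]]] := frame_pointwise_error g01 rho0 T0.
set X := 2 * pi * (2 * (G * (T * b)) ^+ 2) + 2 * (G * 36) ^+ 2 * (T ^+ 2 * (2 * pi * (2 * C1) ^+ 2)).
have P0 : 0 < 2 * pi :> R by exact: pi2_gt0.
have X0 : 0 <= X.
  by apply: addr_ge0; do ?[by [] | exact: sqr_ge0 | exact: ltW | apply: mulr_ge0].
(* [X] bounds the squared error in units of h^{2 gam}; taking 1 + X avoids a square root, since X <=
   (1 + X)^2, and is positive. *)
exists h0, (1 + X); split=> //; first by rewrite ltr_wpDr.
move=> u y us cy dy oy h m hh mT; have /andP[hp _] := hh; have hp' := ltW hp.
have [c [cP err]] := H u y us cy dy oy h m hh mT.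
set hg := h `^ gam in cP err *; have hg0 : 0 <= hg by exact: powR_ge0.
have cc (i : 'I_m) : continuous (fun x => sqmodulus (fS (c i) x)).
  have [[B cB] _] := cP i (ltn_ord i); have [cr ci] := ccont_fS cB => x.
  rewrite /sqmodulus; under eq_fun do rewrite !expr2.
  by apply: cvgD; apply: cvgM; [exact: cr|exact: cr|exact: ci|exact: ci].
have ci (i : 'I_m) : (\int[@lebesgue_measure R]_(x in @torus R) sqmodulus (fS (c i) x))%R <=
    2 * pi * (h * (2 * (C1 * hg))) ^+ 2.
  have [[B cB] c2] := cP i (ltn_ord i); exact: fS_L2 cB c2.
have be0 : 0 <= 2 * (G * 36) ^+ 2 * m%:R by rewrite !mulr_ge0 ?sqr_ge0.
have [I1 I2] := Rintegral_torus_affine (enum 'I_m) (2 * (G * (T * hg * b)) ^+ 2) be0 cc ci.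
apply: integral_torus_le I2 _ => [x|x|].
- exact: sqr_ge0.
- have E0 := mn_ge0 (frame_num h (fS (u 0)) (y 0) m x - cmat (y (m%:R * h) x)).
  have S0 : 0 <= \sum_(i < m) cn (fS (c i) x) by apply: sumr_ge0 => i _; exact: cn_ge0.
  set p := G * (T * hg * b); set s := \sum_(i < m) cn (fS (c i) x) in S0.
  apply: (@le_trans _ _ ((p + G * 36 * s) ^+ 2)).
    rewrite (_ : p + _ = G * (T * hg * b + 36 * s)); last by rewrite /p; ring.
    by have := err x; rewrite -/s => {}err; rewrite lerXn2r ?nnegrE // (le_trans E0).
  apply: (@le_trans _ _ (2 * p ^+ 2 + 2 * (G * 36) ^+ 2 * s ^+ 2)).
    rewrite (_ : 2 * (G * 36) ^+ 2 * s ^+ 2 = 2 * (G * 36 * s) ^+ 2); last by ring.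
    by have := sqr_ge0 (p - G * 36 * s); move: p (G * 36 * s); clear; move=> p v; nra.
  rewrite lerD2l -[leRHS]mulrA ler_wpM2l ?mulr_ge0 ?sqr_ge0 // big_enum.
  under [X in _ <= _ * X]eq_bigr do rewrite sqmodulusE.
  by apply: sqr_sum_le => i; exact: cn_ge0.
apply: le_trans I1 _; rewrite size_enum_ord.
apply: (@le_trans _ _ (X * hg ^+ 2)).
  rewrite (_ : X * hg ^+ 2 = 2 * pi * (2 * (G * (T * hg * b)) ^+ 2) +
     2 * (G * 36) ^+ 2 * (2 * pi * (2 * C1) ^+ 2 * hg ^+ 2) * T ^+ 2); last by rewrite /X; ring.
  rewrite (_ : 2 * (G * 36) ^+ 2 * m%:R * _ =
     2 * (G * 36) ^+ 2 * (2 * pi * (2 * C1) ^+ 2 * hg ^+ 2) * (m%:R * h) ^+ 2); last by ring.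
  rewrite lerD2l ler_wpM2l //; first by do ?[by [] | exact: sqr_ge0 | exact: ltW | apply: mulr_ge0].
  by rewrite lerXn2r ?nnegrE ?mulr_ge0 // ltW.
by rewrite exprMn ler_wpM2r ?sqr_ge0 //; nra.
Qed.

Lemma is_derive_mx (f : R -> 'M[R]_3) t (D : 'M[R]_3) i j : is_derive t (1 : R) f D ->
  is_derive t (1 : R) (fun r => f r i j) (D i j).
Proof.
move=> [fd fD]; split; first exact: ((derivable_mxP f t 1).1 fd i j).
by rewrite -fD derive_mx // mxE.
Qed.

End GlobalL2Error.

Theorem corollary4p7 (R : realType) (gamma T Rsup : R)
    (hgamma : 2^-1 < gamma <= 1) (hT : 0 < T) :
  exists h0 C : R, 0 < h0 /\ 0 < C /\
  forall (u0 : R -> R[i]) (u : R -> R -> R[i])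
         (Tg e1 e2 : R -> R -> 'rV[R]_3) (Tg0 e10 e20 : R -> 'rV[R]_3),
    C0_sobolev T (1 + gamma) u ->
    nls_solution T u ->
    u 0 = u0 ->
    Rsup = sup [set sobolev_norm (1 + gamma) (u t) | t in `[0, T]%classic] ->
    C0_sobolev_row T 1 Tg ->
    C0_sobolev_row T 1 e1 ->
    C0_sobolev_row T 1 e2 ->
    frame_solution T u (fun t x => rows3 (Tg t x) (e1 t x) (e2 t x)) ->
    Tg 0 = Tg0 -> e1 0 = e10 -> e2 0 = e20 ->
    (forall x, orthonormal_rows (rows3 (Tg0 x) (e10 x) (e20 x))) ->
  forall (h : R) (M : nat), 0 < h < h0 -> M%:R = T / h ->
  forall m : nat, (m <= M)%N ->
    (L2_norm (fun x => (
       row ord0 (frame_num h u0 (fun z => rows3 (Tg0 z) (e10 z) (e20 z)) m x)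
       - map_mx (fun a : R => a%:C) (Tg (m%:R * h) x))%R)
     <= (C * h `^ gamma)%R%:E)%E.
Proof.
have /andP[g2 g1] := hgamma; have g0 : 0 <= gamma by lra.
(* The constants must be fixed before any solution is given, when the sign of [Rsup] is unknown;
   this radius is positive in all cases and at least [Rsup]. *)
have rho0 : 0 < `|Rsup| + 1 by rewrite ltr_wpDl.
have [h0 [C [h00 C0 H]]] := frame_L2_error hgamma rho0 hT.
exists h0, C; split=> //; split=> // u0 u Tg e1 e2 Tg0 e10 e20 uC nls u00 RE cT c1 c2 fs T00 e100 e200 on h M hh ME m mM.
have /andP[hp _] := hh.
have mT : m%:R * h <= T by rewrite -ler_pdivlMr // -ME ler_nat.
have s1 : 1 <= 1 + gamma by rewrite lerDl.
pose y t x := rows3 (Tg t x) (e1 t x) (e2 t x).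
pose v t := fourier (u t).
have us : seqsol T (`|Rsup| + 1) gamma v.
  apply: nls_seqsol => // t tT; apply: (@le_trans _ _ `|Rsup|); last by rewrite lerDl ler01.
  by rewrite RE (le_trans (sobolev_norm_bounded hT uC tT)) // ler_norm.
have uv t : 0 <= t <= T -> u t = fS (v t) by exact: (C0_sobolev_series s1 uC).
have cy x i j : ccon T (fun t => (y t x i j)%:C).
  have r0 (a b c : 'rV[R]_3) : rows3 a b c 0 j = a 0 j by rewrite mxE.
  have r1 (a b c : 'rV[R]_3) : rows3 a b c 1 j = b 0 j by rewrite mxE.
  have r2 (a b c : 'rV[R]_3) : rows3 a b c 2 j = c 0 j by rewrite mxE.
  elim/ord3_cases: i.
  - by under eq_fun do rewrite /y r0; exact: C0_sobolev_pointwise (lexx 1) (cT j).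
  - by under eq_fun do rewrite /y r1; exact: C0_sobolev_pointwise (lexx 1) (c1 j).
  - by under eq_fun do rewrite /y r2; exact: C0_sobolev_pointwise (lexx 1) (c2 j).
have dy x t i j : 0 < t < T ->
    is_cderive (fun r => (y r x i j)%:C) t ((frame_matrix (fS (v t)) x *m y t x) i j)%:C.
  move=> tT; have /andP[t0 tT'] := tT; apply: cder_real; rewrite -uv ?(ltW t0) ?(ltW tT') //.
  exact: is_derive_mx (fs t tT x).
have oy x : orthonormal_rows (y 0 x) by rewrite /y T00 e100 e200.
have u0E : u0 = fS (v 0) by rewrite -u00 -uv // lexx ltW.
have y0E : (fun z => rows3 (Tg0 z) (e10 z) (e20 z)) = y 0 by apply/funext => z; rewrite /y T00 e100 e200.
have {}H := H v y us cy dy oy h m hh mT.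
have Ch0 : 0 <= C * h `^ gamma by rewrite mulr_ge0 ?powR_ge0 // ltW.
rewrite u0E y0E /L2_norm.
set I := (\int[_]_(_ in _) _)%E.
have I0 : (0 <= I)%E.
  by apply: integral_ge0 => x _; rewrite lee_fin; apply: sumr_ge0 => j _; rewrite sqmodulusE; exact: sqr_ge0.
have IC : (I <= ((C * h `^ gamma) ^+ 2)%:E)%E.
  apply: le_trans H; apply: ge0_integral_mono => x _; rewrite lee_fin.
    by apply: sumr_ge0 => j _; rewrite sqmodulusE; exact: sqr_ge0.
  apply: le_trans (row_sqmodulus_le _ ord0); apply: ler_sum => j _.
  by rewrite !mxE.
have -> : (C * h `^ gamma)%:E = (((C * h `^ gamma) ^+ 2)%:E `^ 2^-1)%E.
  by rewrite poweR_EFin powR12_sqrt ?sqr_ge0 // sqrtr_sqr ger0_norm.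
by apply: gt0_ler_poweR; rewrite // in_itv /= leey ?I0 // lee_fin sqr_ge0.
Qed.
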